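(* Let $\alpha,\beta,L,C_Z>0$ and $\boldsymbol s\in\mathbb N_0^d$ with $|\boldsymbol s|\le\lfloor\alpha\rfloor$. Consider the functional data model with observations $Y_{i,\boldsymbol j}=\mu(\boldsymbol x_{\boldsymbol j})+Z_i(\boldsymbol x_{\boldsymbol j})+\varepsilon_{i,\boldsymbol j}$ ($i=1,\dots,n$, $\boldsymbol 1\le\boldsymbol j\le\boldsymbol p$) described in the context, under the regular design assumption and the sub-Gaussian error assumption, with $\mu\in\mathcal H(\alpha,L)$ and $Z\in\mathcal P(\beta,C_Z)$. Let $\hat\mu^{(\boldsymbol s)}_{n,\boldsymbol p,h}$ be the linear estimator of $\partial^{\boldsymbol s}\mu$, and suppose that its weights satisfy (M1)–(M4) with polynomial degree $m=\lfloor\alpha\rfloor$. Fix any $\beta_1$ with $0<\beta_1<\beta$ and set $\kappa=\min(|\boldsymbol s|,\beta_1)$ and $$a_{n,\boldsymbol p,h}=\max\Big(L\,h^{\alpha-|\boldsymbol s|},\ \zeta\,\sigma\sqrt{\frac{\log(h^{-1})}{n\,\boldsymbol p^{\boldsymbol 1}\,h^{d+2|\boldsymbol s|}}},\ \frac{C_Z}{\sqrt n\,h^{|\boldsymbol s|-\kappa}}\Big).$$ Then for sufficiently large $\boldsymbol p_{\min}$ and $n$, $$\sup_{h\in(c/\boldsymbol p_{\min},h_0]}\ \sup_{Z\in\mathcal P(\beta,C_Z),\,\mu\in\mathcal H(\alpha,L)}a_{n,\boldsymbol p,h}^{-1}\,\mathbb E_{\mu,Z}\Big[\big\|\hat\mu^{(\boldsymbol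 s)}_{n,\boldsymbol p,h}-\partial^{\boldsymbol s}\mu\big\|_\infty\Big]=\mathcal O(1),$$ where $c,h_0$ are the constants from the assumption on the weights.
   Context: Notation. $d\in\mathbb N$; for multi-indices/vectors, $\boldsymbol a\le\boldsymbol b$ is componentwise, $\boldsymbol a^{\boldsymbol b}=\prod_r a_r^{b_r}$, $|\boldsymbol a|=\sum_r a_r$, $\boldsymbol a!=\prod_r a_r!$, $\boldsymbol 1=(1,\dots,1)$, $\partial^{\boldsymbol s}=\partial_1^{s_1}\cdots\partial_d^{s_d}$. $\boldsymbol p=\boldsymbol p(n)=(p_1,\dots,p_d)$, $\boldsymbol p_{\min}=\min_r p_r$, $\boldsymbol p^{\boldsymbol 1}=\prod_r p_r$; $\sum_{\boldsymbol j=\boldsymbol 1}^{\boldsymbol p}$ is the sum over all $\boldsymbol 1\le\boldsymbol j\le\boldsymbol p$. $\|\cdot\|_\infty$ is the sup-norm on $[0,1]^d$ for functions and the maximum norm for vectors. $\lfloor\alpha\rfloor=\max\{k\in\mathbb N_0: k<\alpha\}$ (strict inequality). $\mathcal O(1)$ means: bounded by a constant, uniformly over all sufficiently large $n$ and $\boldsymbol p_{\min}$. Hölder class. $\|f\|_{\mathcal H,\alpha}=\max_{|\boldsymbol k|\le\lfloor\alpha\rfloor}\sup_{\boldsymbol x}|\partial^{\boldsymbol k}f(\boldsymbol x)|+\max_{|\boldsymbol k|=\lfloor\alpha\rfloor}\sup_{\boldsymbol x\ne\boldsymbol y}\frac{|\partial^{\boldsymbol k}f(\boldsymbol x)-\partial^{\boldsymbol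 k}f(\boldsymbol y)|}{\|\boldsymbol x-\boldsymbol y\|_\infty^{\alpha-\lfloor\alpha\rfloor}}$, with $\boldsymbol x,\boldsymbol y\in[0,1]^d$; $\mathcal H(\alpha,L)$ is the set of $f\in C^{\lfloor\alpha\rfloor}([0,1]^d)$ (derivatives up to order $\lfloor\alpha\rfloor$ in the interior, continuously extendable to $[0,1]^d$) with $\|f\|_{\mathcal H,\alpha}\le L$. Process class. $\mathcal P(\beta,C_Z)$ is the class of processes $Z$ on $[0,1]^d$ with paths differentiable up to order $\lfloor\beta\rfloor$ for which there is a random variable $M$ with $\|Z\|_{\mathcal H,\beta}\le M$ a.s. and $\mathbb E[M^2]\le C_Z$. Model. $Y_{i,\boldsymbol j}=\mu(\boldsymbol x_{\boldsymbol j})+Z_i(\boldsymbol x_{\boldsymbol j})+\varepsilon_{i,\boldsymbol j}$, $i=1,\dots,n$, $\boldsymbol 1\le\boldsymbol j\le\boldsymbol p$, where $\mu$ is deterministic, $Z_1,\dots,Z_n$ are i.i.d. copies of a centered process $Z$ with continuous paths, and $\varepsilon_{i,\boldsymbol j}$ are independent, centered, and independent of the $Z_i$. The fixed known design points $\boldsymbol x_{\boldsymbol j}=(x_{1,j_1},\dots,x_{d,j_d})\in[0,1]^d$, $1\le j_k\le p_k$, have Cartesian product structure with $x_{k,l}<x_{k,l+1}$, and may depend on $n$. Regular design assumption. There is $C_{\mathrm d}>0$ such that for all $\boldsymbol x\in[0,1]^d$, $h>0$: $\#\{\boldsymbol j:\boldsymbol x-(h,\dots,h)\le\boldsymbol x_{\boldsymbol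 j}\le\boldsymbol x+(h,\dots,h)\}\le C_{\mathrm d}h^d\boldsymbol p^{\boldsymbol 1}$. Sub-Gaussian error assumption. The $\varepsilon_{i,\boldsymbol j}$ are independent and independent of $Z_1,\dots,Z_n$, sub-Gaussian; with $\sigma_{i,\boldsymbol j}^2=\mathbb E[\varepsilon_{i,\boldsymbol j}^2]$, $\sigma^2=\sup_i\max_{\boldsymbol j}\sigma_{i,\boldsymbol j}^2<\infty$, and there is $\zeta>0$ such that $\zeta^2\sigma_{i,\boldsymbol j}^2$ bounds the sub-Gaussian parameter (variance proxy) of $\varepsilon_{i,\boldsymbol j}$. Linear estimator. $\hat\mu^{(\boldsymbol s)}_{n,\boldsymbol p,h}(\boldsymbol x)=\sum_{\boldsymbol j=\boldsymbol 1}^{\boldsymbol p}w^{(\boldsymbol s)}_{\boldsymbol j}(\boldsymbol x;h)\,\bar Y_{\boldsymbol j}$, $\bar Y_{\boldsymbol j}=\frac1n\sum_{i=1}^nY_{i,\boldsymbol j}$, with deterministic weights depending on the design points, the bandwidth $h>0$ and $\boldsymbol s$. Assumption on the weights, with degree $m\ge|\boldsymbol s|$. There are $c>0$, $h_0\in(0,1)$ and constants $C_1,C_2>0$ independent of $n,\boldsymbol p,h,\boldsymbol x$ such that for sufficiently large $\boldsymbol p_{\min}$ and all $h\in(c/\boldsymbol p_{\min},h_0]$: (M1) $\sum_{\boldsymbol j}(\boldsymbol x_{\boldsymbol j}-\boldsymbol x)^{\boldsymbol r}w^{(\boldsymbol s)}_{\boldsymbol j}(\boldsymbol x;h)=\delta_{\boldsymbol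 r,\boldsymbol s}\,\boldsymbol s!$ for all $\boldsymbol r\in\mathbb N_0^d$ with $|\boldsymbol r|\le m$ and all $\boldsymbol x\in[0,1]^d$ (equivalently, the weights reproduce the $\boldsymbol s$-th derivative of polynomials of degree $m$); (M2) $w^{(\boldsymbol s)}_{\boldsymbol j}(\boldsymbol x;h)=0$ if $\|\boldsymbol x-\boldsymbol x_{\boldsymbol j}\|_\infty>h$; (M3) $\max_{\boldsymbol j}|w^{(\boldsymbol s)}_{\boldsymbol j}(\boldsymbol x;h)|\le\frac{C_1}{\boldsymbol p^{\boldsymbol 1}h^{d+|\boldsymbol s|}}$ for $\boldsymbol x\in[0,1]^d$; (M4) $|w^{(\boldsymbol s)}_{\boldsymbol j}(\boldsymbol x;h)-w^{(\boldsymbol s)}_{\boldsymbol j}(\boldsymbol y;h)|\le\frac{C_2}{\boldsymbol p^{\boldsymbol 1}h^{d+|\boldsymbol s|}}\min\big(\frac{\|\boldsymbol x-\boldsymbol y\|_\infty}{h},1\big)$ for $\boldsymbol x,\boldsymbol y\in[0,1]^d$.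
   Formalization: The regular design bound is required only for h ≥ 1/p_min instead of all h > 0, since as printed it cannot hold: around a design point the count is at least 1 while C_d h^d p^1 tends to 0 as h → 0. *)

(* Defs.v *)
From HB Require Import structures.
From mathcomp Require Import all_boot all_order all_algebra.
From mathcomp Require Import all_classical all_reals all_analysis.

Set Implicit Arguments.
Unset Strict Implicit.
Unset Printing Implicit Defensive.

Import Order.TTheory GRing.Theory Num.Theory.
Import numFieldNormedType.Exports.

Local Open Scope classical_set_scope.
Local Open Scope ring_scope.

(** Points of R^d are row vectors ['rV[R]_d], whose
    norm [`|x|] is the maximum norm; multi-indices are [{ffun 'I_d -> nat}].
    Functions on [0,1]^d are total functions on ['rV[R]_d] of which only the
    values on [cube] are ever used. *)

Definition multi_size (d : nat) (k : {ffun 'I_d -> nat}) : nat :=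
  (\sum_(r < d) k r)%N.

Definition multi_fact (d : nat) (k : {ffun 'I_d -> nat}) : nat :=
  (\prod_(r < d) (k r)`!)%N.

Definition multi_pow (R : realType) (d : nat) (v : 'rV[R]_d)
    (k : {ffun 'I_d -> nat}) : R :=
  \prod_(r < d) v ord0 r ^+ k r.

(** The inequality is strict: [sfloor 1 = 0]; see [sfloorP] for [0 < a]. *)
Definition sfloor (R : realType) (a : R) : nat :=
  (\max_(k < (Num.truncn a).+1 | ((k : nat)%:R < a)%R) k)%N.

Lemma sfloorP (R : realType) (a : R) : 0 < a ->
  (sfloor a)%:R < a /\ (forall k : nat, k%:R < a -> (k <= sfloor a)%N).
Proof.
move=> a0; split.
  rewrite /sfloor; elim/big_ind: _ => // x y xa ya.
  by rewrite /maxn; case: ifP.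
move=> k ka.
have kt : (k < (Num.truncn a).+1)%N.
  by rewrite ltnS; rewrite truncn_ge_nat ?ltW.
exact: (@leq_bigmax_cond _ (fun i : 'I_ _ => ((i : nat)%:R < a)%R)
  (fun i => nat_of_ord i) (Ordinal kt)).
Qed.

Definition cube (R : realType) (d : nat) : set 'rV[R]_d :=
  [set x | forall r, 0 <= x ord0 r <= 1].

Definition open_cube (R : realType) (d : nat) : set 'rV[R]_d :=
  [set x | forall r, 0 < x ord0 r < 1].

Definition basis_vec (R : realType) (d : nat) (r : 'I_d) : 'rV[R]_d :=
  delta_mx ord0 r.

Definition partial (R : realType) (d : nat) (r : 'I_d) (f : 'rV[R]_d -> R) :
    'rV[R]_d -> R :=
  fun x => 'D_(basis_vec R r) f x.

(** [iter_partial [:: r1; ...; rk] f] is d_{r1} (... (d_{rk} f)). *)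
Definition iter_partial (R : realType) (d : nat) (l : seq 'I_d)
    (f : 'rV[R]_d -> R) : 'rV[R]_d -> R :=
  foldr (@partial R d) f l.

Definition pderiv (R : realType) (d : nat) (k : {ffun 'I_d -> nat})
    (f : 'rV[R]_d -> R) : 'rV[R]_d -> R :=
  iter_partial (flatten [seq nseq (k r) r | r <- enum 'I_d]) f.

(** The continuous extension of [pderiv k f] from the open to the closed cube. *)
Definition cube_pderiv (R : realType) (d : nat) (k : {ffun 'I_d -> nat})
    (f : 'rV[R]_d -> R) (x : 'rV[R]_d) : R :=
  lim (pderiv k f @ within (@open_cube R d) (nbhs x)).

(** C^m([0,1]^d): all partial derivatives up to order [m], taken in any order,
    exist in the interior and have a continuous extension to the closed cube. *)
Definition cube_Cm (R : realType) (d m : nat) (f : 'rV[R]_d -> R) : Prop :=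
  [/\ {within @cube R d, continuous f},
      forall (l : seq 'I_d) (r : 'I_d) (x : 'rV[R]_d),
        (size l < m)%N -> open_cube x ->
        derivable (iter_partial l f) x (basis_vec R r)
    & forall l : seq 'I_d, (size l <= m)%N ->
        exists g : 'rV[R]_d -> R,
          {within @cube R d, continuous g} /\
          {in @open_cube R d, g =1 iter_partial l f} ].

Definition sup_norm (R : realType) (d : nat) (f : 'rV[R]_d -> R) : \bar R :=
  ereal_sup [set (`|f x|)%:E | x in @cube R d].

Definition holder_seminorm (R : realType) (d : nat) (gamma : R)
    (f : 'rV[R]_d -> R) : \bar R :=
  ereal_sup [set (`|f z.1 - f z.2| / `|z.1 - z.2| `^ gamma)%:E
            | z in [set z | [/\ cube z.1, cube z.2 & z.1 != z.2]]].

Definition holder_norm (R : realType) (d : nat) (a : R) (f : 'rV[R]_d -> R) :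
    \bar R :=
  (ereal_sup [set sup_norm (cube_pderiv k f)
             | k in [set k | (multi_size k <= sfloor a)%N]] +
   ereal_sup [set holder_seminorm (a - (sfloor a)%:R) (cube_pderiv k f)
             | k in [set k | multi_size k = sfloor a]])%E.

Definition holder_class (R : realType) (d : nat) (a L : R)
    (f : 'rV[R]_d -> R) : Prop :=
  cube_Cm (sfloor a) f /\ (holder_norm a f <= L%:E)%E.

(** The class P(b, CZ): the paths are C^(sfloor b) on the cube, and their Hoelder
    norm is a.s. below a random variable M with E[M^2] <= CZ. *)
Definition process_class (R : realType) (d : nat) (dO : measure_display)
    (Omega : measurableType dO) (P : probability Omega R) (b CZ : R)
    (Z : Omega -> 'rV[R]_d -> R) : Prop :=
  [/\ forall x, cube x -> measurable_fun setT (Z ^~ x),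
      forall w, cube_Cm (sfloor b) (Z w)
    & exists M : Omega -> R,
        [/\ measurable_fun setT M,
            {ae P, forall w, (holder_norm b (Z w) <= (M w)%:E)%E}
          & ('E_P[fun w => (M w ^+ 2)%R] <= CZ%:E)%E ] ].

Definition centered (R : realType) (dO : measure_display)
    (Omega : measurableType dO) (P : probability Omega R)
    (X : Omega -> R) : Prop :=
  P.-integrable setT (EFin \o X) /\ ('E_P[X] = 0)%E.

(** Equality of the finite-dimensional distributions on the cube; it suffices
    to compare them on measurable rectangles. *)
Definition same_law (R : realType) (d : nat) (dO : measure_display)
    (Omega : measurableType dO) (P : probability Omega R)
    (Z Z' : Omega -> 'rV[R]_d -> R) : Prop :=
  forall (m : nat) (t : 'I_m -> 'rV[R]_d) (B : 'I_m -> set R),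
    (forall k, cube (t k)) -> (forall k, measurable (B k)) ->
    P [set w | forall k, B k (Z w (t k))] =
    P [set w | forall k, B k (Z' w (t k))].

Definition sigma_variable (R : realType) (dO : measure_display)
    (Omega : measurableType dO) (X : Omega -> R) : set_system Omega :=
  preimage_set_system setT X measurable.

Definition sigma_process (R : realType) (d : nat) (dO : measure_display)
    (Omega : measurableType dO) (Z : Omega -> 'rV[R]_d -> R) :
    set_system Omega :=
  <<s \bigcup_(x in @cube R d) sigma_variable (Z ^~ x) >>.

Definition mutually_independent (R : realType) (dO : measure_display)
    (Omega : measurableType dO) (P : probability Omega R) (I : finType)
    (F : I -> set_system Omega) : Prop :=
  forall (J : {set I}) (E : I -> set Omega),
    (forall k, k \in J -> F k (E k)) ->
    P (\bigcap_(k in [set` J]) E k) = (\prod_(k in J) P (E k))%E.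

(** [v] bounds the variance proxy of [X]. *)
Definition sub_gaussian (R : realType) (dO : measure_display)
    (Omega : measurableType dO) (P : probability Omega R)
    (v : R) (X : Omega -> R) : Prop :=
  forall t : R, ('E_P[fun w => expR (t * X w)%R] <= (expR (v * t ^+ 2 / 2)%R)%:E)%E.

Definition variance0 (R : realType) (dO : measure_display)
    (Omega : measurableType dO) (P : probability Omega R)
    (X : Omega -> R) : \bar R :=
  ('E_P[fun w => (X w ^+ 2)%R])%E.

(** Multi-indices 1 <= j <= p, shifted to start at 0. *)
Definition grid (d : nat) (p : 'I_d -> nat) : finType :=
  {dffun forall r : 'I_d, 'I_(p r)}.

Definition grid_card (d : nat) (p : 'I_d -> nat) : nat :=
  (\prod_(r < d) p r)%N.

(** The default value, an upper bound of all the [p r], is neutral for [0 < d]. *)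
Definition pmin (d : nat) (p : 'I_d -> nat) : nat :=
  \big[minn/(\max_(r < d) p r)%N]_(r < d) p r.

Definition design_point (R : realType) (d : nat) (p : 'I_d -> nat)
    (xi : forall r : 'I_d, 'I_(p r) -> R) (j : grid p) : 'rV[R]_d :=
  \row_r xi r (j r).

Definition product_design (R : realType) (d : nat) (p : 'I_d -> nat)
    (xi : forall r : 'I_d, 'I_(p r) -> R) : Prop :=
  (forall r l, 0 <= xi r l <= 1) /\
  (forall r (l l' : 'I_(p r)), (l < l')%N -> xi r l < xi r l').

(** The window half-width is restricted to [1 / pmin <= h]: for a non-empty
    design no bound C h^d p^1 on the number of design points in a window can
    hold as h -> 0.  Any other threshold c / pmin gives the same
    condition up to the value of [Cd]. *)
Definition regular_design (R : realType) (d : nat) (p : nat -> 'I_d -> nat)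
    (xi : forall n (r : 'I_d), 'I_(p n r) -> R) : Prop :=
  exists Cd : R, 0 < Cd /\
    forall (n : nat) (x : 'rV[R]_d) (h : R),
      cube x -> 0 < h -> (pmin (p n))%:R^-1 <= h ->
      #|[set j : grid (p n) | [forall r,
          x ord0 r - h <= design_point (xi n) j ord0 r <= x ord0 r + h]]|%:R
        <= Cd * h ^+ d * (grid_card (p n))%:R.

(** [w n j x h] is the weight of the [j]-th design point at location [x] and
    bandwidth [h], for sample size [n]. *)
Definition weights_assumption (R : realType) (d : nat)
    (s : {ffun 'I_d -> nat}) (m : nat) (p : nat -> 'I_d -> nat)
    (xi : forall n (r : 'I_d), 'I_(p n r) -> R)
    (w : forall n, grid (p n) -> 'rV[R]_d -> R -> R) (c h0 : R) : Prop :=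
  exists (C1 C2 : R) (p0 : nat), [/\ 0 < C1, 0 < C2 &
    forall (n : nat) (h : R), (p0 <= pmin (p n))%N ->
      c / (pmin (p n))%:R < h -> h <= h0 ->
      let scale := (grid_card (p n))%:R * h ^+ (d + multi_size s) in
      [/\ forall (r : {ffun 'I_d -> nat}) (x : 'rV[R]_d),
            (multi_size r <= m)%N -> cube x ->
            \sum_(j : grid (p n))
               multi_pow (design_point (xi n) j - x) r * w n j x h =
            (r == s)%:R * (multi_fact s)%:R,
          forall (j : grid (p n)) (x : 'rV[R]_d), cube x ->
            h < `|x - design_point (xi n) j| -> w n j x h = 0,
          forall (j : grid (p n)) (x : 'rV[R]_d), cube x ->
            `|w n j x h| <= C1 / scale
        & forall (j : grid (p n)) (x y : 'rV[R]_d), cube x -> cube y ->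
            `|w n j x h - w n j y h| <=
              C2 / scale * Num.min (`|x - y| / h) 1 ] ].

(** "The Z_i are i.i.d. copies of Z" is stated without a separate Z: the Z_i
    have the same law, and each of them is centered and in P(b, CZ), membership
    being a property of the law of the paths.  The last clause packs together
    the independence of the Z_i, that of the errors, and that of the two
    families. *)
Definition functional_data (R : realType) (d : nat) (dO : measure_display)
    (Omega : measurableType dO) (P : probability Omega R) (b CZ zeta : R)
    (n : nat) (p : 'I_d -> nat)
    (Z : 'I_n -> Omega -> 'rV[R]_d -> R)
    (eps : 'I_n -> grid p -> Omega -> R) : Prop :=
  [/\ forall i, process_class P b CZ (Z i) /\
        (forall x, cube x -> centered P (Z i ^~ x)),
      forall i i', same_law P (Z i) (Z i'),
      forall i j, [/\ measurable_fun setT (eps i j), centered P (eps i j),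
        (variance0 P (eps i j) < +oo)%E &
        sub_gaussian P (zeta ^+ 2 * fine (variance0 P (eps i j))) (eps i j)]
    & mutually_independent P
        (fun k : 'I_n + 'I_n * grid p =>
           match k with
           | inl i => sigma_process (Z i)
           | inr ij => sigma_variable (eps ij.1 ij.2)
           end) ].

Definition noise_sd (R : realType) (d : nat) (dO : measure_display)
    (Omega : measurableType dO) (P : probability Omega R)
    (n : nat) (p : 'I_d -> nat) (eps : 'I_n -> grid p -> Omega -> R) : R :=
  Num.sqrt (\big[Num.max/0]_(i < n) \big[Num.max/0]_(j : grid p)
    fine (variance0 P (eps i j))).

Definition observation (R : realType) (d : nat) (Omega : Type)
    (n : nat) (p : 'I_d -> nat) (xi : forall r : 'I_d, 'I_(p r) -> R)
    (mu : 'rV[R]_d -> R) (Z : 'I_n -> Omega -> 'rV[R]_d -> R)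
    (eps : 'I_n -> grid p -> Omega -> R) (i : 'I_n) (j : grid p)
    (om : Omega) : R :=
  mu (design_point xi j) + Z i om (design_point xi j) + eps i j om.

Definition linear_estimator (R : realType) (d : nat) (Omega : Type)
    (n : nat) (p : 'I_d -> nat) (w : grid p -> 'rV[R]_d -> R -> R)
    (Y : 'I_n -> grid p -> Omega -> R) (h : R) (om : Omega)
    (x : 'rV[R]_d) : R :=
  \sum_(j : grid p) w j x h * (n%:R^-1 * \sum_(i < n) Y i j om).

Definition rate (R : realType) (d : nat) (a b1 L CZ zeta sigma : R)
    (s : {ffun 'I_d -> nat}) (n : nat) (p : 'I_d -> nat) (h : R) : R :=
  let S := multi_size s in
  let kappa := Num.min S%:R b1 in
  Num.max (L * h `^ (a - S%:R))
   (Num.max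
     (zeta * sigma *
        Num.sqrt (ln h^-1 / (n%:R * (grid_card p)%:R * h ^+ (d + 2 * S))))
     (CZ / (Num.sqrt n%:R * h `^ (S%:R - kappa)))).

(* Main.v *)
(** Write G f (x) = sum_j w_j(x) f(x_j).  The estimation error is a bias term plus
    G applied to the averaged processes plus the averaged noise.

    Bias: Taylor's formula, applied one coordinate at a time, so that only the
    partial derivatives in the order used by [pderiv] occur and no symmetry of
    second derivatives is needed; the moment conditions (M1) then turn G of the
    Taylor polynomial into the derivative of order s.

    Both random terms are handled by dyadic chaining on the cube.  The finite
    maxima are bounded through the soft maximum phi(u) = ln (sum_t exp (l u_t)) / l.
    For the noise, exponential moments suffice.  For the processes only second
    moments are available, and phi(u + v) <= phi(u) + <phi'(u), v> + 8 l max|v|^2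
    shows that adding an independent centered vector v raises the expectation of
    phi by at most 8 l E max|v|^2; this replaces symmetrization.

    If |s| <= beta1, then G f is Hoelder continuous uniformly in the bandwidth h:
    at distances larger than a power of h it is compared with the smoother of a
    larger bandwidth.  If |s| > beta1, then G f has size h^(min(beta,|s|)-|s|), and
    the margin beta - beta1 absorbs the logarithm due to chaining. *)

Require Import Defs.
From HB Require Import structures.
From mathcomp Require Import all_boot all_order all_algebra.
From mathcomp Require Import all_classical all_reals all_analysis.
From mathcomp Require Import measurable_realfun ring lra zify.

Set Implicit Arguments.
Unset Strict Implicit.
Unset Printing Implicit Defensive.

Import Order.TTheory GRing.Theory Num.Theory.
Import numFieldNormedType.Exports.

Local Open Scope classical_set_scope.
Local Open Scope ring_scope.

(** The supremum over the cube is not known to be measurable, so each random term is dominated, off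
    a null set, by a measurable majorant [V], and only [V] is integrated. A chain starting at level
    [k0] costs a factor [Num.sqrt k0.+1], since ln of the number of grid points grows linearly in
    the level. The noise weights vary at scale h, so 2^-k0 is about h and this factor is the square
    root of ln(1/h) in the rate. The process term of the rate has no logarithm, while the evident
    Lipschitz constant h^-(|s|+1) of G f would again start the chain at depth ln(1/h); hence for |s|
    <= beta1 the increments are bounded uniformly in h, and k0 = 0. The smoothness beta of the
    processes is unrelated to the degree m of the weights. Taylor and bias estimates are therefore
    proved for any exponent a, with order min(m, sfloor a) and rate exponent min(a, m+1), also for
    |s| > sfloor a, where the weights annihilate the Taylor polynomial. The same estimate then
    serves mu and the paths of Z. *)

(** * Domination of integrals and independence of sigma-algebras *)

(** Viewing [f] on the same set with a smaller sigma-algebra lets measurability of sums, products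
    and exponentials over a sub-sigma-algebra follow from the usual closure properties. *)
Lemma sub_g_sigma_algebraTypeP (R : realType) (dO : measure_display)
    (Omega : measurableType dO) (F : set_system Omega) (f : Omega -> R) :
  measurable_fun setT (f : g_sigma_algebraType F -> R) <->
  forall B, measurable B -> <<s F >> (f @^-1` B).
Proof.
split=> [mf B mB|mf _ B mB]; last by rewrite setTI; exact: mf.
by have := mf measurableT B mB; rewrite setTI.
Qed.

(** [f] need not be measurable: its integral is a supremum over simple functions. *)
Lemma ae_le_integral_ge0 (R : realType) (dO : measure_display)
    (Omega : measurableType dO) (mu : {measure set Omega -> \bar R})
    (f g : Omega -> \bar R) :
  (forall w, 0 <= f w)%E -> (forall w, 0 <= g w)%E -> measurable_fun setT g ->
  {ae mu, forall w, (f w <= g w)%E} ->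
  (\int[mu]_w f w <= \int[mu]_w g w)%E.
Proof.
move=> f0 g0 mg [N [mN N0 fgN]].
have le1 (u v : Omega -> \bar R) : (forall w, 0 <= u w)%E ->
    (forall w, u w <= v w)%E -> (\int[mu]_w u w <= \int[mu]_w v w)%E.
  move=> u0 uv.
  have v0 w : (0 <= v w)%E by apply: le_trans (uv w).
  rewrite !ge0_integralTE//; apply: le_ereal_sup => _ [h hu <-].
  by exists h => // w; apply: le_trans (hu w) _.
(* Adding [+oo] on the exceptional set makes the domination hold everywhere without changing the
   integral of [g]. *)
pose v w := (g w + (if w \in N then +oo else 0))%E.
have mI : measurable_fun setT (fun w => if w \in N then +oo else 0 : \bar R)%E.
  apply: (measurable_fun_if) => //.
  by apply: (measurable_fun_bool true); rewrite preimage_mem_true setTI.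
have : (\int[mu]_w f w <= \int[mu]_w v w)%E.
  apply: le1 => // w; rewrite /v; case: ifPn => wN.
    by rewrite addey ?leey// gt_eqF// (lt_le_trans _ (g0 w)) ?ltNy0.
  rewrite adde0; apply: contrapT => h.
  by move/negP: wN; apply; rewrite inE; apply: fgN.
move=> /le_trans; apply.
rewrite (_ : \int[mu]_w g w = \int[mu]_w v w)%E //.
apply: ae_eq_integral => //; first exact: emeasurable_funD.
exists N; split => // w; apply: contra_notP => wN /= _.
by rewrite /v memNset// adde0.
Qed.

(** The law of [w |-> (w, w)] on the product of the two sigma-algebras is a product measure. *)
Lemma indep_integralM (R : realType) (dO : measure_display)
    (Omega : measurableType dO) (P : probability Omega R)
    (F G : set_system Omega) (f g : Omega -> \bar R) :
  <<s F >> `<=` measurable -> <<s G >> `<=` measurable ->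
  (forall A B, <<s F >> A -> <<s G >> B -> P (A `&` B) = (P A * P B)%E) ->
  (forall w, 0 <= f w)%E -> (forall w, 0 <= g w)%E ->
  measurable_fun setT (f : g_sigma_algebraType F -> \bar R) ->
  measurable_fun setT (g : g_sigma_algebraType G -> \bar R) ->
  (\int[P]_w (f w * g w) = (\int[P]_w f w) * (\int[P]_w g w))%E.
Proof.
move=> hF hG ind f0 g0 mf mg.
pose T1 : measurableType _ := g_sigma_algebraType F.
pose T2 : measurableType _ := g_sigma_algebraType G.
pose i1 : Omega -> T1 := id.
pose i2 : Omega -> T2 := id.
have mi1 : measurable_fun setT i1 by move=> _ B mB; rewrite setTI; exact: hF.
have mi2 : measurable_fun setT i2 by move=> _ B mB; rewrite setTI; exact: hG.
pose mi1' := isMeasurableFun.Build _ _ _ _ _ mi1.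
pose mi2' := isMeasurableFun.Build _ _ _ _ _ mi2.
pose I1 : {mfun Omega >-> T1} := HB.pack i1 mi1'.
pose I2 : {mfun Omega >-> T2} := HB.pack i2 mi2'.
pose m1 := distribution P I1.
pose m2 := distribution P I2.
pose phi : Omega -> T1 * T2 := fun w => (i1 w, i2 w).
have mphi : measurable_fun setT phi by apply/measurable_fun_pairP; split.
pose mphi' := isMeasurableFun.Build _ _ _ _ _ mphi.
pose Phi : {mfun Omega >-> (T1 * T2)%type} := HB.pack phi mphi'.
pose m := distribution P Phi.
have mE X : measurable X -> (m1 \x m2)%E X = m X.
  apply: product_measure_unique => A B mA mB.
  exact: ind mA mB.
pose h (z : T1 * T2) := (f z.1 * g z.2)%E.
have mh : measurable_fun setT h.
  pose f1 : T1 -> \bar R := f; pose g1 : T2 -> \bar R := g.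
  have mf1 : measurable_fun setT f1 by exact: mf.
  have mg1 : measurable_fun setT g1 by exact: mg.
  apply: (@emeasurable_funM _ _ _ _ (f1 \o fst) (g1 \o snd)).
    by apply: measurableT_comp.
  by apply: measurableT_comp.
have h0 z : (0 <= h z)%E by apply: mule_ge0.
have -> : (\int[P]_w (f w * g w) = \int[m]_z h z)%E.
  by rewrite ge0_integral_distribution.
rewrite (@eq_measure_integral _ _ _ _ (m1 \x m2)%E); last first.
  by move=> A mA _; apply/esym; exact: mE.
rewrite fubini_tonelli1//.
have -> : (\int[P]_w f w = \int[m1]_w f w)%E.
  by rewrite (@ge0_integral_distribution _ _ _ _ _ P I1 f).
have -> : (\int[P]_w g w = \int[m2]_w g w)%E.
  by rewrite (@ge0_integral_distribution _ _ _ _ _ P I2 g).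
have ig0 : (0 <= \int[m2]_w g w)%E by apply: integral_ge0.
rewrite -ge0_integralZr//.
apply: eq_integral => x _.
by rewrite /fubini_F /h /= ge0_integralZl.
Qed.

(** The maps A -> P(A and B) and A -> P(A) P(B) are finite measures. Independence makes them agree
    on the intersections of events from the [F i] with i in J, a pi-system generating the joint
    sigma-algebra, hence on all of it. *)
Lemma mutually_independent_group (R : realType) (dO : measure_display)
    (Omega : measurableType dO) (P : probability Omega R) (I : finType)
    (F : I -> set_system Omega) (J : {set I}) (k : I) (A B : set Omega) :
  (forall i, sigma_algebra setT (F i)) -> (forall i, F i `<=` measurable) ->
  mutually_independent P F -> k \notin J ->
  <<s \bigcup_(i in [set` J]) F i >> A -> F k B -> P (A `&` B) = (P A * P B)%E.
Proof.
move=> sF mF ind kJ sA FB.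
have FT i : F i setT.
  by case: (sF i) => F0 FC _; rewrite -(setD0 setT); exact: FC.
have FI i X Y : F i X -> F i Y -> F i (X `&` Y).
  move=> FX FY; rewrite -(sigma_algebra_id (sF i)) in FX FY *.
  exact: (@measurableI _ (g_sigma_algebraType (F i)) X Y).
pose G : set_system Omega := [set X | exists E : I -> set Omega,
  (forall i, i \in J -> F i (E i)) /\ X = \bigcap_(i in [set` J]) E i].
have GI : setI_closed G.
  move=> _ _ [E [FE ->]] [E' [FE' ->]]; exists (fun i => E i `&` E' i).
  by split; [move=> i iJ; apply: FI; [exact: FE|exact: FE']|rewrite bigcapI].
have mG : G `<=` measurable.
  move=> _ [E [FE ->]]; apply: fin_bigcap_measurable => // i iJ.
  by apply: mF; exact: FE.
have GT : G setT.
  by exists (fun=> setT); split => //; rewrite bigcapT.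
have sFG : <<s \bigcup_(i in [set` J]) F i >> `<=` <<s G >>.
  apply: smallest_sub; first exact: smallest_sigma_algebra.
  move=> X [i /= iJ FX]; apply: sub_sigma_algebra.
  exists (fun j => if j == i then X else setT); split.
    by move=> j _; case: eqP => // ->.
  rewrite eqEsubset; split=> [w Xw j _|w /(_ i iJ)]; last by rewrite eqxx.
  by case: eqP.
have mB : measurable B by exact: mF FB.
have r0 : 0 <= fine (P B) by rewrite fine_ge0.
pose m1 := mrestr P mB.
pose m2 := mscale (NngNum r0) P.
have PBfin : P B \is a fin_num by rewrite fin_num_measure.
have m1m2 X : G X -> m1 X = m2 X.
  move=> [E [FE ->]].
  (* [E'] places [B] in slot [k], which is free because [k] is not in [J]; independence is then used
     once over [k |: J] and once over [J]. *)
  pose E' i := if i == k then B else E i.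
  have EE' i : i \in J -> E' i = E i.
    by rewrite /E'; case: eqP => // ->; rewrite (negbTE kJ).
  have FE' i : i \in k |: J -> F i (E' i).
    rewrite in_setU1 /E'; case: eqP => [->//|_ /=]; exact: FE.
  have capE : \bigcap_(i in [set` J]) E i = \bigcap_(i in [set` J]) E' i.
    by apply: eq_bigcapr => i /= iJ; rewrite EE'.
  have := ind (k |: J) E' FE'.
  rewrite big_setU1//=.
  rewrite -ind; last by move=> i iJ; apply: FE'; rewrite in_setU1 iJ orbT.
  rewrite -capE (_ : E' k = B); last by rewrite /E' eqxx.
  rewrite /m1 /m2 /mrestr /mscale /= fineK// => <-; congr (P _).
  rewrite eqEsubset; split=> [w [Ew Bw] i /=|w E'w].
    rewrite in_setU1 => /orP[/eqP->|iJ]; first by rewrite /E' eqxx.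
    by rewrite EE'//; exact: Ew.
  split=> [i /= iJ|]; last by have := E'w k; rewrite /E' eqxx; apply; rewrite /= setU11.
  by rewrite -EE'//; apply: E'w; rewrite /= in_setU1 iJ orbT.
have -> : (P A * P B)%E = m2 A by rewrite /m2 /mscale /= fineK// muleC.
apply: (@g_sigma_algebra_measure_unique _ _ _ G mG (fun=> setT) _ _ m1 m2 GI m1m2) => //.
- by rewrite bigcup_const.
- by move=> _; rewrite (le_lt_trans (probability_le1 P _)) ?ltry//=; exact: measurableI.
- exact: sFG.
Qed.

(** * The soft maximum and its second-order expansion *)

(** The linear term disappears when averaged with weights of mean zero, leaving only a Gaussian
    factor, whatever the size of z. For z <= 1 the bound comes from e^(z/2) (1 - z/2) <= 1 by
    squaring; for z > 1 the right exponential alone exceeds e^z. *)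
Lemma expR_le_quad (R : realType) (z : R) : expR z <= z + expR (2 * z ^+ 2).
Proof.
have [z1|z1] := leP z 1; last first.
  have : expR z <= expR (2 * z ^+ 2) by rewrite ler_expR; nra.
  by move: z1; lra.
have h : expR (z / 2) * (1 - z / 2) <= 1.
  rewrite -[leRHS](expRxMexpNx_1 (z / 2)) ler_pM2l ?expR_gt0//.
  by have := expR_ge1Dx (- (z / 2)); lra.
have e : expR z = expR (z / 2) ^+ 2 by rewrite expr2 -expRD; congr expR; lra.
have q : 1 + 2 * z ^+ 2 <= expR (2 * z ^+ 2) := expR_ge1Dx _.
suff : expR z <= 1 + z + 2 * z ^+ 2 by move: q; lra.
rewrite e.
have y0 := expR_gt0 (z / 2).
set y := expR (z / 2) in h y0 *.
have p0 : 0 < 1 - z / 2 by lra.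
have h2 : (y * (1 - z / 2)) ^+ 2 <= 1 by rewrite expr_le1// mulr_ge0// ltW.
(* The excess over 1 factors as z^2 (1 - z) (5 - 2 z) / 4, which is nonnegative for z <= 1. *)
have p : 1 <= (1 + z + 2 * z ^+ 2) * (1 - z / 2) ^+ 2.
  have -> : (1 + z + 2 * z ^+ 2) * (1 - z / 2) ^+ 2 =
    1 + z ^+ 2 * ((1 - z) * (5 - 2 * z) / 4) by field.
  by rewrite lerDl; apply: mulr_ge0; [exact: sqr_ge0|nra].
rewrite -(@ler_pM2r _ ((1 - z / 2) ^+ 2)) ?exprn_gt0//.
by rewrite -exprMn (le_trans h2).
Qed.

Section softmax.
Variables (R : realType) (T : finType).
Implicit Types (l b : R) (s u : T -> R).

Definition softsum l s : R := \sum_t expR (l * s t).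
Definition softmax l s : R := ln (softsum l s) / l.
Definition softweight l s t : R := expR (l * s t) / softsum l s.

Hypothesis T0 : (0 < #|T|)%N.

Lemma softsum_gt0 l s : 0 < softsum l s.
Proof.
have /card_gt0P[t _] := T0.
rewrite /softsum (bigD1 t)//= ltr_pwDl ?expR_gt0//.
by rewrite sumr_ge0// => i _; rewrite expR_ge0.
Qed.

Lemma softweight_ge0 l s t : 0 <= softweight l s t.
Proof. by rewrite divr_ge0 ?expR_ge0// ltW// softsum_gt0. Qed.

Lemma softweight_sum l s : \sum_t softweight l s t = 1.
Proof. by rewrite -mulr_suml divff// gt_eqF// softsum_gt0. Qed.

Lemma softweight_le1 l s t : softweight l s t <= 1.
Proof.
rewrite -(softweight_sum l s) (bigD1 t)//= lerDl.
by rewrite sumr_ge0// => i _; rewrite softweight_ge0.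
Qed.

Lemma le_softmax l s t : 0 < l -> s t <= softmax l s.
Proof.
move=> l0; rewrite ler_pdivlMr// mulrC -[leLHS]expRK ler_ln ?posrE ?expR_gt0 ?softsum_gt0//.
rewrite /softsum (bigD1 t)//= lerDl.
by rewrite sumr_ge0// => i _; rewrite expR_ge0.
Qed.

Lemma softmax0 l : softmax l (fun=> 0) = ln #|T|%:R / l.
Proof.
rewrite /softmax /softsum mulr0 expR0 sumr_const.
by congr (ln _ / _); rewrite -mulr_natl mulr1.
Qed.

(** [softweight] is the gradient of [softmax]. Factoring out e^(l m), with m the weighted mean of
    [u], leaves centered exponents of size at most 2 l b; [expR_le_quad] bounds their average by
    exp(2 (2 l b)^2), and division of the exponent by l gives 8 l b^2. *)
Lemma softmaxD l s u b : 0 < l -> (forall t, `|u t| <= b) ->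
  softmax l (fun t => s t + u t) <=
  softmax l s + \sum_t softweight l s t * u t + 8 * l * b ^+ 2.
Proof.
move=> l0 ub.
set m := \sum_t softweight l s t * u t.
have mb : `|m| <= b.
  rewrite /m (le_trans (ler_norm_sum _ _ _))//.
  apply: (@le_trans _ _ (\sum_t softweight l s t * b)).
    apply: ler_sum => t _; rewrite normrM ger0_norm ?softweight_ge0//.
    by rewrite ler_wpM2l ?softweight_ge0.
  by rewrite -mulr_suml softweight_sum mul1r.
have S0 := softsum_gt0 l s.
have sumE : softsum l (fun t => s t + u t) =
    softsum l s * expR (l * m) * \sum_t softweight l s t * expR (l * (u t - m)).
  rewrite mulr_sumr; apply: eq_bigr => t _.
  rewrite /softweight mulrBr expRD expRN mulrDr expRD.
  have := expR_gt0 (l * m); move: S0.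
  move: (softsum l s) (expR (l * m)) => a c a0 c0.
  by field; rewrite !gt_eqF.
have key : \sum_t softweight l s t * expR (l * (u t - m)) <=
    expR (8 * (l * b) ^+ 2).
  apply: (@le_trans _ _ (\sum_t (l * (softweight l s t * u t - softweight l s t * m) +
      softweight l s t * expR (8 * (l * b) ^+ 2)))).
    apply: ler_sum => t _.
    rewrite -mulrBr mulrCA -mulrDr ler_wpM2l ?softweight_ge0//.
    apply: (le_trans (expR_le_quad _)); rewrite lerD2l ler_expR.
    have b0 : 0 <= b by rewrite (le_trans _ (ub t)).
    have d : `|u t - m| <= 2 * b.
      by rewrite (le_trans (ler_normB _ _))// mulr_natl mulr2n lerD.
    have : (u t - m) ^+ 2 <= (2 * b) ^+ 2.
      by rewrite -real_normK ?num_real// ler_sqr ?nnegrE//; lra.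
    rewrite !exprMn => h.
    rewrite [leRHS](_ : _ = 2 * (l ^+ 2 * (2 ^+ 2 * b ^+ 2))); last by ring.
    by rewrite ler_pM2l// ler_pM2l ?exprn_gt0.
  have e1 x : \sum_t softweight l s t * x = x.
    by rewrite -mulr_suml softweight_sum mul1r.
  by rewrite big_split /= -mulr_sumr sumrB !e1 -/m subrr mulr0 add0r.
have K0 : 0 < \sum_t softweight l s t * expR (l * (u t - m)).
  have := softsum_gt0 l (fun t => s t + u t).
  by rewrite sumE pmulr_rgt0// mulr_gt0 ?expR_gt0.
have lnK0 : ln (\sum_t softweight l s t * expR (l * (u t - m))) <= 8 * (l * b) ^+ 2.
  by rewrite -[leRHS]expRK ler_ln ?posrE ?expR_gt0.
rewrite /softmax sumE lnM ?posrE ?mulr_gt0 ?expR_gt0// lnM ?posrE ?expR_gt0// expRK.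
rewrite ler_pdivrMr// (mulrDl _ (8 * l * b ^+ 2)) (mulrDl _ m) divfK ?gt_eqF//.
rewrite (mulrC m) lerD2l (le_trans lnK0)//.
by rewrite [leLHS](_ : _ = 8 * l * b ^+ 2 * l)//; ring.
Qed.

End softmax.

(** Doubling the index set turns a maximum of absolute values into a maximum of signed values; this
    is the origin of the 2 in [ln (2 * #|T|)%:R]. *)
Definition with_sign (R : realType) (T : Type) (s : T -> R) (tb : T * bool) : R :=
  (-1) ^+ tb.2 * s tb.1.

Lemma bigmax_norm_le_softmax (R : realType) (T : finType) (l : R) (s : T -> R) :
  (0 < #|T|)%N -> 0 < l ->
  \big[Num.max/0]_t `|s t| <= softmax l (with_sign s).
Proof.
move=> T0 l0.
have TB0 : (0 < #|{: T * bool}|)%N by rewrite card_prod card_bool muln_gt0 T0.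
have h t : `|s t| <= softmax l (with_sign s).
  have := le_softmax TB0 (with_sign s) (t, true) l0.
  have := le_softmax TB0 (with_sign s) (t, false) l0.
  by rewrite /with_sign /= expr0 expr1 mul1r mulN1r ler_norml; lra.
apply: bigmax_le => //.
have /card_gt0P[t _] := T0.
by apply: le_trans (h t).
Qed.

Lemma measurable_bigmax_norm (R : realType) (d : measure_display)
    (O : measurableType d) (T : finType) (U : T -> O -> R) :
  (forall t, measurable_fun setT (U t)) ->
  measurable_fun setT (fun w => \big[Num.max/0]_t `|U t w|).
Proof.
move=> mU; elim: (index_enum T) => [|t s ih].
  by under eq_fun do rewrite big_nil; exact: measurable_cst.
under eq_fun do rewrite big_cons.
by apply: measurable_maxr => //; apply: measurableT_comp.
Qed.

(** * Integrable majorants and centering under independence *)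

(** Since [f] is nonnegative, [g] agrees almost everywhere with its positive part, which reduces the
    claim to a nonnegative majorant. *)
Lemma ae_le_integral_integrable (R : realType) (dO : measure_display)
    (Omega : measurableType dO) (mu : {measure set Omega -> \bar R})
    (f : Omega -> \bar R) (g : Omega -> R) :
  (forall w, 0 <= f w)%E -> mu.-integrable setT (EFin \o g) ->
  {ae mu, forall w, (f w <= (g w)%:E)%E} ->
  (\int[mu]_w f w <= \int[mu]_w (g w)%:E)%E.
Proof.
move=> f0 ig fg.
have mg : measurable_fun setT g by apply/measurable_EFinP; case/integrableP: ig.
have mG : measurable_fun setT (fun w => (Num.max (g w) 0)%:E).
  by apply/measurable_EFinP; apply: measurable_maxr.
rewrite (_ : \int[mu]_w (g w)%:E = \int[mu]_w (Num.max (g w) 0)%:E)%E; last first.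
  apply: ae_eq_integral => //; first by apply/measurable_EFinP.
  apply: filterS fg => w fgw _.
  have : (0 <= (g w)%:E)%E by apply: le_trans (f0 w) fgw.
  by rewrite lee_fin => ?; rewrite max_l.
apply: ae_le_integral_ge0 => //; first by move=> w; rewrite lee_fin le_max lexx orbT.
by apply: filterS fg => w /le_trans; apply; rewrite lee_fin le_max lexx.
Qed.

Lemma bounded_mul_integrable (R : realType) (dO : measure_display)
    (Omega : measurableType dO) (mu : {measure set Omega -> \bar R})
    (q u : Omega -> R) :
  (forall w, 0 <= q w <= 1) -> measurable_fun setT q ->
  mu.-integrable setT (EFin \o u) ->
  mu.-integrable setT (EFin \o (fun w => q w * u w)).
Proof.
move=> q01 mq iu.
have mu_ : measurable_fun setT u by apply/measurable_EFinP; case/integrableP: iu.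
apply: le_integrable iu => //.
  by apply/measurable_EFinP; apply: measurable_funM.
move=> w _; rewrite !abse_EFin lee_fin normrM.
have /andP[q0 q1] := q01 w.
by rewrite (ger0_norm q0) ler_piMl.
Qed.

(** Factorization is available for nonnegative functions, so [u] is split into its two parts. As [q]
    is nonnegative, the parts of q u are q times those of u; both integrals factor, and centering
    makes the integrals of the parts of [u] equal. *)
Lemma integral_indep_centered (R : realType) (dO : measure_display)
    (Omega : measurableType dO) (P : probability Omega R)
    (F G : set_system Omega) (q u : Omega -> R) :
  <<s F >> `<=` measurable -> <<s G >> `<=` measurable ->
  (forall A B, <<s F >> A -> <<s G >> B -> P (A `&` B) = (P A * P B)%E) ->
  (forall w, 0 <= q w <= 1) ->
  (forall B, measurable B -> <<s F >> (q @^-1` B)) ->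
  (forall B, measurable B -> <<s G >> (u @^-1` B)) ->
  centered P u ->
  (\int[P]_w (q w * u w)%:E = 0)%E.
Proof.
move=> hF hG ind q01 /sub_g_sigma_algebraTypeP mq /sub_g_sigma_algebraTypeP mu_.
move=> [iu]; rewrite unlock => u0.
pose up w := ((EFin \o u)^\+ w)%E.
pose un w := ((EFin \o u)^\- w)%E.
have mup : measurable_fun setT (up : g_sigma_algebraType G -> \bar R).
  by apply: measurable_funepos; apply/measurable_EFinP.
have mun : measurable_fun setT (un : g_sigma_algebraType G -> \bar R).
  by apply: measurable_funeneg; apply/measurable_EFinP.
have mq' : measurable_fun setT ((EFin \o q) : g_sigma_algebraType F -> \bar R).
  by apply/measurable_EFinP.
have q0 w : 0 <= q w by case/andP: (q01 w).
have pn : (\int[P]_w up w = \int[P]_w un w)%E.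
  have := u0; rewrite integralE.
  have /fineK <- := integrable_pos_fin_num measurableT iu.
  have /fineK <- := integrable_neg_fin_num measurableT iu.
  by rewrite -EFinB => -[] /eqP; rewrite subr_eq0 => /eqP ->.
rewrite integralE.
have -> : (fun w => (q w * u w)%:E)^\+%E = (fun w => (q w)%:E * up w)%E.
  apply/funext => w; rewrite /up !funeposE /=.
  by rewrite EFinM maxe_pMr ?lee_fin// mule0.
have -> : (fun w => (q w * u w)%:E)^\-%E = (fun w => (q w)%:E * un w)%E.
  apply/funext => w; rewrite /un !funenegE /=.
  by rewrite -mulrN EFinM maxe_pMr ?lee_fin// mule0.
rewrite (@indep_integralM _ _ _ _ F G (EFin \o q) up)//; last by move=> w; exact: funepos_ge0.
rewrite (@indep_integralM _ _ _ _ F G (EFin \o q) un)//; last by move=> w; exact: funeneg_ge0.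
rewrite -pn.
rewrite subee// fin_numM//; last exact: integrable_pos_fin_num.
have mqO : measurable_fun setT q.
  by move=> _ B mB; rewrite setTI; apply: hF; have := mq measurableT B mB; rewrite setTI.
apply: integrable_fin_num => //.
rewrite [X in _.-integrable _ X](_ : _ = EFin \o (fun w => q w * cst 1 w)).
  by apply: bounded_mul_integrable => //; exact: finite_measure_integrable_cst.
by apply/funext => w /=; rewrite mulr1.
Qed.

(** * Maximal inequalities *)

(** Induction over the index list: the exponential of a partial sum is measurable for the
    sigma-algebra generated by the indices already treated, which is independent of the next one. *)
Lemma integral_expR_sum_le (R : realType) (dO : measure_display)
    (Omega : measurableType dO) (P : probability Omega R) (I : finType)
    (F : I -> set_system Omega) (X : I -> Omega -> R) (c : I -> R) :
  (forall i, sigma_algebra setT (F i)) -> (forall i, F i `<=` measurable) ->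
  mutually_independent P F ->
  (forall i B, measurable B -> F i (X i @^-1` B)) ->
  (forall i, \int[P]_w (expR (X i w))%:E <= (expR (c i))%:E)%E ->
  (\int[P]_w (expR (\sum_i X i w))%:E <= (expR (\sum_i c i))%:E)%E.
Proof.
move=> sF mF ind mX Xc.
have : uniq (index_enum I) by exact: index_enum_uniq.
elim: (index_enum I) => [_|k s ih /= /andP[ks us]].
  under eq_integral do rewrite big_nil.
  rewrite big_nil integral_cst//.
  by have /= -> := @probability_setT _ _ _ P; rewrite mule1.
set J := [set i in s].
pose G := \bigcup_(i in [set` J]) F i.
have mJ : <<s G >> `<=` measurable.
  apply: smallest_sub; first exact: sigma_algebra_measurable.
  by move=> A [i _ FA]; exact: mF FA.
have GX i : i \in s -> measurable_fun setT (X i : g_sigma_algebraType G -> R).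
  move=> si; apply/sub_g_sigma_algebraTypeP => B mB.
  by apply: sub_sigma_algebra; exists i; [rewrite /= inE|exact: mX].
have mS : measurable_fun setT
    ((fun w => \sum_(i <- s) X i w) : g_sigma_algebraType G -> R).
  (* Terms outside [s] are set to zero, because only indices in [s] are known to be measurable for
     the generated sigma-algebra. *)
  have -> : (fun w => \sum_(i <- s) X i w) =
      (fun w => \sum_(i <- s) (if i \in s then X i w else 0)).
    by apply/funext => w; apply: eq_big_seq => i ->.
  apply: measurable_sum => i; case: (boolP (i \in s)) => si; last exact: measurable_cst.
  exact: GX.
under eq_integral do rewrite big_cons addrC expRD EFinM.
rewrite (@indep_integralM _ _ _ P G (F k)
   (fun w => (expR (\sum_(i <- s) X i w))%:E) (fun w => (expR (X k w))%:E))//.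
- rewrite big_cons addrC expRD EFinM; apply: lee_pmul => //.
  + by apply: integral_ge0 => w _; rewrite lee_fin expR_ge0.
  + by apply: integral_ge0 => w _; rewrite lee_fin expR_ge0.
  + exact: ih.
- by rewrite sigma_algebra_id.
- move=> A B GA; rewrite sigma_algebra_id// => FB.
  by apply: (@mutually_independent_group _ _ _ P _ F J k) => //; rewrite inE.
- by apply/measurable_EFinP; apply: measurableT_comp.
- apply/measurable_EFinP; apply: measurableT_comp => //.
  apply/sub_g_sigma_algebraTypeP => B mB.
  by apply: sub_sigma_algebra; exact: mX.
Qed.

(** The maximum is at most ln(S) / l, where S is a sum of 2 #|T| exponentials of mean at most
    exp(l^2 v / 2); the logarithm is bounded by its tangent at that bound for the mean of S. The
    parameter [l] stays free, to be balanced later. *)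
Lemma bigmax_subgaussian_le (R : realType) (dO : measure_display)
    (Omega : measurableType dO) (P : probability Omega R) (T : finType)
    (U : T -> Omega -> R) (l v : R) :
  (0 < #|T|)%N -> 0 < l -> (forall t, measurable_fun setT (U t)) ->
  (forall t, \int[P]_w (expR (l * U t w))%:E <= (expR (l ^+ 2 * v / 2))%:E)%E ->
  (forall t, \int[P]_w (expR (- l * U t w))%:E <= (expR (l ^+ 2 * v / 2))%:E)%E ->
  (\int[P]_w (\big[Num.max/0]_t `|U t w|)%:E <=
    (ln (2 * #|T|)%:R / l + l * v / 2)%:E)%E.
Proof.
move=> T0 l0 mU Up Um.
pose W (tb : T * bool) w := expR (l * with_sign (U ^~ w) tb).
have mW tb : measurable_fun setT (W tb).
  apply: measurableT_comp => //; apply: measurable_funM; first exact: measurable_cst.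
  by apply: measurable_funM => //; exact: mU.
pose c := expR (l ^+ 2 * v / 2).
have W0 tb w : 0 <= W tb w by exact: expR_ge0.
have iWc tb : (\int[P]_w (W tb w)%:E <= c%:E)%E.
  rewrite /W /with_sign /=; case: tb => t [] /=.
    by under eq_integral do rewrite expr1 mulN1r mulrN -mulNr.
  by under eq_integral do rewrite expr0 mul1r.
have iW tb : P.-integrable setT (EFin \o W tb).
  apply/integrableP; split; first exact/measurable_EFinP.
  rewrite (le_lt_trans _ (ltry c))// (le_trans _ (iWc tb))//.
  by under eq_integral do rewrite /= ger0_norm//.
pose N : R := (2 * #|T|)%:R.
have N0 : 0 < N by rewrite ltr0n muln_gt0.
have c0 : 0 < c by exact: expR_gt0.
(* [ln S <= S / (N c) - 1 + ln (N c)] replaces Jensen's inequality. *)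
pose k := (ln (N * c) - 1) / l.
pose H w := \sum_tb (l * (N * c))^-1 * W tb w + k.
have iWs tb : P.-integrable setT (fun w => ((l * (N * c))^-1 * W tb w)%:E).
  by under eq_fun do rewrite EFinM; apply: integrableZl => //; exact: iW.
have iS : P.-integrable setT (fun w => (\sum_tb (l * (N * c))^-1 * W tb w)%:E).
  by under eq_fun do rewrite -sumEFin; exact: integrable_sum.
have iH : P.-integrable setT (EFin \o H).
  rewrite (_ : EFin \o H = (fun w => (\sum_tb (l * (N * c))^-1 * W tb w)%:E) \+ (EFin \o cst k))%E.
    by apply: integrableD => //; exact: finite_measure_integrable_cst.
  by apply/funext.
have TB0 : (0 < #|{: T * bool}|)%N by rewrite card_prod card_bool muln_gt0 T0.
apply: (@le_trans _ _ (\int[P]_w (H w)%:E)%E).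
  apply: ae_le_integral_integrable => //.
    move=> w; rewrite lee_fin; elim/big_ind: _ => // x y x0 y0.
    by rewrite le_max x0.
  apply: aeW => w; rewrite lee_fin.
  apply: (le_trans (bigmax_norm_le_softmax _ T0 l0)).
  have S0 := softsum_gt0 TB0 l (with_sign (U ^~ w)).
  rewrite /softmax /H -mulr_sumr.
  have -> : \sum_tb W tb w = softsum l (with_sign (U ^~ w)) by [].
  move: S0; set S := softsum _ _ => S0.
  have Nc : 0 < N * c by rewrite mulr_gt0.
  have h0 : -1 < S / (N * c) - 1 by rewrite ltrBrDl subrr divr_gt0.
  have := le_ln1Dx h0; rewrite addrCA subrr addr0 ln_div ?posrE// => h.
  have -> : (l * (N * c))^-1 * S + k = (S / (N * c) + (ln (N * c) - 1)) / l.
    by rewrite /k; clear -l0 N0 c0; clearbody N c; field; rewrite !gt_eqF.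
  by rewrite ler_pM2r ?invr_gt0//; move: h; lra.
rewrite /H; under eq_integral do rewrite EFinD.
rewrite integralD//=; last exact: finite_measure_integrable_cst.
rewrite integral_cst//.
have /= -> := @probability_setT _ _ _ P.
rewrite mule1.
apply: (@le_trans _ _ ((\sum_(tb : T * bool) (l * (N * c))^-1 * c + k)%:E)).
  rewrite EFinD leeD2r//.
  under eq_integral do rewrite -sumEFin.
  rewrite integral_sum// -sumEFin; apply: lee_sum => tb _.
  under eq_integral do rewrite EFinM.
  rewrite (integralZl measurableT (iW tb)) EFinM.
  apply: lee_wpmul2l; last exact: iWc.
  rewrite lee_fin invr_ge0.
  by rewrite !mulr_ge0// ltW.
rewrite lee_fin sumr_const card_prod card_bool -[_ *+ _]mulr_natl mulnC -/N.
rewrite /k lnM ?posrE// expRK.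
rewrite [leLHS](_ : _ = ln N / l + l * v / 2)//.
by clear -l0 N0 c0; clearbody N c; field; rewrite !gt_eqF.
Qed.

Lemma centeredZ (R : realType) (dO : measure_display)
    (Omega : measurableType dO) (P : probability Omega R) (a : R) (X : Omega -> R) :
  centered P X -> centered P (fun w => a * X w).
Proof.
move=> [iX X0]; split.
  by rewrite /comp; under eq_fun do rewrite EFinM; exact: integrableZl.
move: X0; rewrite unlock => X0; under eq_integral do rewrite EFinM.
by rewrite (integralZl measurableT iX) X0 mule0.
Qed.

(** An exponential of a difference avoids the quotient in measurability proofs. *)
Lemma softweightE (R : realType) (T : finType) (l : R) (s : T -> R) (t : T) :
  (0 < #|T|)%N -> softweight l s t = expR (l * s t - ln (softsum l s)).
Proof.
by move=> T0; rewrite expRD expRN lnK// posrE softsum_gt0.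
Qed.

(** The summands enter one at a time, starting from [softmax] of zero, equal to ln (2 #|T|) / l. At
    step i the linear term of [softmaxD] has weights determined by the earlier summands, so it
    integrates to zero against the centered [u i]; only the second moments of the envelopes [b i]
    accumulate. *)
Lemma bigmax_sum_indep_le (R : realType) (dO : measure_display)
    (Omega : measurableType dO) (P : probability Omega R) (n : nat)
    (F : 'I_n -> set_system Omega) (T : finType) (u : 'I_n -> T -> Omega -> R)
    (b : 'I_n -> Omega -> R) (v : 'I_n -> R) (l : R) :
  (0 < #|T|)%N -> 0 < l ->
  (forall i, sigma_algebra setT (F i)) -> (forall i, F i `<=` measurable) ->
  mutually_independent P F ->
  (forall i t B, measurable B -> F i (u i t @^-1` B)) ->
  (forall i t, centered P (u i t)) ->
  (forall i, measurable_fun setT (b i)) ->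
  (forall i t, {ae P, forall w, `|u i t w| <= b i w}) ->
  (forall i, \int[P]_w (b i w ^+ 2)%:E <= (v i)%:E)%E ->
  (\int[P]_w (\big[Num.max/0]_t `|\sum_i u i t w|)%:E <=
    (ln (2 * #|T|)%:R / l + 8 * l * \sum_i v i)%:E)%E.
Proof.
move=> T0 l0 sF mF ind mu cu mb ub bv.
have TB0 : (0 < #|{: T * bool}|)%N by rewrite card_prod card_bool muln_gt0 T0.
pose U i tb w := with_sign (fun t => u i t w) tb.
pose S (m : nat) tb w := \sum_(i < n | (i < m)%N) U i tb w.
(* The partial sum stops strictly before [i], so the bounded weight [q i] is measurable for the
   indices below [i]. *)
pose q (i : 'I_n) tb w := softweight l (fun tb => S (nat_of_ord i) tb w) tb.
pose k0 : R := ln (2 * #|T|)%:R / l.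
pose X (i : 'I_n) w := \sum_tb q i tb w * U i tb w + 8 * l * b i w ^+ 2.
pose H w := k0 + \sum_i X i w.
have cU i tb : centered P (U i tb) by apply: centeredZ; exact: cu.
have q01 i tb w : 0 <= q i tb w <= 1.
  by rewrite softweight_ge0//= softweight_le1.
pose J (i : 'I_n) : {set 'I_n} := finset (fun j : 'I_n => (j < i)%N).
pose G (i : 'I_n) := \bigcup_(j in [set` J i]) F j.
have mG i : <<s G i >> `<=` measurable.
  apply: smallest_sub; first exact: sigma_algebra_measurable.
  by move=> A [j _ FA]; exact: mF FA.
have mUF i tb : measurable_fun setT (U i tb : g_sigma_algebraType (F i) -> R).
  apply: measurable_funM; first exact: measurable_cst.
  by apply/sub_g_sigma_algebraTypeP => B mB; apply: sub_sigma_algebra; exact: mu.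
have mUG (i j : 'I_n) tb : (j < i)%N -> measurable_fun setT (U j tb : g_sigma_algebraType (G i) -> R).
  move=> ji; apply: measurable_funM; first exact: measurable_cst.
  apply/sub_g_sigma_algebraTypeP => B mB; apply: sub_sigma_algebra.
  by exists j; [rewrite /= inE|exact: mu].
have mSG (i : 'I_n) tb : measurable_fun setT (S i tb : g_sigma_algebraType (G i) -> R).
  have -> : S i tb = (fun w => \sum_(j < n) (if (j < i)%N then U j tb w else 0)).
    by apply/funext => w; rewrite /S big_mkcond.
  apply: measurable_sum => j; case: (boolP (j < i)%N) => ji; last exact: measurable_cst.
  exact: mUG.
have mqG i tb : measurable_fun setT (q i tb : g_sigma_algebraType (G i) -> R).
  have -> : q i tb = (fun w => expR (l * S i tb w - ln (softsum l (fun tb => S i tb w)))).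
    by apply/funext => w; rewrite /q softweightE.
  apply: measurableT_comp => //; apply: measurable_funB.
    by apply: measurable_funM => //; exact: measurable_cst.
  apply: measurableT_comp; first exact: measurable_ln.
  apply: measurable_sum => tb'; apply: measurableT_comp => //.
  by apply: measurable_funM => //; exact: measurable_cst.
have mq i tb : measurable_fun setT (q i tb).
  move=> _ B mB; rewrite setTI; apply: (mG i).
  by have /sub_g_sigma_algebraTypeP := mqG i tb; apply.
have iqU i tb : P.-integrable setT (fun w => (q i tb w * U i tb w)%:E).
  by apply: bounded_mul_integrable => //; case: (cU i tb).
have iqU0 i tb : (\int[P]_w (q i tb w * U i tb w)%:E = 0)%E.
  apply: (@integral_indep_centered _ _ _ P (G i) (F i)) => //.
  - by rewrite sigma_algebra_id.
  - move=> A B GA; rewrite sigma_algebra_id// => FB.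
    apply: (@mutually_independent_group _ _ _ P _ F (J i) i) => //.
    by rewrite inE ltnn.
  - by apply/sub_g_sigma_algebraTypeP; exact: mqG.
  - by apply/sub_g_sigma_algebraTypeP; exact: mUF.
have ib i : P.-integrable setT (fun w => (b i w ^+ 2)%:E).
  apply/integrableP; split; first by apply/measurable_EFinP; exact: measurable_funX.
  rewrite (le_lt_trans _ (ltry (v i)))// (le_trans _ (bv i))//.
  by under eq_integral do rewrite /= ger0_norm ?sqr_ge0//.
have isq i : P.-integrable setT (fun w => (\sum_tb q i tb w * U i tb w)%:E).
  by under eq_fun do rewrite -sumEFin; exact: integrable_sum.
have ib' i : P.-integrable setT (fun w => (8 * l * b i w ^+ 2)%:E).
  by under eq_fun do rewrite EFinM; apply: integrableZl => //; exact: ib.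
have iX i : P.-integrable setT (EFin \o X i).
  by rewrite /comp /X; under eq_fun do rewrite EFinD; apply: integrableD => //; exact: ib'.
have iXs : P.-integrable setT (fun w => (\sum_i X i w)%:E).
  by under eq_fun do rewrite -sumEFin; apply: integrable_sum => // i _; exact: iX.
have ik : P.-integrable setT (EFin \o cst k0) by exact: finite_measure_integrable_cst.
have iH : P.-integrable setT (EFin \o H).
  by rewrite /comp /H; under eq_fun do rewrite EFinD; apply: integrableD => //; exact: ik.
apply: (@le_trans _ _ (\int[P]_w (H w)%:E)%E).
  apply: ae_le_integral_integrable => //.
    move=> w; rewrite lee_fin; elim/big_ind: _ => // x y x0 y0.
    by rewrite le_max x0.
  have : {ae P, forall w, forall i t, `|u i t w| <= b i w}.
    by apply: filter_forall => i; apply: filter_forall => t; exact: ub.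
  apply: filterS => w ubw; rewrite lee_fin.
  apply: (le_trans (bigmax_norm_le_softmax _ T0 l0)).
  have -> : with_sign (fun t => \sum_i u i t w) = (fun tb => S n tb w).
    apply/funext => tb; rewrite /with_sign /S mulr_sumr.
    by apply: eq_bigl => i; rewrite ltn_ord.
  have bU i tb : `|U i tb w| <= b i w.
    by rewrite normrM normrX normrN1 expr1n mul1r.
  suff hm m : (m <= n)%N -> softmax l (fun tb => S m tb w) <=
      k0 + \sum_(i < n | (i < m)%N) X i w.
    have := hm n (leqnn n); rewrite /H => /le_trans; apply.
    by rewrite lerD2l le_eqVlt; apply/orP; left; apply/eqP/eq_bigl => i; rewrite ltn_ord.
  elim: m => [_|m ih mn].
    have -> : (fun tb => S 0 tb w) = (fun=> 0).
      by apply/funext => tb; rewrite /S big_pred0.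
    by rewrite softmax0 card_prod card_bool mulnC big_pred0// addr0.
  pose im := Ordinal mn.
  have sumS (Y : 'I_n -> R) : \sum_(i < n | (i < m.+1)%N) Y i =
      \sum_(i < n | (i < m)%N) Y i + Y im.
    rewrite (bigD1 im)/= ?ltnSn// addrC; congr (_ + _); apply: eq_bigl => i.
    rewrite ltnS -val_eqE /= [RHS]ltn_neqAle.
    by rewrite andbC.
  have -> : (fun tb => S m.+1 tb w) = (fun tb => S m tb w + U im tb w).
    by apply/funext => tb; rewrite /S sumS.
  apply: (le_trans (softmaxD TB0 _ l0 (bU im))).
  rewrite sumS [leRHS]addrA -[leLHS]addrA.
  by apply: lerD; [exact: ih (ltnW mn)|exact: lexx].
rewrite /H; under eq_integral do rewrite EFinD.
rewrite (integralD measurableT ik iXs) /= integral_cst//.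
have /= -> := @probability_setT _ _ _ P.
rewrite mule1 EFinD; apply: leeD2l.
under eq_integral do rewrite -sumEFin.
rewrite (integral_sum measurableT iX) mulr_sumr -sumEFin; apply: lee_sum => i _.
rewrite /comp /X; under eq_integral do rewrite EFinD.
rewrite (integralD measurableT (isq i) (ib' i)) /=.
under eq_integral do rewrite -sumEFin.
rewrite (integral_sum measurableT (iqU i)) big1 ?add0e//.
under eq_integral do rewrite EFinM.
rewrite (integralZl measurableT (ib i)) (EFinM _ (v i)).
apply: lee_wpmul2l; last exact: bv.
rewrite lee_fin.
by rewrite mulr_ge0// ltW.
Qed.

(** * Dyadic chaining *)

Lemma rV_norm_leP (R : realType) (d : nat) (x : 'rV[R]_d) (e : R) : 0 <= e ->
  reflect (forall r, `|x ord0 r| <= e) (`|x| <= e).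
Proof.
move=> e0; apply: (iffP idP) => [xe r|h].
  apply: le_trans xe; rewrite [leRHS]/Num.Def.normr /= mx_normrE.
  exact: (le_bigmax _ (fun i : 'I_1 * 'I_d => `|x i.1 i.2|) (ord0, r)).
rewrite [leLHS]/Num.Def.normr /= mx_normrE; apply: bigmax_le => // -[i r] _ /=.
by rewrite (ord1 i).
Qed.

Lemma rV_coord_le_norm (R : realType) (d : nat) (x : 'rV[R]_d) r :
  `|x ord0 r| <= `|x|.
Proof. exact/(rV_norm_leP x (normr_ge0 x)). Qed.

(** Numerators run from 0 to 2^k inclusive, so that [dyadic_floor] is meaningful on the faces where
    a coordinate equals 1. *)
Definition dyadic_index (d k : nat) := {ffun 'I_d -> 'I_(2 ^ k).+1}.

Definition dyadic_pt (R : realType) (d k : nat) (i : dyadic_index d k) : 'rV[R]_d :=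
  \row_r ((i r)%:R / 2 ^+ k).

Definition dyadic_parent (d k : nat) (i : dyadic_index d k.+1) : dyadic_index d k :=
  [ffun r => inord (i r)./2].

Definition dyadic_floor (R : realType) (d k : nat) (x : 'rV[R]_d) : dyadic_index d k :=
  [ffun r => inord (Num.truncn (x ord0 r * 2 ^+ k))].

Lemma dyadic_pt_cube (R : realType) (d k : nat) (i : dyadic_index d k) :
  cube (dyadic_pt R i).
Proof.
move=> r; rewrite mxE divr_ge0//= ler_pdivrMr ?exprn_gt0// mul1r.
by rewrite -natrX ler_nat -ltnS.
Qed.

Lemma dyadic_parent_dist (R : realType) (d k : nat) (i : dyadic_index d k.+1) :
  `|dyadic_pt R i - dyadic_pt R (dyadic_parent i)| <= 2^-1 ^+ k.+1.
Proof.
apply/rV_norm_leP => [|r]; first by rewrite exprn_ge0.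
rewrite !mxE ffunE inordK; last first.
  rewrite ltnS -[leqRHS]doubleK; apply: half_leq.
  by rewrite -mul2n -expnS -ltnS.
have -> : (i r)%:R = (odd (i r) + (i r)./2.*2)%:R :> R by rewrite odd_double_half.
rewrite natrD -mul2n natrM.
rewrite [X in `|X|](_ : _ = (odd (i r))%:R * 2^-1 ^+ k.+1); last first.
  by rewrite exprVn exprS; field; rewrite expf_neq0.
rewrite ger0_norm ?mulr_ge0// ?exprn_ge0//.
by rewrite ler_piMl ?exprn_ge0//; case: odd.
Qed.

Lemma truncn_cube (R : realType) (d k : nat) (x : 'rV[R]_d) r : cube x ->
  (Num.truncn (x ord0 r * 2 ^+ k) < (2 ^ k).+1)%N.
Proof.
move=> /(_ r) /andP[x0 x1]; rewrite ltnS truncn_le_nat.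
rewrite (@le_lt_trans _ _ (2 ^+ k))// -?natrX ?ltr_nat//.
by rewrite natrX ler_piMl// exprn_ge0.
Qed.

Lemma dyadic_floor_dist (R : realType) (d k : nat) (x : 'rV[R]_d) : cube x ->
  `|x - dyadic_pt R (dyadic_floor k x)| <= 2^-1 ^+ k.
Proof.
move=> cx; apply/rV_norm_leP => [|r]; first by rewrite exprn_ge0.
rewrite !mxE ffunE inordK ?truncn_cube//.
have x0 : 0 <= x ord0 r by case/andP: (cx r).
have p0 : 0 < (2 : R) ^+ k by rewrite exprn_gt0.
have /andP[t1 t2] := truncn_itv (mulr_ge0 x0 (ltW p0)).
set t := (Num.truncn _)%:R in t1 *.
have -> : x ord0 r - t / 2 ^+ k = (x ord0 r * 2 ^+ k - t) / 2 ^+ k.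
  by field; rewrite gt_eqF.
rewrite -natr1 in t2.
rewrite exprVn ger0_norm; last by apply: divr_ge0; [rewrite subr_ge0|exact: ltW].
by rewrite ler_pdivrMr// mulVf ?gt_eqF//; move: t2; lra.
Qed.

(** Halving the integer part of 2y gives the integer part of y. Successive floors of a point are
    thus linked by [dyadic_parent], and the increments at one level range over grid points instead
    of pairs of points. *)
Lemma dyadic_parent_floor (R : realType) (d k : nat) (x : 'rV[R]_d) : cube x ->
  dyadic_parent (dyadic_floor k.+1 x) = dyadic_floor k x.
Proof.
move=> cx; apply/ffunP => r; rewrite !ffunE; congr inord.
rewrite inordK ?truncn_cube//; apply/esym/truncn_def.
have x0 : 0 <= x ord0 r by case/andP: (cx r).
have := @truncn_itv _ (x ord0 r * 2 ^+ k.+1).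
rewrite mulr_ge0 ?exprn_ge0// => /(_ isT).
set t := Num.truncn _; rewrite -{1 2}(odd_double_half t) exprS.
set y := 2 ^+ k; move: (t./2) (odd t) => m b.
rewrite -addnS !natrD -!mul2n !natrM -(natr1 m) -(natr1 (2 * m)) natrM.
by case: b => /=; rewrite ?mulr1n ?mulr0n => /andP[h1 h2]; apply/andP; split; nra.
Qed.

(** For d >= 1 one has 2 (2^k + 1)^d <= 2^(2 d (k+1)), and ln 2 <= 1. *)
Lemma ln_card_dyadic (R : realType) (d k : nat) : (0 < d)%N ->
  ln (2 * #|{: dyadic_index d k}|)%:R <= 2 * d%:R * k.+1%:R :> R.
Proof.
move=> d0; rewrite card_ffun !card_ord.
have h : (2 * (2 ^ k).+1 ^ d <= 2 ^ (2 * d * k.+1))%N.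
  apply: (@leq_trans (2 * (2 ^ k.+1) ^ d)).
    by rewrite leq_mul2l /= leq_exp2r// expnS mul2n -addnn -addn1 leq_add2l expn_gt0.
  rewrite -expnM -expnS leq_exp2l//; nia.
rewrite (@le_trans _ _ (ln (2 ^ (2 * d * k.+1))%:R))//.
  by rewrite ler_ln ?posrE ?ltr0n ?muln_gt0 ?expn_gt0// ler_nat.
rewrite natrX lnXn// -[ln 2 *+ _]mulr_natl -!natrM ler_piMr//.
by have -> : 2 = 1 + 1 :> R; [lra|apply: le_ln1Dx; lra].
Qed.

(** The sum is a partial sum of the differentiated geometric series; its closed form, proved by
    induction, lies below the limit. *)
Lemma sum_geom_le (R : realType) (r : R) (K : nat) : 0 < r < 1 ->
  \sum_(j < K) (j.+1)%:R * r ^+ j <= (1 - r)^-1 ^+ 2.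
Proof.
move=> /andP[r0 r1]; have q0 : 0 < 1 - r by lra.
suff -> : \sum_(j < K) (j.+1)%:R * r ^+ j =
    (1 - r)^-1 ^+ 2 * (1 - (K.+1)%:R * r ^+ K + K%:R * r ^+ K.+1).
  rewrite ler_piMr ?exprn_ge0 ?invr_ge0 ?(ltW q0)//.
  rewrite -natr1 exprS; have := exprn_ge0 K (ltW r0).
  have : 0 <= K%:R :> R by [].
  move: (K%:R : R) (r ^+ K) => a b a0 b0.
  have : 0 <= a * b by exact: mulr_ge0.
  by nra.
elim: K => [|K ih]; first by rewrite big_ord0 expr0 mul1r mul0r; lra.
rewrite big_ord_recr/= ih -!natr1 !exprS; field.
by rewrite gt_eqF.
Qed.

(** [X_mod] is only used to discard the scales beyond a large, but finite, level. *)
Section chaining.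
Variables (R : realType) (d : nat) (dO : measure_display).
Variables (Omega : measurableType dO) (P : probability Omega R).
Variables (X : Omega -> 'rV[R]_d -> R) (k0 : nat) (A r : R) (W : Omega -> R).
Hypotheses (d0 : (0 < d)%N) (A0 : 0 < A) (r01 : 0 < r < 1).
Hypothesis mX : forall x, cube x -> measurable_fun setT (X ^~ x).
Hypothesis X_max : forall (T : finType) (x : T -> 'rV[R]_d),
  (0 < #|T|)%N -> (forall t, cube (x t)) ->
  (\int[P]_w (\big[Num.max/0]_t `|X w (x t)|)%:E <=
   (A * Num.sqrt (ln (2 * #|T|)%:R))%:E)%E.
Hypothesis X_incr : forall (k : nat) (T : finType) (x y : T -> 'rV[R]_d),
  (0 < #|T|)%N -> (forall t, cube (x t)) -> (forall t, cube (y t)) ->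
  (forall t, `|x t - y t| <= 2^-1 ^+ (k0 + k)) ->
  (\int[P]_w (\big[Num.max/0]_t `|X w (x t) - X w (y t)|)%:E <=
   (A * r ^+ k * Num.sqrt (ln (2 * #|T|)%:R))%:E)%E.
Hypotheses (W0 : forall w, 0 <= W w) (iW : P.-integrable setT (EFin \o W)).
Hypothesis X_mod : {ae P, forall w, forall (k : nat) (x y : 'rV[R]_d),
  cube x -> cube y -> `|x - y| <= 2^-1 ^+ (k0 + k) -> `|X w x - X w y| <= W w * r ^+ k}.

(** A value at [x] is its floor value at level k0, plus K parent increments, plus a tail bounded by
    [W]. At level at most k0 + j, the logarithm of twice the cardinality is at most 2 d (k0+1)
    (j+1)^2, so the levels sum to A sqrt(2 d (k0+1)) times the sum of (j+1) r^j. The [+ 1] in the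
    constant pays for the tail. *)
Lemma chaining : exists V : Omega -> \bar R,
  [/\ forall w, (0 <= V w)%E, measurable_fun setT V,
    {ae P, forall w, forall x, cube x -> ((`|X w x|)%:E <= V w)%E} &
    (\int[P]_w V w <= ((Num.sqrt (2 * d%:R) * (1 - r)^-1 ^+ 2 + 1) * A *
       Num.sqrt k0.+1%:R)%:E)%E ].
Proof.
have /andP[r0 r1] := r01.
have EW0 : (0 <= \int[P]_w (W w)%:E)%E by apply: integral_ge0 => w _; rewrite lee_fin.
have EWf : (\int[P]_w (W w)%:E)%E \is a fin_num by apply: integrable_fin_num.
(* The number of levels is chosen so that the tail has mean at most [A]; dividing by e + 1 covers
   the case e = 0. *)
have [K KA] : exists K, r ^+ K * fine (\int[P]_w (W w)%:E)%E <= A.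
  set e := fine _; have e0 : 0 <= e by exact: fine_ge0.
  have Ae : 0 < A / (e + 1) by rewrite divr_gt0// ltr_wpDl.
  have : (fun n => r ^+ n) @ \oo --> (0 : R).
    by apply: cvg_expr; rewrite gtr0_norm.
  move/cvgrPdist_le => /(_ _ Ae)[K _ /(_ K (leqnn K))].
  rewrite sub0r normrN ger0_norm ?exprn_ge0 ?(ltW r0)// => hK; exists K.
  apply: (@le_trans _ _ (A / (e + 1) * e)); first by rewrite ler_wpM2r.
  rewrite -mulrA ler_piMr ?(ltW A0)// mulrC ler_pdivrMr ?ltr_wpDl// mul1r.
  by rewrite lerDl.
pose I k := dyadic_index d k.
have I0 k : (0 < #|{: I k}|)%N by apply/card_gt0P; exists [ffun=> ord0].
pose B0 w := \big[Num.max/0]_(i : I k0) `|X w (dyadic_pt R i)|.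
pose B k w := \big[Num.max/0]_(i : I (k0 + k).+1)
  `|X w (dyadic_pt R i) - X w (dyadic_pt R (dyadic_parent i))|.
have max0 (T : finType) (f : T -> R) : 0 <= \big[Num.max/0]_t `|f t|.
  by elim/big_ind: _ => // x y x0 y0; rewrite le_max x0.
have mB0 : measurable_fun setT B0.
  by apply: measurable_bigmax_norm => i; apply: mX; exact: dyadic_pt_cube.
have mB k : measurable_fun setT (B k).
  by apply: measurable_bigmax_norm => i; apply: measurable_funB; apply: mX;
    exact: dyadic_pt_cube.
have mW : measurable_fun setT W by apply/measurable_EFinP; case/integrableP: iW.
pose V w := B0 w + \sum_(k < K) B k w + r ^+ K * W w.
have mS : measurable_fun setT (fun w => \sum_(k < K) B k w).
  by apply: measurable_sum => k; exact: mB.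
have S0 w : 0 <= \sum_(k < K) B k w by apply: sumr_ge0 => k _; exact: max0.
have rW0 w : 0 <= r ^+ K * W w by rewrite mulr_ge0// exprn_ge0// ltW.
have mrW : measurable_fun setT (fun w => r ^+ K * W w).
  by apply: measurable_funM => //; exact: measurable_cst.
exists (EFin \o V); split.
- by move=> w; rewrite lee_fin addr_ge0// addr_ge0//; exact: max0.
- by apply/measurable_EFinP; apply: measurable_funD => //; apply: measurable_funD.
- apply: filterS X_mod => w modw x cx; rewrite lee_fin.
  have chain j : `|X w (dyadic_pt R (dyadic_floor (k0 + j) x))| <=
      B0 w + \sum_(k < j) B k w.
    elim: j => [|j ih].
      rewrite big_ord0 addr0 addn0.
      exact: (le_bigmax _ (fun i : I k0 => `|X w (dyadic_pt R i)|)).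
    rewrite big_ord_recr /= addrA addnS.
    set z := dyadic_floor (k0 + j).+1 x.
    have -> : X w (dyadic_pt R z) = X w (dyadic_pt R (dyadic_parent z)) +
      (X w (dyadic_pt R z) - X w (dyadic_pt R (dyadic_parent z))) by rewrite addrC subrK.
    rewrite (le_trans (ler_normD _ _))// lerD//.
      by rewrite dyadic_parent_floor.
    exact: (le_bigmax _ (fun i : I (k0 + j).+1 =>
      `|X w (dyadic_pt R i) - X w (dyadic_pt R (dyadic_parent i))|)).
  set z := dyadic_pt R (dyadic_floor (k0 + K) x).
  have -> : X w x = X w z + (X w x - X w z) by rewrite addrC subrK.
  rewrite (le_trans (ler_normD _ _))// lerD//; first exact: chain.
  rewrite mulrC; apply: modw => //; first exact: dyadic_pt_cube.
  exact: dyadic_floor_dist.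
have -> : (\int[P]_w (EFin \o V) w = \int[P]_w (B0 w)%:E +
    \sum_(k < K) \int[P]_w (B k w)%:E + (r ^+ K)%:E * \int[P]_w (W w)%:E)%E.
  rewrite /V /comp.
  under eq_integral do rewrite 2!EFinD EFinM.
  have eW : measurable_fun setT (fun w => (W w)%:E) by exact/measurable_EFinP.
  have eB0 : measurable_fun setT (fun w => (B0 w)%:E) by exact/measurable_EFinP.
  have eS : measurable_fun setT (fun w => (\sum_(k < K) B k w)%:E).
    exact/measurable_EFinP.
  have pB0 w : setT w -> (0 <= (B0 w)%:E)%E by move=> _; rewrite lee_fin; exact: max0.
  have pS w : setT w -> (0 <= (\sum_(k < K) B k w)%:E)%E by move=> _; rewrite lee_fin.
  rewrite (ge0_integralD P measurableT _ (emeasurable_funD eB0 eS)); first last.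
  - by apply: measurable_funeM.
  - by move=> w _; rewrite -EFinM lee_fin.
  - by move=> w _; apply: adde_ge0; [exact: pB0|exact: pS].
  rewrite (ge0_integralZl P measurableT eW); first last.
  - by rewrite lee_fin exprn_ge0// ltW.
  - by move=> w _; rewrite lee_fin.
  congr (_ + _)%E.
  rewrite (ge0_integralD P measurableT pB0 eB0 pS eS); congr (_ + _)%E.
  under eq_integral do rewrite -sumEFin.
  rewrite ge0_integral_sum//; first by move=> k; exact/measurable_EFinP.
  by move=> k w _; rewrite lee_fin; exact: max0.
pose q j : R := A * (Num.sqrt (2 * d%:R) * Num.sqrt k0.+1%:R) * ((j.+1)%:R * r ^+ j).
have q0 j k : (k <= k0 + j)%N ->
   A * r ^+ j * Num.sqrt (ln (2 * #|{: I k}|)%:R) <= q j.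
  move=> kj; rewrite /q -!mulrA ler_pM2l//.
  rewrite [leRHS](_ : _ = r ^+ j * (Num.sqrt (2 * d%:R) * Num.sqrt k0.+1%:R * j.+1%:R)); last by ring.
  rewrite ler_pM2l ?exprn_gt0//.
  have -> : j.+1%:R = Num.sqrt ((j.+1 * j.+1)%:R) :> R.
    by rewrite natrM -expr2 sqrtr_sqr ger0_norm.
  rewrite -!sqrtrM ?mulr_ge0//; apply: ler_wsqrtr.
  apply: (le_trans (ln_card_dyadic _ _ d0)); rewrite -!natrM ler_nat.
  by nia.
have hB0 : (\int[P]_w (B0 w)%:E <= (q 0%N)%:E)%E.
  have h := @X_max (I k0) (fun i => dyadic_pt R i) (I0 k0) (@dyadic_pt_cube R d k0).
  apply: (le_trans h).
  by rewrite lee_fin -[A]mulr1 -(expr0 r) q0// addn0.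
(* [B k] joins level k0 + k + 1 to its parents, at distance at most 2^-(k0+k+1); hence the shift to
   [q k.+1], while [q 0] is kept for the coarsest grid. *)
have hB k : (\int[P]_w (B k w)%:E <= (q k.+1)%:E)%E.
  have h := @X_incr k.+1 (I (k0 + k).+1) (fun i => dyadic_pt R i)
    (fun i => dyadic_pt R (dyadic_parent i)) (I0 (k0 + k).+1)
    (@dyadic_pt_cube R d _) (fun i => @dyadic_pt_cube R d _ (dyadic_parent i)).
  apply: le_trans (h _) _ => [i|].
    by rewrite addnS; exact: dyadic_parent_dist.
  by rewrite lee_fin q0// addnS.
have -> : (Num.sqrt (2 * d%:R) * (1 - r)^-1 ^+ 2 + 1) * A * Num.sqrt k0.+1%:R =
   A * (Num.sqrt (2 * d%:R) * Num.sqrt k0.+1%:R) * (1 - r)^-1 ^+ 2 +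
   A * Num.sqrt k0.+1%:R by ring.
rewrite EFinD; apply: leeD.
  apply: (@le_trans _ _ (\sum_(j < K.+1) (q j)%:E)%E).
    rewrite big_ord_recl; apply: leeD => //; apply: lee_sum => k _; exact: hB.
  rewrite sumEFin lee_fin -mulr_sumr ler_wpM2l ?sum_geom_le//.
  by rewrite !mulr_ge0// ltW.
rewrite -(fineK EWf) -EFinM lee_fin (le_trans KA)//.
rewrite ler_pMr// -[leLHS]sqrtr1; apply: ler_wsqrtr.
by rewrite ler1n.
Qed.

End chaining.

(** * Taylor expansion on the cube *)

(** Induction on m: the derivative of the remainder is the remainder of the shifted family, hence
    bounded by [B], and the mean value theorem on [0, t] with t <= 1 passes [B] on. The top function
    enters through its oscillation, the quantity that a Hoelder condition controls. *)
Lemma taylor_unit (R : realType) (m : nat) (phi : nat -> R -> R) (B : R) :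
  (forall k (t : R), (k < m)%N -> 0 <= t <= 1 -> is_derive t 1 (phi k) (phi k.+1 t)) ->
  (forall t : R, 0 <= t <= 1 -> `|phi m t - phi m 0| <= B) ->
  forall t : R, 0 <= t <= 1 ->
    `|phi 0 t - (\poly_(k < m.+1) (phi k 0 / k`!%:R)).[t]| <= B.
Proof.
elim: m phi => [|m ih] phi dphi hB t t01.
  rewrite horner_poly big_ord_recl big_ord0 fact0 expr0 mulr1 addr0 divr1.
  exact: hB.
set p := \poly_(k < m.+2) _.
pose q := \poly_(k < m.+1) (phi k.+1 0 / k`!%:R).
have pq : p^`() = q.
  apply/polyP => k; rewrite coef_deriv !coef_poly ltnS.
  case: ifP => _; last by rewrite mul0rn.
  rewrite factS natrM -mulr_natl; field.
  by rewrite nat1r !pnatr_eq0 -lt0n fact_gt0.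
have B0 : 0 <= B by apply: le_trans (hB t t01).
pose psi u := phi 0 u - p.[u].
have dpsi (u : R) : 0 <= u <= 1 -> is_derive u 1 psi (phi 1 u - q.[u]).
  move=> u01; rewrite -pq.
  by apply: is_deriveB; exact: dphi.
have bd (u : R) : 0 <= u <= 1 -> `|phi 1 u - q.[u]| <= B.
  by apply: (ih (fun k => phi k.+1)) => // k s km; apply: dphi.
have psi0 : psi 0 = 0.
  rewrite /psi horner_coef0 coef_poly /= fact0 divr1; exact: subrr.
case/andP: t01 => t0 t1.
have inI (x : R) : x \in `[0, t]%R -> 0 <= x <= 1.
  by rewrite in_itv /= => /andP[-> xt]; rewrite (le_trans xt).
have cpsi : {within `[0, t], continuous psi}.
  by apply: derivable_within_continuous => x xt; case: (dpsi x (inI x xt)).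
have ipsi x : x \in `]0, t[%R -> is_derive x 1 psi (phi 1 x - q.[x]).
  by move=> xt; apply/dpsi/inI/subset_itv_oo_cc.
have [c ct] := MVT_segment t0 ipsi cpsi.
rewrite psi0 !subr0 -/(psi t) => ->.
rewrite normrM (ger0_norm t0).
by rewrite -[leRHS]mulr1 ler_pM ?bd ?inI.
Qed.

Definition mi_add (d : nat) (k : {ffun 'I_d -> nat}) (i : 'I_d) (j : nat) :
    {ffun 'I_d -> nat} :=
  [ffun r => (k r + (r == i) * j)%N].

Lemma mi_add0 (d : nat) (k : {ffun 'I_d -> nat}) (i : 'I_d) : mi_add k i 0 = k.
Proof. by apply/ffunP => r; rewrite ffunE muln0 addn0. Qed.

Lemma mi_addS (d : nat) (k : {ffun 'I_d -> nat}) (i : 'I_d) j :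
  mi_add (mi_add k i j) i 1 = mi_add k i j.+1.
Proof. by apply/ffunP => r; rewrite !ffunE -addnA -mulnDr addn1. Qed.

Lemma multi_size_add (d : nat) (k : {ffun 'I_d -> nat}) (i : 'I_d) (j : nat) :
  multi_size (mi_add k i j) = (multi_size k + j)%N.
Proof.
rewrite /multi_size; under eq_bigr do rewrite ffunE.
rewrite big_split /= -big_distrl /=; congr (_ + _)%N.
by rewrite (bigD1 i)//= eqxx big1 ?addn0 ?mul1n// => r /negbTE->.
Qed.

Section taylor.
Variables (R : realType) (d m : nat).
Notation mi := {ffun 'I_d -> nat}.
Implicit Types (D : mi -> R) (k s : mi) (v x y : 'rV[R]_d) (l : seq 'I_d).

(** Taylor polynomial of total order [m] in the coordinates listed in [l], expanding the
    head of [l] first; [D k] stands for the derivative [k] at the base point, and [k]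
    records the orders already spent. *)
Fixpoint taylor_sum D l k v : R :=
  if l is i :: l' then
    \sum_(j < (m - multi_size k).+1)
      taylor_sum D l' (mi_add k i j) v * (v ord0 i ^+ j / j`!%:R)
  else D k.

Lemma multi_powD v k i j :
  multi_pow v (mi_add k i j) = multi_pow v k * v ord0 i ^+ j.
Proof.
rewrite /multi_pow; under eq_bigr do rewrite ffunE exprD.
rewrite big_split /=; congr (_ * _).
by rewrite (bigD1 i)//= eqxx mul1n big1 ?mulr1// => r /negbTE->.
Qed.

Lemma multi_factD k i j : k i = 0%N ->
  multi_fact (mi_add k i j) = (multi_fact k * j`!)%N.
Proof.
move=> ki; rewrite /multi_fact (bigD1 i)//= [in RHS](bigD1 i)//= ffunE eqxx ki.
rewrite mul1n add0n fact0 mul1n mulnC; congr (_ * _)%N.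
by apply: eq_bigr => r /negbTE ri; rewrite ffunE ri addn0.
Qed.

Lemma multi_fact_neq0 k : (multi_fact k)%:R != 0 :> R.
Proof.
rewrite pnatr_eq0 -lt0n /multi_fact; elim/big_ind: _ => // [x y|r _].
  by rewrite muln_gt0 => -> ->.
exact: fact_gt0.
Qed.

(** In the sum over the orders of coordinate i only the order [s i] survives. For the induction, [k]
    holds the orders already chosen, the quotient of [multi_pow] by [multi_fact] is the monomial
    they produced, and the Boolean says that [s] can still be reached from [k] within degree m. *)
Lemma taylor_sum_functional D l k s (J : finType) (w : J -> R) (v : J -> 'rV[R]_d) :
  uniq l -> (forall r, r \in l -> k r = 0%N) -> (multi_size k <= m)%N ->
  (forall k, (multi_size k <= m)%N ->
    \sum_j multi_pow (v j) k * w j = (k == s)%:R * (multi_fact s)%:R) ->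
  \sum_j w j * (taylor_sum D l k (v j) * (multi_pow (v j) k / (multi_fact k)%:R)) =
  ([forall (r | r \notin l), k r == s r] && (multi_size s <= m)%N)%:R * D s.
Proof.
move=> + + + hw; elim: l k => [|i l ih] k /= ul kl km.
  have -> : [forall (r | r \notin [::]), k r == s r] = (k == s).
    apply/forallP/eqP => [h|-> r]; last by rewrite eqxx implybT.
    by apply/ffunP => r; have := h r; rewrite in_nil /= => /eqP.
  transitivity (D k * (\sum_j multi_pow (v j) k * w j) / (multi_fact k)%:R).
    by rewrite mulr_sumr mulr_suml; apply: eq_bigr => j _; ring.
  rewrite hw//; have [ks|] := eqVneq k s; last by rewrite /= !(mul0r, mulr0).
  rewrite -ks km /=; field; exact: multi_fact_neq0.
case/andP: ul => il ul.
have ki : k i = 0%N by rewrite kl ?mem_head.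
set N := (m - multi_size k)%N.
have kN : (multi_size k + N = m)%N by rewrite subnKC.
transitivity (\sum_(n < N.+1) \sum_j w j * (taylor_sum D l (mi_add k i n) (v j) *
    (multi_pow (v j) (mi_add k i n) / (multi_fact (mi_add k i n))%:R))).
  rewrite exchange_big /=; apply: eq_bigr => j _.
  rewrite -mulr_sumr mulr_suml; congr (_ * _); apply: eq_bigr => n _.
  rewrite multi_powD multi_factD// natrM; field.
  by rewrite multi_fact_neq0 pnatr_eq0 -lt0n fact_gt0.
have nN (n : 'I_N.+1) : (multi_size (mi_add k i n) <= m)%N.
  by rewrite multi_size_add -kN leq_add2l -ltnS.
transitivity (\sum_(n < N.+1)
   ([forall (r | r \notin l), mi_add k i n r == s r] && (multi_size s <= m)%N)%:R * D s).
  apply: eq_bigr => n _; rewrite ih// => r rl; rewrite ffunE.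
  rewrite kl ?inE ?rl ?orbT//; case: eqP => // ri.
  by rewrite -ri rl in il.
have [sm|] := leqP (multi_size s) m; last first.
  by rewrite andbF mul0r => _; rewrite big1// => n _; rewrite andbF mul0r.
rewrite andbT.
have allE n : [forall (r | r \notin l), mi_add k i n r == s r] =
    [forall (r | r \notin i :: l), k r == s r] && (n == s i).
  apply/forall_inP/andP => [h|[/forall_inP h /eqP ni] r rl].
    split.
      apply/forall_inP => r; rewrite inE negb_or => /andP[ri rl].
      by have := h r rl; rewrite ffunE (negbTE ri) addn0.
    by have := h i il; rewrite ffunE eqxx ki add0n mul1n.
  rewrite ffunE; have [->|ri] := eqVneq r i; first by rewrite ki ni mul1n.
  by rewrite addn0; apply: h; rewrite inE negb_or ri.
have [ks|nks] := boolP [forall (r | r \notin i :: l), k r == s r]; last first.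
  by rewrite mul0r big1// => n _; rewrite allE (negbTE nks) mul0r.
(* The order [s i] lies in the truncated range: setting coordinate i of [k] to [s i] stays
   componentwise below [s], whose size is at most m. *)
have siN : (s i < N.+1)%N.
  rewrite ltnS -(leq_add2l (multi_size k)) kN (leq_trans _ sm)//.
  rewrite -(multi_size_add k i) /multi_size; apply: leq_sum => r _; rewrite ffunE.
  have [->|ri] := eqVneq r i; first by rewrite ki mul1n.
  rewrite addn0; have [rl|rl] := boolP (r \in l).
    by rewrite kl// inE rl orbT.
  by have /forall_inP/(_ r) := ks; rewrite inE negb_or ri rl => /(_ isT)/eqP->.
rewrite (bigD1 (Ordinal siN))//= allE ks eqxx big1 ?addr0// => n.
by rewrite -val_eqE /= => /negbTE nsi; rewrite allE nsi andbF mul0r.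
Qed.

(** Coordinates are expanded from the largest to the smallest. When [i] is treated, all smaller
    coordinates are still to come and have order zero in [k], which is what [pderiv_add]
    requires. *)
Fixpoint down_closed l : Prop :=
  if l is i :: l' then (forall r : 'I_d, (r < i)%N -> r \in l') /\ down_closed l'
  else True.

Definition hybrid l x y : 'rV[R]_d :=
  \row_r (if r \in l then y ord0 r else x ord0 r).

(** One coordinate contributes its own remainder, the 1, and at most m+1 coefficients, each carrying
    the error of the remaining coordinates. *)
Definition taylor_const (n : nat) : R := iter n (fun c => 1 + m.+1%:R * c) 0.

Lemma taylor_const_ge0 n : 0 <= taylor_const n.
Proof. by elim: n => //= n ih; rewrite addr_ge0// mulr_ge0. Qed.

(** The coordinates of [y] are replaced by those of [x] one by one. Each replacement is a
    one-dimensional expansion along an axis-parallel segment between two hybrids; its coefficients,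
    taken at the next hybrid, are expanded in turn by induction. *)
Lemma taylor_remainder (D : mi -> 'rV[R]_d -> R) (H Q : R) x y l k :
  (forall (i : 'I_d) k (z : 'rV[R]_d) (t : R), (forall r : 'I_d, (r < i)%N -> k r = 0%N) -> (multi_size k < m)%N ->
    open_cube (z + t *: basis_vec R i) ->
    is_derive t 1 (fun t => D k (z + t *: basis_vec R i))
      (D (mi_add k i 1) (z + t *: basis_vec R i))) ->
  (forall (i : 'I_d) k (z : 'rV[R]_d) (t : R), (forall r : 'I_d, (r < i)%N -> k r = 0%N) -> multi_size k = m ->
    open_cube z -> open_cube (z + t *: basis_vec R i) -> `|t| <= H ->
    `|D k (z + t *: basis_vec R i) - D k z| <= Q) ->
  open_cube x -> open_cube y -> `|y - x| <= H ->
  uniq l -> down_closed l -> (forall r, r \in l -> k r = 0%N) ->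
  (multi_size k <= m)%N ->
  `|D k (hybrid l x y) - taylor_sum (D ^~ x) l k (y - x)| <=
    taylor_const (size l) * (Q * H ^+ (m - multi_size k)).
Proof.
move=> dD hD ox oy yxH.
have H0 : 0 <= H by apply: le_trans yxH.
set v := y - x.
have vH i : `|v ord0 i| <= H by apply: le_trans yxH; exact: rV_coord_le_norm.
elim: l k => [|i l ih] k /=.
  move=> _ _ _ _; rewrite mul0r.
  rewrite (_ : hybrid [::] x y = x) ?subrr ?normr0//.
  by apply/rowP => r; rewrite mxE.
move=> /andP[il ul] [li dl] kl km.
have ki : k i = 0%N by rewrite kl ?mem_head.
set N := (m - multi_size k)%N.
have kN : (multi_size k + N = m)%N by rewrite subnKC.
set z := hybrid l x y; set c : R := v ord0 i.
have hybE : hybrid (i :: l) x y = z + c *: basis_vec R i.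
  apply/rowP => r; rewrite !mxE inE eqxx /=.
  have [->|ri] := eqVneq r i; first by rewrite (negbTE il) /c /v !mxE mulr1 addrC subrK.
  by rewrite mulr0 addr0.
have oz (u : R) : 0 <= u <= 1 -> open_cube (z + (u * c) *: basis_vec R i).
  move=> /andP[u0 u1] r; rewrite !mxE eqxx /=.
  have /andP[x0 x1] := ox r; have /andP[y0 y1] := oy r.
  have [ri|ri] := eqVneq r i; last by rewrite mulr0 addr0; case: ifP; rewrite ?x0 ?y0.
  rewrite ri (negbTE il) -ri /c /v !mxE -ri mulr1.
  move: x0 x1 y0 y1; move: (x ord0 r) (y ord0 r) => /= a b x0 x1 y0 y1.
  by have [ab|ab] := lerP a b; apply/andP; split; nra.
have kadd j (r : 'I_d) : (r < i)%N -> mi_add k i j r = 0%N.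
  move=> ri; rewrite ffunE kl ?inE ?li ?orbT// add0n.
  by case: eqP => // rE; rewrite rE ltnn in ri.
(* [phi j] is the j-th derivative of the restriction to the segment: u = 0 is the hybrid for [l], u
   = 1 the one for [i :: l]. *)
pose phi j u := D (mi_add k i j) (z + (u * c) *: basis_vec R i) * c ^+ j.
have dphi j (u : R) : (j < N)%N -> 0 <= u <= 1 -> is_derive u 1 (phi j) (phi j.+1 u).
  move=> jN u01.
  have d1 := dD i (mi_add k i j) z (u * c) (kadd j).
  rewrite multi_size_add -kN ltn_add2l in d1.
  have {}d1 := d1 jN (oz u u01).
  rewrite mi_addS in d1.
  have d2 : is_derive u 1 (fun u : R => u * c) c.
    have := @is_deriveM R R^o id (cst c) u 1 1 0 (is_derive_id _ _) (is_derive_cst _ _ _).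
    move/is_derive_eq; apply.
    rewrite scaler0 add0r; exact: mulr1.
  have d3 := @is_derive1_comp R _ _ u _ _ d1 d2.
  have := @is_deriveM R R^o _ (cst (c ^+ j)) u 1 _ 0 d3 (is_derive_cst _ _ _).
  move/is_derive_eq; apply.
  rewrite scaler0 add0r /phi exprS mulrA; exact: mulrC.
have u01 : 0 <= (1 : R) <= 1 by rewrite ler01 lexx.
have u00 : 0 <= (0 : R) <= 1 by rewrite ler01 lexx.
have z0 : z + (0 * c) *: basis_vec R i = z by rewrite mul0r scale0r addr0.
have hphi (u : R) : 0 <= u <= 1 -> `|phi N u - phi N 0| <= Q * H ^+ N.
  move=> u01'; rewrite /phi -mulrBl normrM normrX.
  apply: ler_pM => //; rewrite ?exprn_ge0//; last first.
    by apply: lerXn2r; rewrite ?nnegrE//; exact: vH.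
  rewrite z0; apply: hD; [exact: kadd|by rewrite multi_size_add| |exact: oz|].
    by rewrite -z0; exact: oz.
  rewrite normrM -[leRHS]mul1r; apply: ler_pM => //; last exact: vH.
  by case/andP: u01' => ? ?; rewrite ger0_norm.
have := taylor_unit dphi hphi u01.
rewrite horner_poly {1}/phi mi_add0 mul1r expr0 mulr1 -hybE => tay.
(* First the one-dimensional remainder, then the errors made by the coefficients. *)
have -> : D k (hybrid (i :: l) x y) - \sum_(j < N.+1)
     taylor_sum (D^~ x) l (mi_add k i j) v * (c ^+ j / j`!%:R) =
  (D k (hybrid (i :: l) x y) - \sum_(j < N.+1) phi j 0 / j`!%:R * 1 ^+ j) +
  \sum_(j < N.+1) (D (mi_add k i j) z - taylor_sum (D^~ x) l (mi_add k i j) v) *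
     (c ^+ j / j`!%:R).
  rewrite -[RHS]addrA; congr (_ + _).
  rewrite -!sumrN -big_split /=; apply: eq_bigr => j _.
  by rewrite /phi z0 expr1n; ring.
rewrite (le_trans (ler_normD _ _))//.
rewrite mulrDl mul1r lerD//.
rewrite (le_trans (ler_norm_sum _ _ _))//.
have QH : 0 <= Q * H ^+ N by apply: le_trans (hphi 0 u00).
have cQ : 0 <= taylor_const (size l) * (Q * H ^+ N).
  by rewrite mulr_ge0// taylor_const_ge0.
apply: (@le_trans _ _ (\sum_(j < N.+1) taylor_const (size l) * (Q * H ^+ N))); last first.
  rewrite sumr_const card_ord -[_ *+ _]mulr_natl -mulrA ler_wpM2r// ler_nat ltnS.
  by rewrite -kN leq_addl.
apply: ler_sum => j _.
have jN : (j <= N)%N by rewrite -ltnS.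
have jm : (multi_size (mi_add k i j) <= m)%N.
  by rewrite multi_size_add -kN leq_add2l.
have kl' (r : 'I_d) : r \in l -> mi_add k i j r = 0%N.
  move=> rl; rewrite ffunE kl ?inE ?rl ?orbT// add0n.
  by case: eqP => // rE; rewrite -rE rl in il.
have := ih (mi_add k i j) ul dl kl' jm; rewrite -/z => hih.
(* The coefficient of order j has only N - j orders left; the factor c^j restores the missing power
   of [H]. *)
have -> : Q * H ^+ N = Q * H ^+ (m - multi_size (mi_add k i j)) * H ^+ j.
  rewrite -mulrA -exprD multi_size_add; congr (_ * _ ^+ _).
  by move: kN jN; clear; lia.
rewrite [leRHS]mulrA normrM; apply: ler_pM => //.
rewrite normrM normfV normrX (ger0_norm (ler0n _ _)).
rewrite ler_pdivrMr ?ltr0n ?fact_gt0//.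
apply: (@le_trans _ _ (H ^+ j)); first by apply: lerXn2r; rewrite ?nnegrE//; exact: vH.
by rewrite ler_peMr ?exprn_ge0// ler1n fact_gt0.
Qed.
End taylor.

(** * Derivatives in the open cube and their extension to the boundary *)

Lemma size_pderiv_seq (d : nat) (k : {ffun 'I_d -> nat}) :
  size (flatten [seq nseq (k r) r | r <- enum 'I_d]) = multi_size k.
Proof.
rewrite size_flatten /shape -map_comp sumnE big_map big_enum.
by apply: eq_bigr => r _ /=; rewrite size_nseq.
Qed.

(** [pderiv] differentiates in the last coordinates first, hence the condition on [k]. *)
Lemma pderiv_add (R : realType) (d : nat) (k : {ffun 'I_d -> nat}) (i : 'I_d)
    (f : 'rV[R]_d -> R) :
  (forall r : 'I_d, (r < i)%N -> k r = 0%N) ->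
  pderiv (mi_add k i 1) f = partial i (pderiv k f).
Proof.
move=> ki; rewrite /pderiv -[RHS]/(iter_partial (i :: _) f).
congr iter_partial.
have : sorted (fun a b : 'I_d => (a < b)%N) (enum 'I_d).
  by have := iota_ltn_sorted 0 d; rewrite -val_enum_ord sorted_map.
have : i \in enum 'I_d by rewrite mem_enum.
have tr : transitive (fun a b : 'I_d => (a < b)%N) by move=> b a c; exact: ltn_trans.
elim: (enum 'I_d) => // r s ih; rewrite inE => /predU1P[<-|si] rs.
  rewrite /= ffunE eqxx mul1n addn1 /=; congr (_ :: _ ++ flatten _).
  have := order_path_min tr rs.
  move=> /allP h; apply/eq_in_map => j /h ij; rewrite ffunE.
  by case: eqP => [jE|_]; [rewrite jE ltnn in ij|rewrite addn0].
have ri : (r < i)%N.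
  have /allP := order_path_min tr rs.
  exact.
rewrite /= ffunE ki// -val_eqE (ltn_eqF ri) /= ih//.
exact: path_sorted rs.
Qed.

Lemma is_derive_line (R : realType) (d : nat) (g : 'rV[R]_d -> R) (z : 'rV[R]_d)
    (i : 'I_d) (t : R) :
  derivable g (z + t *: basis_vec R i) (basis_vec R i) ->
  is_derive t 1 (fun t => g (z + t *: basis_vec R i))
    (partial i g (z + t *: basis_vec R i)).
Proof.
move=> dg.
have e : (fun h : R => h^-1 *: (((fun t => g (z + t *: basis_vec R i)) \o shift t) (h *: (1:R)) -
      g (z + t *: basis_vec R i))) =
   (fun h : R => h^-1 *: ((g \o shift (z + t *: basis_vec R i)) (h *: basis_vec R i) -
      g (z + t *: basis_vec R i))).
  apply/funext => h /=; congr (_ *: (g _ - _)).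
  by rewrite [h *: 1]mulr1 scalerDl addrCA.
split; first by rewrite /derivable e.
by rewrite /partial /derive e.
Qed.

Section cube.
Variables (R : realType) (d : nat).
Notation mi := {ffun 'I_d -> nat}.
Implicit Types (x y : 'rV[R]_d) (f : 'rV[R]_d -> R) (k : mi).

(** A contraction towards the center (1/2, ..., 1/2), which sends the closed cube into the open one
    and tends to the identity. Estimates proved in the interior reach the boundary along it. *)
Definition shrink (n : nat) x : 'rV[R]_d :=
  \row_r (x ord0 r + n.+2%:R^-1 * (2^-1 - x ord0 r)).

Lemma open_cube_sub x : open_cube x -> cube x.
Proof. by move=> ox r; have /andP[h1 h2] := ox r; rewrite !ltW. Qed.

Lemma shrink_open n x : cube x -> open_cube (shrink n x).
Proof.
move=> cx r; rewrite mxE.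
have : 0 < n.+2%:R^-1 :> R by rewrite invr_gt0.
have : n.+2%:R^-1 < 1 :> R by rewrite invf_lt1// ltr1n.
have /andP[x0 x1] := cx r.
move: (x ord0 r) (n.+2%:R^-1) x0 x1 => a b a0 a1 b1 b0.
by apply/andP; split; nra.
Qed.

Lemma cvg_rV (u : nat -> 'rV[R]_d) x :
  (forall r, u n ord0 r @[n --> \oo] --> x ord0 r) -> u n @[n --> \oo] --> x.
Proof.
move=> h; apply/cvgrPdist_le => e e0.
have : \forall n \near \oo, forall r : 'I_d, `|x ord0 r - u n ord0 r| <= e.
  by apply: filter_forall => r; have /cvgrPdist_le := h r; apply.
apply: filterS => n hn; apply/rV_norm_leP; first exact: ltW.
by move=> r; rewrite !mxE.
Qed.

Lemma shrink_cvg_coord x r : shrink n x ord0 r @[n --> \oo] --> x ord0 r.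
Proof.
under eq_fun do rewrite mxE.
suff : (x ord0 r + n.+2%:R^-1 * (2^-1 - x ord0 r)) @[n --> \oo] -->
    x ord0 r + 0 * (2^-1 - x ord0 r) by rewrite mul0r addr0.
apply: cvgD; first exact: cvg_cst.
apply: cvgMl.
have h := @cvg_harmonic R; rewrite -cvg_shiftS in h.
exact: h.
Qed.

Lemma shrink_cvg x : shrink n x @[n --> \oo] --> x.
Proof. by apply: cvg_rV => r; exact: shrink_cvg_coord. Qed.

Lemma shrink_cvg_within x (A : set 'rV[R]_d) : cube x -> @open_cube R d `<=` A ->
  shrink n x @[n --> \oo] --> within A (nbhs x).
Proof.
move=> cx oA B /= hB.
have : \forall n \near \oo, A (shrink n x) -> B (shrink n x).
  exact: (shrink_cvg hB).
by apply: filterS => n; apply; apply: oA; exact: shrink_open.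
Qed.

Lemma within_open_cube_proper x : cube x ->
  ProperFilter (within (@open_cube R d) (nbhs x)).
Proof.
move=> cx; apply: within_nbhs_proper => B hB.
have h := @shrink_cvg x B hB.
have [n _ hn] := h.
exists (shrink n x); split; first exact: shrink_open.
exact: hn (leqnn n).
Qed.

(** [cube_pderiv] is a [lim], informative only once convergence is known. The continuous extension
    provided by [cube_Cm] gives that convergence and identifies the limit. *)
Lemma cube_pderivP f m k : cube_Cm m f -> (multi_size k <= m)%N ->
  (forall x, open_cube x -> cube_pderiv k f x = pderiv k f x) /\
  (forall x, cube x -> pderiv k f (shrink n x) @[n --> \oo] --> cube_pderiv k f x).
Proof.
move=> [_ _ ext] km.
have [|g [cg gE]] := ext (flatten [seq nseq (k r) r | r <- enum 'I_d]).
  by rewrite size_pderiv_seq.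
have gE' x : open_cube x -> g x = pderiv k f x by move=> ox; apply: gE; rewrite inE.
have gC x : cube x -> g @ within (@cube R d) (nbhs x) --> g x.
  by move=> cx; move/subspace_continuousP : cg; exact.
have gP x : cube x -> cube_pderiv k f x = g x.
  move=> cx; rewrite /cube_pderiv.
  have PF := within_open_cube_proper cx.
  apply: cvg_lim => //.
  apply/cvgrPdist_le => e e0; rewrite near_withinE.
  have /cvgrPdist_le/(_ _ e0) := gC x cx; rewrite near_withinE.
  by apply: filterS => z + oz; rewrite -gE'//; apply; exact: open_cube_sub.
split=> x cx; first by rewrite gP ?gE'//; exact: open_cube_sub.
rewrite gP//.
have -> : (fun n => pderiv k f (shrink n x)) = (fun n => g (shrink n x)).
  by apply/funext => n; rewrite gE'//; exact: shrink_open.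
apply: (cvg_comp _ _ (shrink_cvg_within cx (@open_cube_sub))).
exact: gC.
Qed.

Lemma multi_size0 : multi_size ([ffun=> 0%N] : mi) = 0%N.
Proof. by rewrite /multi_size big1// => r _; rewrite ffunE. Qed.

Lemma pderiv0 f : pderiv ([ffun=> 0%N] : mi) f = f.
Proof.
rewrite /pderiv (_ : flatten _ = [::])//.
by elim: (enum 'I_d) => //= r s ->; rewrite ffunE.
Qed.

Lemma cube_pderiv0 f m x : cube_Cm m f -> cube x ->
  cube_pderiv ([ffun=> 0%N] : mi) f x = f x.
Proof.
move=> cf cx.
have [|_ h] := cube_pderivP (k := [ffun=> 0%N]) cf; first by rewrite multi_size0.
have := h x cx; rewrite pderiv0 => h1.
apply: (cvg_unique _ h1) => //.
case: cf => /subspace_continuousP cf _ _.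
exact: (cvg_comp _ _ (shrink_cvg_within cx (@open_cube_sub)) (cf x cx)).
Qed.

Lemma is_derive_pderiv f m (i : 'I_d) k z (t : R) : cube_Cm m f ->
  (forall r : 'I_d, (r < i)%N -> k r = 0%N) -> (multi_size k < m)%N ->
  open_cube (z + t *: basis_vec R i) ->
  is_derive t 1 (fun t => pderiv k f (z + t *: basis_vec R i))
    (pderiv (mi_add k i 1) f (z + t *: basis_vec R i)).
Proof.
move=> [_ df _] ki km oz; rewrite pderiv_add//.
apply: is_derive_line; apply: df => //.
by rewrite size_pderiv_seq.
Qed.

(** A real-valued, pointwise form of the bound on [holder_norm]: both parts of the norm are
    nonnegative, so each is bounded by the same [M]. *)
Definition holder_bound (a M : R) f : Prop :=
  [/\ cube_Cm (sfloor a) f,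
    forall k x, (multi_size k <= sfloor a)%N -> cube x -> `|cube_pderiv k f x| <= M &
    forall k x y, multi_size k = sfloor a -> cube x -> cube y ->
      `|cube_pderiv k f x - cube_pderiv k f y| <= M * `|x - y| `^ (a - (sfloor a)%:R)].

Hypothesis d0 : (0 < d)%N.

Lemma holder_bound_ge0 a M f : holder_bound a M f -> 0 <= M.
Proof.
move=> [_ h _]; have c0 : cube (0 : 'rV[R]_d) by move=> r; rewrite mxE lexx ler01.
have := h [ffun=> 0%N] 0; rewrite multi_size0 => /(_ isT c0).
exact: le_trans.
Qed.

Lemma cube_const (c : R) : 0 <= c <= 1 -> cube (const_mx c : 'rV[R]_d).
Proof. by move=> c01 r; rewrite mxE. Qed.

Lemma holder_norm_bound a M f : cube_Cm (sfloor a) f ->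
  (holder_norm a f <= M%:E)%E -> holder_bound a M f.
Proof.
move=> cf; rewrite /holder_norm; set A := ereal_sup _; set B := ereal_sup _ => AB.
have c0 : cube (const_mx 0 : 'rV[R]_d) by apply: cube_const; rewrite lexx ler01.
have c1 : cube (const_mx 1 : 'rV[R]_d) by apply: cube_const; rewrite lexx ler01.
have c01 : (const_mx 0 : 'rV[R]_d) != const_mx 1.
  apply/eqP => /rowP/(_ (Ordinal d0)); rewrite !mxE => /esym/eqP.
  by rewrite oner_eq0.
(* A supremum over the empty set is [-oo]. The index [ka] of size [sfloor a] and two opposite
   corners show that the seminorm part is nonnegative, so that the sum bounds each part. *)
pose ka : mi := [ffun r => if r == Ordinal d0 then sfloor a else 0%N].
have kaE : multi_size ka = sfloor a.
  rewrite /multi_size (bigD1 (Ordinal d0))//= ffunE eqxx big1 ?addn0// => r /negbTE r0.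
  by rewrite ffunE r0.
have Ak k x : (multi_size k <= sfloor a)%N -> cube x -> ((`|cube_pderiv k f x|)%:E <= A)%E.
  move=> kx cx; apply: (@le_trans _ _ (sup_norm (cube_pderiv k f))).
    by apply: ereal_sup_ubound; exists x.
  by apply: ereal_sup_ubound; exists k.
have Bk k x y : multi_size k = sfloor a -> cube x -> cube y -> x != y ->
    ((`|cube_pderiv k f x - cube_pderiv k f y| / `|x - y| `^ (a - (sfloor a)%:R))%:E <= B)%E.
  move=> kx cx cy xy.
  apply: (@le_trans _ _ (holder_seminorm (a - (sfloor a)%:R) (cube_pderiv k f))).
    by apply: ereal_sup_ubound; exists (x, y).
  by apply: ereal_sup_ubound; exists k.
have A0 : (0 <= A)%E.
  apply: le_trans (Ak [ffun=> 0%N] _ _ c0); first by rewrite lee_fin.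
  by rewrite multi_size0.
have B0 : (0 <= B)%E.
  apply: le_trans (Bk ka _ _ kaE c0 c1 c01).
  by rewrite lee_fin divr_ge0// powR_ge0.
have AM : (A <= M%:E)%E by apply: le_trans AB; rewrite leeDl.
have BM : (B <= M%:E)%E by apply: le_trans AB; rewrite leeDr.
split => // [k x kx cx|k x y kx cx cy].
  by have := le_trans (Ak k x kx cx) AM; rewrite lee_fin.
have [->|xy] := eqVneq x y.
  rewrite !subrr normr0 mulr_ge0 ?powR_ge0//.
  by rewrite -lee_fin (le_trans A0).
have := le_trans (Bk k x y kx cx cy xy) BM; rewrite lee_fin ler_pdivrMr//.
by rewrite powR_gt0// normr_gt0 subr_eq0.
Qed.

End cube.

(** * Taylor's formula up to the boundary and the bias of a linear functional *)

Lemma is_derive_scale_arg (R : realType) (F : R -> R) (u c dF : R) :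
  is_derive (u * c) 1 F dF -> is_derive u 1 (fun u => F (u * c)) (dF * c).
Proof.
move=> d1.
have d2 : is_derive u 1 (fun u : R => u * c) c.
  have := @is_deriveM R R^o id (cst c) u 1 1 0 (is_derive_id _ _) (is_derive_cst _ _ _).
  by move/is_derive_eq; apply; rewrite scaler0 add0r; exact: mulr1.
exact: (@is_derive1_comp R _ _ u _ _ d1 d2).
Qed.

Lemma sfloor_ge (R : realType) (a : R) : 0 < a -> a <= (sfloor a).+1%:R.
Proof.
move=> a0; rewrite leNgt; apply/negP => h.
by have [_ /(_ _ h)] := sfloorP a0; rewrite ltnn.
Qed.

Lemma rV_norm_basis (R : realType) (d : nat) (i : 'I_d) (t : R) :
  `|t *: basis_vec R i| <= `|t|.
Proof.
apply/rV_norm_leP => // r; rewrite !mxE eqxx /= normrM.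
by case: (r == i); rewrite ?normr1 ?normr0 ?mulr1 ?mulr0.
Qed.

Lemma down_closed_rev_enum (d : nat) : down_closed (rev (enum 'I_d)).
Proof.
suff h (s1 s2 : seq 'I_d) : sorted (fun a b : 'I_d => (b < a)%N) (s1 ++ s2) ->
    (forall r, r \in s1 ++ s2) -> down_closed s2.
  apply: (h [::]) => /=; last by move=> r; rewrite mem_rev mem_enum.
  rewrite rev_sorted; have := iota_ltn_sorted 0 d.
  by rewrite -val_enum_ord sorted_map.
elim: s2 s1 => //= i s2 ih s1 st al; split; last first.
  by apply: (ih (rcons s1 i)); rewrite cat_rcons.
move=> r ri.
have := al r; rewrite mem_cat inE => /or3P[rs|/eqP rE|//]; last first.
  by rewrite rE ltnn in ri.
have tr : transitive (fun a b : 'I_d => (b < a)%N).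
  by move=> b a c ab bc; exact: ltn_trans bc ab.
have := st; rewrite (sorted_pairwise tr) pairwise_cat => /and3P[/allrelP h _ _].
have := h r i rs (mem_head _ _) => ir.
by have := ltn_trans ri ir; rewrite ltnn.
Qed.

Lemma cvg_sumr (R : realType) (n : nat) (u : 'I_n -> nat -> R) (l : 'I_n -> R) :
  (forall i, u i q @[q --> \oo] --> l i) ->
  (\sum_(i < n) u i q) @[q --> \oo] --> \sum_(i < n) l i.
Proof.
move=> h; elim: (index_enum _) => [|i s ih].
  by rewrite big_nil; under eq_fun do rewrite big_nil; exact: cvg_cst.
by rewrite big_cons; under eq_fun do rewrite big_cons; apply: cvgD.
Qed.

Section cube_taylor.
Variables (R : realType) (d m : nat).
Notation mi := {ffun 'I_d -> nat}.
Implicit Types (x y z : 'rV[R]_d) (f : 'rV[R]_d -> R) (k s : mi).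

Lemma open_cube_segment z i (t u : R) : open_cube z ->
  open_cube (z + t *: basis_vec R i) -> 0 <= u <= 1 ->
  open_cube (z + (u * t) *: basis_vec R i).
Proof.
move=> oz ozt /andP[u0 u1] r; have := oz r; have := ozt r.
rewrite !mxE eqxx /=; case: (r == i); rewrite ?mulr1 ?mulr0 ?addr0//.
move: (z ord0 r) => a /andP[h1 h2] /andP[h3 h4].
by have [tn|tp] := leP t 0; apply/andP; split; nra.
Qed.

(** Two regimes are merged by the minima. If sfloor a <= m, the top derivative is Hoelder of
    exponent a - sfloor a. If m < sfloor a, the derivative of order m is Lipschitz, because that of
    order m+1 is bounded, and the exponent is (m+1) - m = 1. *)
Lemma pderiv_increment a M f (i : 'I_d) k z (t H : R) : 0 < a -> holder_bound a M f ->
  (forall r : 'I_d, (r < i)%N -> k r = 0%N) -> multi_size k = minn m (sfloor a) ->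
  open_cube z -> open_cube (z + t *: basis_vec R i) -> `|t| <= H ->
  `|pderiv k f (z + t *: basis_vec R i) - pderiv k f z| <=
    M * H `^ (Num.min a m.+1%:R - (minn m (sfloor a))%:R).
Proof.
move=> a0 hf ki km oz ozt tH.
have M0 := holder_bound_ge0 hf.
have H0 : 0 <= H by apply: le_trans tH.
have [cf hb hh] := hf.
have [sm|ms] := leqP (sfloor a) m.
  rewrite (minn_idPr sm) in km *.
  have -> : Num.min a m.+1%:R = a.
    by rewrite min_l// (le_trans (sfloor_ge a0))// ler_nat ltnS.
  have [e _] := cube_pderivP cf (eq_leq km).
  rewrite -!e//.
  apply: (le_trans (hh _ _ _ km (open_cube_sub ozt) (open_cube_sub oz))).
  rewrite ler_wpM2l// addrAC subrr add0r.
  have [sa _] := sfloorP a0.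
  apply: ge0_ler_powR; rewrite ?nnegrE ?subr_ge0 ?(ltW sa)//.
  by apply: le_trans tH; exact: rV_norm_basis.
rewrite (minn_idPl (ltnW ms)) in km *.
have [sa _] := sfloorP a0.
have ma : m.+1%:R <= a by rewrite (le_trans _ (ltW sa))// ler_nat.
have -> : Num.min a m.+1%:R - m%:R = 1.
  by rewrite min_r// -natr1 addrAC subrr add0r.
rewrite powRr1//.
pose psi (u : R) := pderiv k f (z + (u * t) *: basis_vec R i).
pose dpsi (u : R) := pderiv (mi_add k i 1) f (z + (u * t) *: basis_vec R i) * t.
have hpsi (u : R) : 0 <= u <= 1 -> is_derive u 1 psi (dpsi u).
  move=> u01.
  have kms : (multi_size k < sfloor a)%N by rewrite km.
  have := is_derive_pderiv cf ki kms (open_cube_segment oz ozt u01).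
  exact: is_derive_scale_arg.
have inI (u : R) : u \in `[0, 1]%R -> 0 <= u <= 1 by rewrite in_itv.
have cpsi : {within `[0, 1], continuous psi}.
  by apply: derivable_within_continuous => u u01; case: (hpsi u (inI u u01)).
have ipsi (u : R) : u \in `]0, 1[%R -> is_derive u 1 psi (dpsi u).
  by move=> u01; apply/hpsi/inI/subset_itv_oo_cc.
have [c c01] := MVT_segment ler01 ipsi cpsi.
rewrite {1 2}/psi mul1r mul0r scale0r addr0 subr0 mulr1 => ->.
rewrite /dpsi normrM; apply: ler_pM => //.
have oc := open_cube_segment oz ozt (inI c c01).
have k1 : (multi_size (mi_add k i 1) <= sfloor a)%N.
  by rewrite multi_size_add km addn1.
have [e _] := cube_pderivP cf k1.
by rewrite -e//; apply: hb => //; exact: open_cube_sub.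
Qed.

Lemma taylor_sum_cvg (D : nat -> mi -> R) (D' : mi -> R) (n : nat) (l : seq 'I_d) k
    (v : nat -> 'rV[R]_d) (v' : 'rV[R]_d) : (multi_size k <= n)%N ->
  (forall k, (multi_size k <= n)%N -> D q k @[q --> \oo] --> D' k) ->
  (forall r, v q ord0 r @[q --> \oo] --> v' ord0 r) ->
  taylor_sum n (D q) l k (v q) @[q --> \oo] --> taylor_sum n D' l k v'.
Proof.
move=> + hD hv; elim: l k => [|i l ih] k kn /=; first exact: hD.
apply: cvg_sumr => j; apply: cvgM.
  apply: ih; rewrite multi_size_add.
  by have := ltn_ord j; rewrite ltnS -(leq_add2l (multi_size k)) subnKC.
apply: cvgM; last exact: cvg_cst.
elim: (nat_of_ord j) => [|q ihq]; first by under eq_fun do rewrite expr0; exact: cvg_cst.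
by under eq_fun do rewrite exprS; rewrite exprS; apply: cvgM.
Qed.

(** The interior estimate is applied to the shrunk points, and both sides pass to the limit. *)
Lemma taylor_cube a M f x y (H : R) : 0 < a -> holder_bound a M f ->
  cube x -> cube y -> `|y - x| <= H ->
  `|f y - taylor_sum (minn m (sfloor a)) (fun k => cube_pderiv k f x)
      (rev (enum 'I_d)) [ffun=> 0%N] (y - x)| <=
  taylor_const R (minn m (sfloor a)) d *
    (M * H `^ (Num.min a m.+1%:R - (minn m (sfloor a))%:R) * H ^+ minn m (sfloor a)).
Proof.
move=> a0 hf cx cy yxH.
have [cf hb hh] := hf.
set n := minn m (sfloor a); set Q := M * _.
have ns : (n <= sfloor a)%N by rewrite geq_minr.
(* Shrinking multiplies differences by 1 - 1/(q+2), so the same [H] works for every q. *)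
have yxq q : `|shrink q y - shrink q x| <= H.
  apply: le_trans yxH; apply/rV_norm_leP => // r; rewrite !mxE.
  have -> : y ord0 r + q.+2%:R^-1 * (2^-1 - y ord0 r) -
      (x ord0 r + q.+2%:R^-1 * (2^-1 - x ord0 r)) =
      (1 - q.+2%:R^-1) * (y - x) ord0 r by rewrite !mxE; ring.
  rewrite normrM -[leRHS]mul1r ler_pM// ?rV_coord_le_norm//.
  have q0 : 0 <= q.+2%:R^-1 :> R by rewrite invr_ge0.
  have q1 : q.+2%:R^-1 <= 1 :> R by rewrite invf_le1// ler1n.
  by rewrite ger0_norm ?subr_ge0// lerBlDr lerDl.
have hq q : `|f (shrink q y) - taylor_sum n (fun k => pderiv k f (shrink q x))
      (rev (enum 'I_d)) [ffun=> 0%N] (shrink q y - shrink q x)| <=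
    taylor_const R n d * (Q * H ^+ n).
  have := @taylor_remainder R d n (fun k => pderiv k f) H Q (shrink q x) (shrink q y)
    (rev (enum 'I_d)) [ffun=> 0%N].
  rewrite multi_size0 subn0 size_rev size_enum_ord pderiv0.
  have -> : hybrid (rev (enum 'I_d)) (shrink q x) (shrink q y) = shrink q y.
    by apply/rowP => r; rewrite mxE mem_rev mem_enum.
  apply => //.
  - move=> i k z t ki kn oz; apply: (is_derive_pderiv cf) => //.
    exact: leq_trans kn ns.
  - by move=> i k z t ki kn oz ozt tH; exact: pderiv_increment.
  - exact: shrink_open.
  - exact: shrink_open.
  - by rewrite rev_uniq enum_uniq.
  - exact: down_closed_rev_enum.
  - by move=> r _; rewrite ffunE.
have lim1 : (f (shrink q y) - taylor_sum n (fun k => pderiv k f (shrink q x))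
      (rev (enum 'I_d)) [ffun=> 0%N] (shrink q y - shrink q x)) @[q --> \oo] -->
   f y - taylor_sum n (fun k => cube_pderiv k f x)
      (rev (enum 'I_d)) [ffun=> 0%N] (y - x).
  apply: cvgB.
    have k0 : (multi_size ([ffun=> 0%N] : mi) <= sfloor a)%N by rewrite multi_size0.
    have [_ h] := cube_pderivP cf k0.
    by have := h y cy; rewrite pderiv0 (cube_pderiv0 cf cy).
  apply: taylor_sum_cvg.
  - by rewrite multi_size0.
  - move=> k kn; have [_ h] := cube_pderivP cf (leq_trans kn ns).
    exact: h.
  - move=> r.
    under eq_fun do rewrite mxE [X in _ + X]mxE.
    by rewrite mxE [X in _ + X]mxE; apply: cvgB; exact: shrink_cvg_coord.
have FF : Filter (\oo : set_system nat) by exact: filter_filter.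
have lim2 := @cvg_norm _ _ _ _ FF _ _ lim1.
apply: (cvgr_to_le lim2).
by apply: nearW => q; exact: hq.
Qed.

(** The functional is exact on the Taylor polynomial of degree min(m, sfloor a), so only the
    remainder over the window counts. If |s| exceeds [sfloor a], that polynomial is annihilated and
    the Boolean factor removes the derivative. *)
Lemma estimator_bias a M f s x (H S : R) (J : finType) (om : J -> R)
    (pt : J -> 'rV[R]_d) :
  0 < a -> 0 < H -> holder_bound a M f -> cube x -> (forall j, cube (pt j)) ->
  (multi_size s <= m)%N ->
  (forall k, (multi_size k <= m)%N ->
    \sum_j multi_pow (pt j - x) k * om j = (k == s)%:R * (multi_fact s)%:R) ->
  (forall j, H < `|x - pt j| -> om j = 0) ->
  \sum_j `|om j| <= S ->
  `|\sum_j om j * f (pt j) - (multi_size s <= sfloor a)%N%:R * cube_pderiv s f x| <=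
    taylor_const R (minn m (sfloor a)) d * M * H `^ (Num.min a m.+1%:R) * S.
Proof.
move=> a0 H0 hf cx cpt sm mom supp omS.
set n := minn m (sfloor a); set th := Num.min a m.+1%:R.
pose D k := cube_pderiv k f x.
pose T v := taylor_sum n D (rev (enum 'I_d)) [ffun=> 0%N] v.
have momT : \sum_j om j * T (pt j - x) = (multi_size s <= sfloor a)%N%:R * D s.
  have := @taylor_sum_functional R d n D (rev (enum 'I_d)) [ffun=> 0%N] s J om
    (fun j => pt j - x).
  rewrite rev_uniq enum_uniq multi_size0 => /(_ isT).
  move=> /(_ (fun r _ => ffunE _ _) isT) h.
  have -> : (multi_size s <= sfloor a)%N = (multi_size s <= n)%N.
    by rewrite leq_min sm.
  transitivity (\sum_j om j * (T (pt j - x) * (multi_pow (pt j - x) [ffun=> 0%N] /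
     (multi_fact ([ffun=> 0%N] : mi))%:R))).
    apply: eq_bigr => j _.
    have -> : multi_fact ([ffun=> 0%N] : mi) = 1%N.
      by rewrite /multi_fact big1// => r _; rewrite ffunE.
    have -> : multi_pow (pt j - x) ([ffun=> 0%N] : mi) = 1.
      by rewrite /multi_pow big1// => r _; rewrite ffunE expr0.
    by rewrite divr1 mulr1.
  rewrite h; last first.
    by move=> k kn; apply: mom; rewrite (leq_trans kn)// geq_minl.
  have -> // : [forall (r | r \notin rev (enum 'I_d)), ([ffun=> 0%N] : mi) r == s r].
  by apply/forall_inP => r; rewrite mem_rev mem_enum.
rewrite -/(D s) -momT -sumrB.
have M0 := holder_bound_ge0 hf.
have c0 : 0 <= taylor_const R n d * M * H `^ th.
  by rewrite !mulr_ge0 ?powR_ge0// taylor_const_ge0.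
apply: (le_trans (ler_norm_sum _ _ _)).
apply: (@le_trans _ _ (\sum_j `|om j| * (taylor_const R n d * M * H `^ th))); last first.
  by rewrite -mulr_suml mulrC ler_wpM2l.
apply: ler_sum => j _; rewrite -mulrBr normrM.
have [Hj|jH] := ltP H `|x - pt j|.
  by rewrite supp// normr0 !mul0r.
rewrite ler_wpM2l//.
have := taylor_cube a0 hf cx (cpt j); rewrite distrC => /(_ _ jH).
move=> /le_trans; apply.
rewrite -!mulrA ler_wpM2l ?taylor_const_ge0// ler_wpM2l//.
rewrite -/n -/th -powR_mulrn ?(ltW H0)// -powRD ?subrK//.
by rewrite (gt_eqF H0) implybT.
Qed.

End cube_taylor.

(** * Smoothing with local weights *)

(** (M1)-(M4) and the design condition at a single bandwidth [h]; [N] is the number of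
    design points. *)
Record local_weights (R : realType) (d : nat) (J : finType) (pt : J -> 'rV[R]_d)
    (om : J -> 'rV[R]_d -> R) (s : {ffun 'I_d -> nat}) (m : nat)
    (N h C1 C2 Cw : R) : Prop := LocalWeights {
  lw_N : 0 < N;
  lw_h : 0 < h < 1;
  lw_C1 : 0 < C1;
  lw_C2 : 0 < C2;
  lw_Cw : 0 < Cw;
  lw_cube : forall j, cube (pt j);
  lw_moments : forall (k : {ffun 'I_d -> nat}) x, (multi_size k <= m)%N -> cube x ->
    \sum_j multi_pow (pt j - x) k * om j x = (k == s)%:R * (multi_fact s)%:R;
  lw_support : forall j x, cube x -> h < `|x - pt j| -> om j x = 0;
  lw_bound : forall j x, cube x -> `|om j x| <= C1 / (N * h ^+ (d + multi_size s));
  lw_lipschitz : forall j x y, cube x -> cube y ->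
    `|om j x - om j y| <= C2 / (N * h ^+ (d + multi_size s)) * (`|x - y| / h);
  lw_count : forall x, cube x ->
    #|[pred j | `|x - pt j| <= h]|%:R <= Cw * h ^+ d * N
}.

Lemma sum_support_le (R : realType) (J : finType) (A : pred J) (F : J -> R) (B c : R) :
  0 <= B -> (forall j, ~~ A j -> F j = 0) -> (forall j, F j <= B) -> #|A|%:R <= c ->
  \sum_j F j <= c * B.
Proof.
move=> B0 F0 FB Ac; rewrite (bigID A) /= [X in _ + X]big1 ?addr0//.
apply: (@le_trans _ _ (\sum_(j | A j) B)); first by apply: ler_sum => j _.
rewrite sumr_const -[_ *+ _]mulr_natl ler_wpM2r//.
Qed.

Definition smoother (R : realType) (d : nat) (J : finType) (pt : J -> 'rV[R]_d)
    (om : J -> 'rV[R]_d -> R) (f : 'rV[R]_d -> R) (x : 'rV[R]_d) : R :=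
  \sum_j om j x * f (pt j).

Section local_weights.
Variables (R : realType) (d : nat) (J : finType) (pt : J -> 'rV[R]_d).
Variables (om : J -> 'rV[R]_d -> R) (s : {ffun 'I_d -> nat}) (m : nat).
Variables (N h C1 C2 Cw : R).
Hypothesis lw : local_weights pt om s m N h C1 C2 Cw.
Implicit Types (x y : 'rV[R]_d) (f : 'rV[R]_d -> R).
Let S := multi_size s.

Let N0 : 0 < N := lw_N lw.
Let C10 : 0 < C1 := lw_C1 lw.
Let C20 : 0 < C2 := lw_C2 lw.
Let Cw0 : 0 < Cw := lw_Cw lw.
Let h0 : 0 < h. Proof. by case/andP: (lw_h lw). Qed.
Let h1 : h < 1. Proof. by case/andP: (lw_h lw). Qed.
Let hX0 n : 0 < h ^+ n. Proof. exact: exprn_gt0. Qed.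
Let scale0 : 0 < N * h ^+ (d + S). Proof. by rewrite mulr_gt0. Qed.

Let hS2 : h ^+ (d + 2 * S) = h ^+ d * (h ^+ S * h ^+ S).
Proof. by rewrite exprD mul2n -addnn exprD. Qed.

Lemma weights_abs_sum x : cube x -> \sum_j `|om j x| <= Cw * C1 / h ^+ S.
Proof.
move=> cx; apply: le_trans (sum_support_le _ _ _ (lw_count lw cx)) _.
- by apply: ltW (divr_gt0 C10 scale0).
- by move=> j /=; rewrite -ltNge => /(lw_support lw cx) ->; rewrite normr0.
- by move=> j; exact: (lw_bound lw).
rewrite exprD le_eqVlt; apply/orP; left; apply/eqP; field.
by rewrite !gt_eqF.
Qed.

(** Up to the error variance over n, this is the variance of the averaged noise: the source of p^1
    h^(d+2|s|) in the rate. *)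
Lemma weights_sqr_sum x : cube x ->
  \sum_j om j x ^+ 2 <= Cw * C1 ^+ 2 / (N * h ^+ (d + 2 * S)).
Proof.
move=> cx; apply: le_trans (sum_support_le (B := (C1 / (N * h ^+ (d + S))) ^+ 2)
  _ _ _ (lw_count lw cx)) _.
- exact: sqr_ge0.
- by move=> j /=; rewrite -ltNge => /(lw_support lw cx) ->; rewrite expr0n.
- move=> j; rewrite -real_normK ?num_real// lerXn2r ?nnegrE//.
    by rewrite (le_trans _ (lw_bound lw j cx)).
  exact: (lw_bound lw).
rewrite hS2 exprD le_eqVlt; apply/orP; left; apply/eqP; field.
by rewrite !gt_eqF.
Qed.

Lemma count2 x y : cube x -> cube y ->
  #|[pred j | (`|x - pt j| <= h) || (`|y - pt j| <= h)]|%:R <= 2 * Cw * h ^+ d * N.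
Proof.
move=> cx cy.
rewrite (@le_trans _ _ ((#|[pred j | `|x - pt j| <= h]| +
  #|[pred j | `|y - pt j| <= h]|)%:R))//.
  by rewrite ler_nat -cardUI (leq_trans _ (leq_addr _ _))//; apply: subset_leq_card.
rewrite natrD (le_trans (lerD (lw_count lw cx) (lw_count lw cy)))//.
by rewrite le_eqVlt; apply/orP; left; apply/eqP; ring.
Qed.

Lemma diff_support x y j : cube x -> cube y ->
  ~~ ((`|x - pt j| <= h) || (`|y - pt j| <= h)) -> om j x - om j y = 0.
Proof.
move=> cx cy; rewrite negb_or -!ltNge => /andP[hx hy].
by rewrite (lw_support lw cx hx) (lw_support lw cy hy) subrr.
Qed.

Lemma weights_diff_abs_sum x y : cube x -> cube y ->
  \sum_j `|om j x - om j y| <= 2 * Cw * C2 / h ^+ S.+1 * `|x - y|.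
Proof.
move=> cx cy; apply: le_trans (sum_support_le
  (B := C2 / (N * h ^+ (d + S)) * (`|x - y| / h)) _ _ _ (count2 cx cy)) _.
- by rewrite mulr_ge0 ?(ltW (divr_gt0 C20 scale0))// divr_ge0// ltW.
- by move=> j /= /(diff_support cx cy) ->; rewrite normr0.
- by move=> j; exact: (lw_lipschitz lw).
rewrite exprD exprS le_eqVlt; apply/orP; left; apply/eqP; field.
by rewrite !gt_eqF.
Qed.

Lemma weights_diff_sqr_sum x y : cube x -> cube y ->
  \sum_j (om j x - om j y) ^+ 2 <=
    2 * Cw * C2 ^+ 2 / (N * h ^+ (d + 2 * S)) * (`|x - y| / h) ^+ 2.
Proof.
move=> cx cy; apply: le_trans (sum_support_le
  (B := (C2 / (N * h ^+ (d + S)) * (`|x - y| / h)) ^+ 2) _ _ _ (count2 cx cy)) _.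
- exact: sqr_ge0.
- by move=> j /= /(diff_support cx cy) ->; rewrite expr0n.
- move=> j; rewrite -real_normK ?num_real// lerXn2r ?nnegrE//.
    by rewrite (le_trans _ (lw_lipschitz lw j cx cy)).
  exact: (lw_lipschitz lw).
rewrite hS2 exprD le_eqVlt; apply/orP; left; apply/eqP; field.
by rewrite !gt_eqF.
Qed.

Lemma smoother_diff_le f (M : R) x y : cube x -> cube y -> 
  (forall z, cube z -> `|f z| <= M) ->
  `|smoother pt om f x - smoother pt om f y| <=
    2 * Cw * C2 * M / h ^+ S.+1 * `|x - y|.
Proof.
move=> cx cy fM; rewrite /smoother -sumrB.
apply: (le_trans (ler_norm_sum _ _ _)).
apply: (@le_trans _ _ (\sum_j `|om j x - om j y| * M)).
  apply: ler_sum => j _; rewrite -mulrBl normrM ler_wpM2l//.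
  by apply: fM; exact: (lw_cube lw).
have M0 : 0 <= M by apply: le_trans (fM x cx).
rewrite -mulr_suml (le_trans (ler_wpM2r M0 (weights_diff_abs_sum cx cy)))//.
by rewrite le_eqVlt; apply/orP; left; apply/eqP; ring.
Qed.

Lemma smoother_bias a f (M : R) x : 0 < a -> holder_bound a M f -> cube x ->
  (S <= m)%N ->
  `|smoother pt om f x - (S <= sfloor a)%N%:R * cube_pderiv s f x| <=
    taylor_const R (minn m (sfloor a)) d * Cw * C1 * M *
      h `^ (Num.min a m.+1%:R - S%:R).
Proof.
move=> a0 hf cx Sm.
have := @estimator_bias R d m a M f s x h _ J (om^~ x) pt a0 h0 hf cx (lw_cube lw) Sm
  (fun k km => lw_moments lw km cx) (fun j => lw_support lw cx (j := j))
  (weights_abs_sum cx).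
move=> /le_trans; apply.
rewrite powRB; last by rewrite (gt_eqF h0) implybT.
rewrite powR_mulrn ?(ltW h0)//.
by rewrite le_eqVlt; apply/orP; left; apply/eqP; field; rewrite gt_eqF.
Qed.

End local_weights.

Lemma holder_bound_sup (R : realType) (d : nat) (a M : R) (f : 'rV[R]_d -> R) x :
  holder_bound a M f -> cube x -> `|f x| <= M.
Proof.
move=> [cf hb _] cx; rewrite -(cube_pderiv0 cf cx); apply: hb => //.
by rewrite multi_size0.
Qed.

Section smoother_size.
Variables (R : realType) (d : nat) (J : finType) (pt : J -> 'rV[R]_d).
Variables (s : {ffun 'I_d -> nat}) (m : nat) (N C1 C2 Cw a : R).
Implicit Types (x y : 'rV[R]_d) (f : 'rV[R]_d -> R).
Let S := multi_size s.
Let Kt := taylor_const R (minn m (sfloor a)) d * Cw * C1.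
Hypotheses (a0 : 0 < a) (Sm : (S <= m)%N).

(** If |s| <= sfloor a, the derivative is bounded by [M] and the exponent is 0. Otherwise a <=
    sfloor a + 1 <= |s|, only the bias remains, and the exponent is a - |s|. *)
Lemma smoother_le om (h M : R) f x :
  local_weights pt om s m N h C1 C2 Cw -> holder_bound a M f -> cube x ->
  `|smoother pt om f x| <= (1 + Kt) * M * h `^ (Num.min a S%:R - S%:R).
Proof.
move=> lw hf cx.
have /andP[h0 h1] := lw_h lw.
have M0 := holder_bound_ge0 hf.
have Kt0 : 0 <= Kt by rewrite !mulr_ge0 ?taylor_const_ge0// ltW ?(lw_Cw lw) ?(lw_C1 lw).
have bias := smoother_bias lw a0 hf cx Sm; rewrite -/S -/Kt in bias.
have [sa sb] := sfloorP a0.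
have -> : smoother pt om f x = (smoother pt om f x - (S <= sfloor a)%N%:R * cube_pderiv s f x) +
   (S <= sfloor a)%N%:R * cube_pderiv s f x by rewrite subrK.
rewrite (le_trans (ler_normD _ _))//.
rewrite [leLHS]addrC.
have -> : (1 + Kt) * M * h `^ (Num.min a S%:R - S%:R) = M * h `^ (Num.min a S%:R - S%:R) +
  Kt * (M * h `^ (Num.min a S%:R - S%:R)) by ring.
apply: lerD.
  have [Sa|aS] := leqP S (sfloor a); last by rewrite mul0r normr0 mulr_ge0// powR_ge0.
  rewrite mul1r min_r; last by rewrite (le_trans _ (ltW sa))// ler_nat.
  rewrite subrr powRr0 mulr1.
  by case: hf => _ hb _; exact: hb.
rewrite (le_trans bias)// [leRHS]mulrA; apply: ler_wpM2l; first by rewrite mulr_ge0.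
rewrite ger_powR ?h0 ?(ltW h1)//.
rewrite lerD2r le_min; apply/andP; split; first by rewrite ge_min lexx.
by rewrite ge_min ler_nat (leq_trans Sm)// orbT.
Qed.

(** Only the supremum of [f] is used. The factor h^(min(a,|s|) - |s|) >= 1 is inserted so that
    values and increments share one scale in the chaining. *)
Lemma smoother_lipschitz om (h M : R) f x y :
  local_weights pt om s m N h C1 C2 Cw -> holder_bound a M f -> cube x -> cube y ->
  `|smoother pt om f x - smoother pt om f y| <=
    2 * Cw * C2 * M * h `^ (Num.min a S%:R - S%:R) * (`|x - y| / h ^+ S.+1).
Proof.
move=> lw hf cx cy.
have /andP[h0 h1] := lw_h lw.
have M0 := holder_bound_ge0 hf.
apply: (le_trans (smoother_diff_le lw cx cy (fun z => @holder_bound_sup _ _ _ _ _ z hf))).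
rewrite -/S [leLHS]mulrAC -[leLHS]mulrA; apply: ler_wpM2r.
  by rewrite divr_ge0// exprn_ge0// ltW.
rewrite ler_peMr//.
  by rewrite !mulr_ge0// ltW ?(lw_Cw lw) ?(lw_C2 lw).
rewrite -(powRr0 h) ger_powR ?h0 ?(ltW h1)//.
by rewrite subr_le0 ge_min lexx orbT.
Qed.

Hypothesis Sa : S%:R < a.
Variables (om : R -> J -> 'rV[R]_d -> R) (hmin h0 : R).
Hypothesis lw : forall h, hmin < h -> h <= h0 -> local_weights pt (om h) s m N h C1 C2 Cw.
Hypothesis hh : hmin < h0.

(** [gam] is the exponent of the bias; [rho] solves rho^q = 1/2, so rho^k is the bandwidth matched
    to the distance 2^-k. *)
Let gam : R := Num.min a m.+1%:R - S%:R.
Let q : R := S.+1%:R + gam.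
Let rho : R := 2^-1 `^ q^-1.

Let gam0 : 0 < gam.
Proof. by rewrite subr_gt0 lt_min Sa ltr_nat ltnS. Qed.

Let q0 : 0 < q. Proof. by rewrite addr_gt0. Qed.

Definition smoother_ratio : R := rho `^ gam.
(** The three summands belong to the three positions of the matched bandwidth tau in
    [smoother_holder]: tau <= h, h < tau <= h0, and tau > h0. *)
Definition smoother_modulus : R :=
  2 * Cw * C2 + 4 * Kt + 2 * (1 + Kt) / h0 `^ gam.

Lemma powR_lt1 (x e : R) : 0 < x < 1 -> 0 < e -> 0 < x `^ e < 1.
Proof.
move=> /andP[x0 x1] e0; rewrite powR_gt0//=.
have -> : 1 = 1 `^ e :> R by rewrite powR1.
by apply: gt0_ltr_powR => //; rewrite nnegrE ?ltW.
Qed.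

Let rho01 : 0 < rho < 1.
Proof. by apply: powR_lt1; rewrite ?invr_gt0// invf_lt1 ?ltr1n// ltr0n. Qed.

Lemma smoother_ratio01 : 0 < smoother_ratio < 1.
Proof. exact: powR_lt1. Qed.

Hypothesis Kt0 : 0 <= Kt.

Lemma smoother_le_low (h M : R) f x : hmin < h -> h <= h0 ->
  holder_bound a M f -> cube x -> `|smoother pt (om h) f x| <= (1 + Kt) * M.
Proof.
move=> hh1 hh2 hf cx; have := smoother_le (lw hh1 hh2) hf cx.
by rewrite min_r ?(ltW Sa)// subrr powRr0 mulr1.
Qed.

(** If tau <= h, the Lipschitz bound at h suffices. If h < tau <= h0, both smoothers approximate the
    same derivative within order tau^gam, so h may be replaced by tau, which is admissible because
    it exceeds h. If tau > h0, the distance is bounded below and the uniform bound on the values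
    suffices. *)
Lemma smoother_holder (h M : R) f x y k : hmin < h -> h <= h0 ->
  holder_bound a M f -> cube x -> cube y -> `|x - y| <= 2^-1 ^+ k ->
  `|smoother pt (om h) f x - smoother pt (om h) f y| <=
    smoother_modulus * M * smoother_ratio ^+ k.
Proof.
move=> hh1 hh2 hf cx cy xyk.
have M0 := holder_bound_ge0 hf.
have lwh := lw hh1 hh2.
have /andP[h_0 h_1] := lw_h lwh.
have /andP[h00 h01] := lw_h (lw hh (lexx _)).
have /andP[rho0 rho1] := rho01.
have K20 : 0 <= 2 * Cw * C2 by rewrite !mulr_ge0// ltW ?(lw_Cw lwh) ?(lw_C2 lwh).
set K2 := 2 * Cw * C2 in K20 *.
have sa : (S <= sfloor a)%N by have [_ ->] := sfloorP a0.
(* The comparison bandwidth: [2^-k = tau^(S+1) tau^gam] balances the Lipschitz bound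
   [2^-k / tau^(S+1)] with the bias [tau^gam]. *)
pose tau := rho ^+ k.
have tau0 : 0 < tau by exact: exprn_gt0.
have ratE : smoother_ratio ^+ k = tau `^ gam.
  rewrite /smoother_ratio /tau -(powR_mulrn k (powR_ge0 _ _)).
  by rewrite -(powR_mulrn k (ltW rho0)) powRAC.
have tauE : 2^-1 ^+ k = tau ^+ S.+1 * tau `^ gam.
  rewrite -[in RHS](powR_mulrn _ (ltW tau0)) -powRD; last first.
    by rewrite (gt_eqF tau0) implybT.
  have rq : rho `^ q = 2^-1.
    by rewrite /rho -powRrM mulVf ?gt_eqF// powRr1// invr_ge0.
  by rewrite -/q /tau -(powR_mulrn k (ltW rho0)) powRAC rq powR_mulrn// invr_ge0.
rewrite ratE; set T := tau `^ gam.
have T0 : 0 <= T by exact: powR_ge0.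
have modE : smoother_modulus * M * T =
    K2 * M * T + 4 * Kt * M * T + 2 * (1 + Kt) * M * (T / h0 `^ gam).
  by rewrite /smoother_modulus -/K2; ring.
have m1 : 0 <= K2 * M * T by exact: (mulr_ge0 (mulr_ge0 K20 M0) T0).
have m2 : 0 <= 4 * Kt * M * T.
  exact: (mulr_ge0 (mulr_ge0 (mulr_ge0 (ler0n _ 4) Kt0) M0) T0).
have m3 : 0 <= 2 * (1 + Kt) * M * (T / h0 `^ gam).
  apply: mulr_ge0; last by rewrite divr_ge0// powR_ge0.
  exact: (mulr_ge0 (mulr_ge0 (ler0n _ 2) (addr_ge0 ler01 Kt0)) M0).
have lip g : tau <= g -> hmin < g -> g <= h0 ->
    `|smoother pt (om g) f x - smoother pt (om g) f y| <= K2 * M * T.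
  move=> tg g1 g2.
  have /andP[g_0 _] := lw_h (lw g1 g2).
  apply: (le_trans (smoother_diff_le (lw g1 g2) cx cy
    (fun z => @holder_bound_sup _ _ _ _ _ z hf))).
  rewrite -/K2 -mulrA; apply: ler_wpM2l; first exact: mulr_ge0.
  rewrite mulrC ler_pdivrMr ?exprn_gt0// (le_trans xyk)// tauE mulrC.
  apply: ler_wpM2l => //; apply: lerXn2r => //; rewrite nnegrE; exact: ltW.
have bias g z : hmin < g -> g <= h0 -> cube z ->
    `|smoother pt (om g) f z - cube_pderiv s f z| <= Kt * M * g `^ gam.
  move=> g1 g2 cz; have := smoother_bias (lw g1 g2) a0 hf cz Sm.
  by rewrite -/S sa mul1r.
have mono u v : 0 <= u -> u <= v -> u `^ gam <= v `^ gam.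
  move=> u0 uv; apply: ge0_ler_powR => //; rewrite ?nnegrE ?(ltW gam0)//.
  exact: le_trans uv.
have [th|ht] := leP tau h.
  by rewrite (le_trans (lip h th hh1 hh2))// modE -addrA lerDl addr_ge0.
have [th0|h0t] := leP tau h0.
  (* Replacing h by tau at both points uses the bias bound four times, hence the [4 * Kt]. *)
  have ht' : hmin < tau by apply: lt_trans ht.
  have b1 := bias h x hh1 hh2 cx; have b2 := bias h y hh1 hh2 cy.
  have b3 := bias tau x ht' th0 cx; have b4 := bias tau y ht' th0 cy.
  have l := lip tau (lexx _) ht' th0.
  have hT : Kt * M * h `^ gam <= Kt * M * T.
    by apply: ler_wpM2l; [exact: mulr_ge0|apply: mono; exact: ltW].
  rewrite modE.
  move: b1 b2 b3 b4 l hT m3; rewrite -/T !ler_norml.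
  move: (smoother pt (om h) f x) (smoother pt (om h) f y) (smoother pt (om tau) f x)
    (smoother pt (om tau) f y) (cube_pderiv s f x) (cube_pderiv s f y) => u1 u2 u3 u4 u5 u6.
  move: (Kt * M * h `^ gam) => v1.
  rewrite -(mulrA 4 Kt) -(mulrA 4 (Kt * M)).
  move: (Kt * M * T) (K2 * M * T) (2 * _ * _ * _) => v2 v3 v4.
  do 5!move=> /andP[? ?]; move=> ? ?; apply/andP; split; lra.
have b1 := smoother_le_low hh1 hh2 hf cx; have b2 := smoother_le_low hh1 hh2 hf cy.
have b3 : 2 * (1 + Kt) * M <= 2 * (1 + Kt) * M * (T / h0 `^ gam).
  rewrite ler_peMr//.
    exact: (mulr_ge0 (mulr_ge0 (ler0n _ 2) (addr_ge0 ler01 Kt0)) M0).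
  by rewrite ler_pdivlMr ?powR_gt0// mul1r mono// ltW.
rewrite modE (le_trans (ler_normB _ _))// (le_trans (lerD b1 b2))//.
by move: b3 m1 m2; rewrite -!(mulrA 2); lra.
Qed.

End smoother_size.

(** * The averaged processes and the averaged noise *)

Lemma centered_sum (R : realType) (dO : measure_display)
    (Omega : measurableType dO) (P : probability Omega R) (J : finType)
    (X : J -> Omega -> R) :
  (forall j, centered P (X j)) -> centered P (fun w => \sum_j X j w).
Proof.
move=> cX; split.
  rewrite /comp; under eq_fun do rewrite -sumEFin.
  by apply: integrable_sum => // j _; case: (cX j).
rewrite unlock; under eq_integral do rewrite -sumEFin.
rewrite integral_sum//; last by move=> j; case: (cX j).
by rewrite big1// => j _; case: (cX j) => _; rewrite unlock.
Qed.

Lemma integrable_of_sqr (R : realType) (dO : measure_display)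
    (Omega : measurableType dO) (P : probability Omega R) (X : Omega -> R) (C : R) :
  measurable_fun setT X -> (\int[P]_w (X w ^+ 2)%:E <= C%:E)%E ->
  P.-integrable setT (EFin \o X).
Proof.
move=> mX XC.
have iX2 : P.-integrable setT (fun w => (X w ^+ 2)%:E).
  apply/integrableP; split; first by apply/measurable_EFinP; exact: measurable_funX.
  rewrite (le_lt_trans _ (ltry C))// (le_trans _ XC)//.
  by under eq_integral do rewrite /= ger0_norm ?sqr_ge0//.
have i1 : P.-integrable setT (EFin \o cst (1 : R)) by exact: finite_measure_integrable_cst.
apply: (le_integrable measurableT _ _ (integrableD measurableT i1 iX2)).
  exact/measurable_EFinP.
move=> w _; rewrite [Y in (_ <= `|Y|)%E](_ : _ = (1 + X w ^+ 2)%:E)//.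
rewrite /comp !abse_EFin lee_fin.
rewrite [leRHS]ger0_norm ?addr_ge0 ?sqr_ge0//.
rewrite -(real_normK (num_real (X w))); move: `|X w| (normr_ge0 (X w)) => a a0.
have := sqr_ge0 (a - 1); rewrite sqrrB1.
by have := sqr_ge0 a; lra.
Qed.

Section process.
Variables (R : realType) (d : nat) (dO : measure_display).
Variables (Omega : measurableType dO) (P : probability Omega R).
Variables (n : nat) (Z : 'I_n -> Omega -> 'rV[R]_d -> R) (b CZ : R).
Variables (M : 'I_n -> Omega -> R) (J : finType) (pt : J -> 'rV[R]_d).
Hypotheses (n0 : (0 < n)%N) (CZ0 : 0 < CZ) (d0 : (0 < d)%N).
Hypothesis mZ : forall i x, cube x -> measurable_fun setT (Z i ^~ x).
Hypothesis cZ : forall i x, cube x -> centered P (Z i ^~ x).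
Hypothesis indZ : mutually_independent P (fun i => sigma_process (Z i)).
Hypothesis mM : forall i, measurable_fun setT (M i).
Hypothesis hM : forall i, {ae P, forall w, holder_bound b (M i w) (Z i w)}.
Hypothesis EM : forall i, (\int[P]_w (M i w ^+ 2)%:E <= CZ%:E)%E.
Hypothesis cpt : forall j, cube (pt j).

Lemma sigma_process_measurable i : sigma_process (Z i) `<=` measurable.
Proof.
apply: smallest_sub; first exact: sigma_algebra_measurable.
move=> A [x cx] [B mB <-]; exact: mZ.
Qed.

(** With total variance a^2 = D^2 CZ / n and L = ln (2 #|T|), the choice l = sqrt(L) / a makes L / l
    + 8 l a^2 equal to 9 a sqrt(L). *)
Lemma bigmax_process_le (T : finType) (c : T -> J -> R) (D : R) :
  (0 < #|T|)%N -> 0 < D ->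
  (forall f m t, holder_bound b m f -> `|\sum_j c t j * f (pt j)| <= D * m) ->
  (\int[P]_w (\big[Num.max/0]_t `|\sum_i n%:R^-1 * \sum_j c t j * Z i w (pt j)|)%:E <=
    (9 * D * Num.sqrt (CZ / n%:R) * Num.sqrt (ln (2 * #|T|)%:R))%:E)%E.
Proof.
move=> T0 D0 hD.
have nR0 : 0 < n%:R :> R by rewrite ltr0n.
pose a := D * Num.sqrt (CZ / n%:R).
have a0 : 0 < a by rewrite mulr_gt0// sqrtr_gt0 divr_gt0.
pose L : R := ln (2 * #|T|)%:R.
(* The factor 2 keeps the logarithm, and with it [l], positive even for a single point. *)
have L0 : 0 < L by rewrite ln_gt0// ltr1n; move: T0; lia.
pose l := Num.sqrt L / a.
have l0 : 0 < l by rewrite divr_gt0// sqrtr_gt0.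
pose u (i : 'I_n) (t : T) (w : Omega) := n%:R^-1 * \sum_j c t j * Z i w (pt j).
pose bb (i : 'I_n) (w : Omega) := n%:R^-1 * D * M i w.
pose v (i : 'I_n) := (n%:R^-1 * D) ^+ 2 * CZ.
have := @bigmax_sum_indep_le R dO Omega P n (fun i => sigma_process (Z i)) T u bb v l
  T0 l0 (fun i => smallest_sigma_algebra _ _) sigma_process_measurable indZ.
have mu i t B : measurable B -> sigma_process (Z i) (u i t @^-1` B).
  move: B; apply/sub_g_sigma_algebraTypeP.
  apply: measurable_funM; first exact: measurable_cst.
  apply: measurable_sum => j; apply: measurable_funM; first exact: measurable_cst.
  apply/sub_g_sigma_algebraTypeP => B mB; apply: sub_sigma_algebra.
  exists (pt j) => //; exists B => //; exact: setTI.
have cu i t : centered P (u i t).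
  apply: centeredZ; apply: centered_sum => j; apply: centeredZ; exact: cZ.
have mbb i : measurable_fun setT (bb i).
  by apply: measurable_funM => //; exact: measurable_cst.
have ub i t : {ae P, forall w, `|u i t w| <= bb i w}.
  apply: filterS (hM i) => w hw; rewrite /u /bb normrM ger0_norm ?invr_ge0//.
  by rewrite -mulrA ler_wpM2l ?invr_ge0//; exact: hD.
have bv i : (\int[P]_w (bb i w ^+ 2)%:E <= (v i)%:E)%E.
  rewrite /bb; under eq_integral do rewrite exprMn EFinM.
  rewrite ge0_integralZl//; last 3 first.
  - by apply/measurable_EFinP; exact: measurable_funX.
  - by move=> w _; rewrite lee_fin sqr_ge0.
  - by rewrite lee_fin sqr_ge0.
  by rewrite /v (EFinM _ CZ); apply: lee_wpmul2l; [rewrite lee_fin sqr_ge0|exact: EM].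
move=> /(_ mu cu mbb ub bv) /le_trans; apply; rewrite lee_fin.
rewrite sumr_const card_ord -[_ *+ n]mulr_natl.
have sq : Num.sqrt (CZ / n%:R) ^+ 2 = CZ / n%:R by rewrite sqr_sqrtr// divr_ge0// ltW.
have vE : n%:R * ((n%:R^-1 * D) ^+ 2 * CZ) = a ^+ 2.
  by rewrite /a [RHS]exprMn sq; field; rewrite gt_eqF.
rewrite vE -/L /l.
have sL : Num.sqrt L ^+ 2 = L by rewrite sqr_sqrtr// ltW.
have sL0 : 0 < Num.sqrt L by rewrite sqrtr_gt0.
rewrite -{1}sL le_eqVlt; apply/orP; left; apply/eqP.
rewrite -(mulrA 9) -/a; clearbody a; field.
by rewrite !gt_eqF.
Qed.

Variable om : J -> 'rV[R]_d -> R.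

Lemma process_chaining (D r : R) (k0 : nat) : 0 < D -> 0 < r < 1 ->
  (forall f m x, holder_bound b m f -> cube x -> `|smoother pt om f x| <= D * m) ->
  (forall f m x y k, holder_bound b m f -> cube x -> cube y ->
    `|x - y| <= 2^-1 ^+ (k0 + k) ->
    `|smoother pt om f x - smoother pt om f y| <= D * m * r ^+ k) ->
  exists V : Omega -> \bar R,
  [/\ forall w, (0 <= V w)%E, measurable_fun setT V,
    {ae P, forall w, forall x, cube x ->
      ((`|\sum_i n%:R^-1 * smoother pt om (Z i w) x|)%:E <= V w)%E} &
    (\int[P]_w V w <= ((Num.sqrt (2 * d%:R) * (1 - r)^-1 ^+ 2 + 1) *
       (9 * D * Num.sqrt (CZ / n%:R)) * Num.sqrt k0.+1%:R)%:E)%E ].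
Proof.
move=> D0 r01 hb hi.
have nR0 : 0 < n%:R :> R by rewrite ltr0n.
have /andP[r0 r1] := r01.
have A0 : 0 < 9 * D * Num.sqrt (CZ / n%:R).
  by rewrite !mulr_gt0// sqrtr_gt0 divr_gt0.
pose W (w : Omega) := \sum_i n%:R^-1 * (D * `|M i w|).
have iM i : P.-integrable setT (EFin \o M i) by exact: integrable_of_sqr (EM i).
apply: (@chaining R d dO Omega P (fun w x => \sum_i n%:R^-1 * smoother pt om (Z i w) x)
  k0 (9 * D * Num.sqrt (CZ / n%:R)) r W d0 A0 r01).
- move=> x cx; apply: measurable_sum => i; apply: measurable_funM; first exact: measurable_cst.
  apply: measurable_sum => j; apply: measurable_funM; first exact: measurable_cst.
  exact: mZ.
- move=> T x T0 cx; apply: (@bigmax_process_le T (fun t j => om j (x t))) => //.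
  by move=> f m t hf; exact: hb.
- move=> k T x y T0 cx cy xy.
  have -> : 9 * D * Num.sqrt (CZ / n%:R) * r ^+ k = 9 * (D * r ^+ k) * Num.sqrt (CZ / n%:R).
    by ring.
  have hmax := @bigmax_process_le T (fun t j => om j (x t) - om j (y t)) (D * r ^+ k) T0.
  have E w t : \sum_i n%:R^-1 * smoother pt om (Z i w) (x t) -
      \sum_i n%:R^-1 * smoother pt om (Z i w) (y t) =
      \sum_i n%:R^-1 * \sum_j (om j (x t) - om j (y t)) * Z i w (pt j).
    rewrite -sumrB; apply: eq_bigr => i _; rewrite -mulrBr -sumrB; congr (_ * _).
    by apply: eq_bigr => j _; rewrite mulrBl.
  under eq_integral do under eq_bigr do rewrite E.
  apply: hmax; first by rewrite mulr_gt0// exprn_gt0.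
  move=> f m t hf; rewrite mulrAC; apply: le_trans (hi f m _ _ k hf (cx t) (cy t) (xy t)).
  rewrite /smoother -sumrB le_eqVlt; apply/orP; left; apply/eqP; congr (`|_|).
  by apply: eq_bigr => j _; rewrite mulrBl.
- move=> w; apply: sumr_ge0 => i _; rewrite mulr_ge0 ?invr_ge0// mulr_ge0//.
  exact: ltW.
- rewrite /W /comp; under eq_fun do rewrite -sumEFin.
  apply: integrable_sum => // i _; under eq_fun do rewrite 2!EFinM.
  do 2!apply: integrableZl => //.
  exact: (integrable_abse (iM i)).
- have : {ae P, forall w, forall i, holder_bound b (M i w) (Z i w)}.
    by apply: filter_forall.
  apply: filterS => w hw k x y cx cy xy.
  rewrite -sumrB (le_trans (ler_norm_sum _ _ _))// /W mulr_suml.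
  apply: ler_sum => i _; rewrite -mulrBr normrM ger0_norm ?invr_ge0//.
  rewrite -mulrA ler_wpM2l ?invr_ge0//.
  rewrite (le_trans (hi _ _ _ _ k (hw i) cx cy xy))//.
  by rewrite ger0_norm// (holder_bound_ge0 (hw i)).
Qed.

End process.

Section noise.
Variables (R : realType) (d : nat) (dO : measure_display).
Variables (Omega : measurableType dO) (P : probability Omega R).
Variables (n : nat) (J : finType) (eps : 'I_n -> J -> Omega -> R) (zeta sigma : R).
Hypotheses (n0 : (0 < n)%N) (d0 : (0 < d)%N).
Hypothesis meps : forall i j, measurable_fun setT (eps i j).
Hypothesis ceps : forall i j, centered P (eps i j).
Hypothesis veps : forall i j, fine (variance0 P (eps i j)) <= sigma ^+ 2.
Hypothesis seps : forall i j,
  sub_gaussian P (zeta ^+ 2 * fine (variance0 P (eps i j))) (eps i j).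
Hypothesis indeps : mutually_independent P
  (fun ij : 'I_n * J => sigma_variable (eps ij.1 ij.2)).

Lemma sigma_variable_algebra (X : Omega -> R) : sigma_algebra setT (sigma_variable X).
Proof. by apply: sigma_algebra_preimage; exact: sigma_algebra_measurable. Qed.

(** Variance proxies of independent summands add; averaging n errors at each design point leaves
    zeta^2 sigma^2 / n times the sum of the squared coefficients. *)
Lemma noise_expR_le (c : J -> R) (A l : R) :
  zeta ^+ 2 * sigma ^+ 2 / n%:R * (\sum_j c j ^+ 2) <= A ^+ 2 ->
  (\int[P]_w (expR (l * \sum_j c j * (n%:R^-1 * \sum_i eps i j w)))%:E <=
    (expR (l ^+ 2 * A ^+ 2 / 2))%:E)%E.
Proof.
move=> cA.
have nR0 : 0 < n%:R :> R by rewrite ltr0n.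
pose X (ij : 'I_n * J) (w : Omega) := l * c ij.2 * n%:R^-1 * eps ij.1 ij.2 w.
pose v (ij : 'I_n * J) := zeta ^+ 2 * fine (variance0 P (eps ij.1 ij.2)) *
  (l * c ij.2 * n%:R^-1) ^+ 2 / 2.
have XE w : l * (\sum_j c j * (n%:R^-1 * \sum_i eps i j w)) = \sum_ij X ij w.
  rewrite -(pair_bigA _ (fun i j => X (i, j) w)) /= exchange_big /= mulr_sumr.
  apply: eq_bigr => j _; rewrite mulrA mulr_sumr mulr_sumr.
  by apply: eq_bigr => i _; rewrite /X /=; ring.
under eq_integral do rewrite XE.
apply: (le_trans (@integral_expR_sum_le R dO Omega P _
  (fun ij => sigma_variable (eps ij.1 ij.2)) X v _ _ indeps _ _)).
- by move=> ij; exact: sigma_variable_algebra.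
- by move=> ij A' [B mB <-]; exact: meps.
- move=> ij B mB; exists ((fun y => l * c ij.2 * n%:R^-1 * y) @^-1` B).
    rewrite -[X in measurable X]setTI.
    by apply: (measurable_funM (measurable_cst _) (@measurable_id _ _ _)).
  by rewrite setTI.
- by move=> ij; have := seps ij.1 ij.2 (l * c ij.2 * n%:R^-1); rewrite unlock.
rewrite lee_fin ler_expR.
apply: (@le_trans _ _ (\sum_(ij : 'I_n * J) zeta ^+ 2 * sigma ^+ 2 *
    (l * c ij.2 * n%:R^-1) ^+ 2 / 2)).
  apply: ler_sum => ij _; rewrite ler_pM2r ?invr_gt0//.
  by rewrite ler_wpM2r ?sqr_ge0// ler_wpM2l ?sqr_ge0.
rewrite -(pair_bigA _ (fun (i : 'I_n) j => zeta ^+ 2 * sigma ^+ 2 *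
    (l * c j * n%:R^-1) ^+ 2 / 2)) /= sumr_const card_ord -[_ *+ n]mulr_natl.
have -> : \sum_j zeta ^+ 2 * sigma ^+ 2 * (l * c j / n%:R) ^+ 2 / 2 =
    zeta ^+ 2 * sigma ^+ 2 * l ^+ 2 / n%:R ^+ 2 / 2 * \sum_j c j ^+ 2.
  rewrite mulr_sumr; apply: eq_bigr => j _; field.
  by rewrite gt_eqF.
apply: (@le_trans _ _ (l ^+ 2 / 2 *
   (zeta ^+ 2 * sigma ^+ 2 / n%:R * (\sum_j c j ^+ 2)))).
  rewrite le_eqVlt; apply/orP; left; apply/eqP; field.
  by rewrite gt_eqF.
rewrite [leRHS](_ : _ = l ^+ 2 / 2 * A ^+ 2); last by field.
by apply: ler_wpM2l cA; rewrite divr_ge0// sqr_ge0.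
Qed.

(** The choice l = sqrt(L) / A gives L / l + l A^2 / 2 = (3/2) A sqrt(L), rounded up to the constant
    2. *)
Lemma bigmax_noise_le (T : finType) (c : T -> J -> R) (A : R) :
  (0 < #|T|)%N -> 0 < A ->
  (forall t, zeta ^+ 2 * sigma ^+ 2 / n%:R * (\sum_j c t j ^+ 2) <= A ^+ 2) ->
  (\int[P]_w (\big[Num.max/0]_t `|\sum_j c t j * (n%:R^-1 * \sum_i eps i j w)|)%:E <=
    (2 * A * Num.sqrt (ln (2 * #|T|)%:R))%:E)%E.
Proof.
move=> T0 A0 cA.
pose L : R := ln (2 * #|T|)%:R.
have L0 : 0 < L by rewrite ln_gt0// ltr1n; move: T0; lia.
pose l := Num.sqrt L / A.
have sL0 : 0 < Num.sqrt L by rewrite sqrtr_gt0.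
have l0 : 0 < l by rewrite divr_gt0.
apply: (le_trans (@bigmax_subgaussian_le R dO Omega P T
  (fun t w => \sum_j c t j * (n%:R^-1 * \sum_i eps i j w)) l (A ^+ 2) T0 l0 _ _ _)).
- move=> t; apply: measurable_sum => j; apply: measurable_funM; first exact: measurable_cst.
  apply: measurable_funM; first exact: measurable_cst.
  exact: measurable_sum.
- by move=> t; exact: noise_expR_le.
- by move=> t; rewrite -sqrrN; exact: noise_expR_le.
rewrite lee_fin -/L /l.
have sL : Num.sqrt L ^+ 2 = L by rewrite sqr_sqrtr// ltW.
rewrite -{1}sL.
rewrite [leLHS](_ : _ = 3 / 2 * (A * Num.sqrt L)); last by field; rewrite !gt_eqF.
rewrite -[leRHS]mulrA; apply: ler_wpM2r; last by lra.
by rewrite mulr_ge0// ltW.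
Qed.

Variables (om : J -> 'rV[R]_d -> R).

(** [A] is a standard deviation and fixes the final bound. [B] controls increments path by path and
    enters only the tail variable, so it may be a negative power of h. *)
Lemma noise_chaining (A B r : R) (k0 : nat) : 0 < A -> 0 <= B -> 0 < r < 1 ->
  (forall x, cube x -> zeta ^+ 2 * sigma ^+ 2 / n%:R * (\sum_j om j x ^+ 2) <= A ^+ 2) ->
  (forall x y k, cube x -> cube y -> `|x - y| <= 2^-1 ^+ (k0 + k) ->
    zeta ^+ 2 * sigma ^+ 2 / n%:R * (\sum_j (om j x - om j y) ^+ 2) <= (A * r ^+ k) ^+ 2) ->
  (forall x y k, cube x -> cube y -> `|x - y| <= 2^-1 ^+ (k0 + k) ->
    \sum_j `|om j x - om j y| <= B * r ^+ k) ->
  exists V : Omega -> \bar R,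
  [/\ forall w, (0 <= V w)%E, measurable_fun setT V,
    {ae P, forall w, forall x, cube x ->
      ((`|\sum_j om j x * (n%:R^-1 * \sum_i eps i j w)|)%:E <= V w)%E} &
    (\int[P]_w V w <= ((Num.sqrt (2 * d%:R) * (1 - r)^-1 ^+ 2 + 1) *
       (2 * A) * Num.sqrt k0.+1%:R)%:E)%E ].
Proof.
move=> A0 B0 r01 ha hb hB.
have nR0 : 0 < n%:R :> R by rewrite ltr0n.
have /andP[r0 r1] := r01.
have A20 : 0 < 2 * A by rewrite mulr_gt0.
pose ebar j (w : Omega) := n%:R^-1 * \sum_i eps i j w.
pose W (w : Omega) := B * \sum_j `|ebar j w|.
have iebar j : P.-integrable setT (fun w => (ebar j w)%:E).
  by case: (centeredZ n%:R^-1 (centered_sum (fun i => ceps i j))).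
have diffE w x y : \sum_j om j x * ebar j w - \sum_j om j y * ebar j w =
    \sum_j (om j x - om j y) * ebar j w.
  by rewrite -sumrB; apply: eq_bigr => j _; rewrite mulrBl.
apply: (@chaining R d dO Omega P (fun w x => \sum_j om j x * ebar j w)
  k0 (2 * A) r W d0 A20 r01).
- move=> x cx; apply: measurable_sum => j; apply: measurable_funM; first exact: measurable_cst.
  apply: measurable_funM; first exact: measurable_cst.
  exact: measurable_sum.
- move=> T x T0 cx; apply: (@bigmax_noise_le T (fun t j => om j (x t))) => //.
  by move=> t; exact: ha.
- move=> k T x y T0 cx cy xy.
  have := @bigmax_noise_le T (fun t j => om j (x t) - om j (y t)) (A * r ^+ k) T0.
  rewrite mulrA => hmax.
  under eq_integral do under eq_bigr do rewrite diffE.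
  apply: hmax; first by rewrite mulr_gt0// exprn_gt0.
  by move=> t; exact: hb.
- by move=> w; rewrite mulr_ge0// sumr_ge0.
- rewrite /W /comp; under eq_fun do rewrite EFinM -sumEFin.
  apply: integrableZl => //; apply: integrable_sum => // j _.
  exact: (integrable_abse (iebar j)).
- apply: aeW => w k x y cx cy xy; rewrite diffE.
  apply: (le_trans (ler_norm_sum _ _ _)).
  apply: (@le_trans _ _ (\sum_j `|om j x - om j y| * \sum_j `|ebar j w|)).
    apply: ler_sum => j _; rewrite normrM ler_wpM2l//.
    by rewrite (bigD1 j)//= lerDl sumr_ge0.
  rewrite -mulr_suml /W mulrAC ler_wpM2r ?sumr_ge0//.
  exact: hB.
Qed.

End noise.

(** * From the model and the design to a fixed bandwidth *)

(** Indices outside the image of [f] receive the sure event. Along [inl] and [inr] this extracts the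
    independence of the processes and that of the errors from the joint family. *)
Lemma mutually_independent_comp (R : realType) (dO : measure_display)
    (Omega : measurableType dO) (P : probability Omega R) (I K : finType)
    (F : K -> set_system Omega) (f : I -> K) : injective f ->
  mutually_independent P F -> mutually_independent P (F \o f).
Proof.
move=> fI ind J E FE.
pose E' k := if [pick i | f i == k] is Some i then E i else setT.
have E'f i : E' (f i) = E i.
  rewrite /E'; case: pickP => [j /eqP /fI ->//|/(_ i)].
  by rewrite eqxx.
have := ind (f @: J) E'.
rewrite big_imset /=; last by move=> x y _ _ /fI.
under eq_bigr do rewrite E'f.
move=> <-; last by move=> _ /imsetP[i iJ ->]; rewrite E'f; exact: FE.
congr (P _); rewrite eqEsubset; split=> w Ew k /=.
  by move=> /imsetP[i iJ ->]; rewrite E'f; exact: Ew.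
by move=> kJ; rewrite -E'f; apply: Ew; apply/imsetP; exists k.
Qed.

Lemma pmin_le (d : nat) (p : 'I_d -> nat) r : (pmin p <= p r)%N.
Proof.
rewrite /pmin; move: (\max_(r < d) p r)%N => D; have : r \in index_enum 'I_d by rewrite mem_index_enum.
elim: (index_enum 'I_d) => // i l ih; rewrite inE big_cons => /predU1P[->|/ih h].
  exact: geq_minl.
exact: leq_trans (geq_minr _ _) h.
Qed.

Lemma grid_card_gt0 (d : nat) (p : 'I_d -> nat) : (0 < pmin p)%N -> (0 < grid_card p)%N.
Proof.
move=> p0; rewrite /grid_card; elim/big_ind: _ => // [x y x0 y0|r _].
  by rewrite muln_gt0 x0.
exact: leq_trans (pmin_le p r).
Qed.

Lemma design_point_cube (R : realType) (d : nat) (p : 'I_d -> nat)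
    (xi : forall r : 'I_d, 'I_(p r) -> R) (j : grid p) :
  product_design xi -> cube (design_point xi j).
Proof. by move=> [h _] r; rewrite mxE. Qed.

(** The design condition needs half-widths of at least 1/pmin, whereas h only exceeds c/pmin.
    Enlarging the window by max(1, 1/c) bridges the gap at the cost of the d-th power of that
    factor. *)
Lemma local_weights_design (R : realType) (d n : nat) (s : {ffun 'I_d -> nat}) (m : nat)
    (p : nat -> 'I_d -> nat) (xi : forall n (r : 'I_d), 'I_(p n r) -> R)
    (w : forall n, grid (p n) -> 'rV[R]_d -> R -> R) (c h0 C1 C2 Cd h : R) :
  product_design (xi n) -> 0 < c -> 0 < h0 < 1 -> 0 < C1 -> 0 < C2 -> 0 < Cd ->
  (0 < pmin (p n))%N -> c / (pmin (p n))%:R < h -> h <= h0 ->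
  (forall (x : 'rV[R]_d) (h : R),
      cube x -> 0 < h -> (pmin (p n))%:R^-1 <= h ->
      #|[set j : grid (p n) | [forall r,
          x ord0 r - h <= design_point (xi n) j ord0 r <= x ord0 r + h]]|%:R
        <= Cd * h ^+ d * (grid_card (p n))%:R) ->
  (let scale := (grid_card (p n))%:R * h ^+ (d + multi_size s) in
      [/\ forall (r : {ffun 'I_d -> nat}) (x : 'rV[R]_d),
            (multi_size r <= m)%N -> cube x ->
            \sum_(j : grid (p n))
               multi_pow (design_point (xi n) j - x) r * w n j x h =
            (r == s)%:R * (multi_fact s)%:R,
          forall (j : grid (p n)) (x : 'rV[R]_d), cube x ->
            h < `|x - design_point (xi n) j| -> w n j x h = 0,
          forall (j : grid (p n)) (x : 'rV[R]_d), cube x ->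
            `|w n j x h| <= C1 / scale
        & forall (j : grid (p n)) (x y : 'rV[R]_d), cube x -> cube y ->
            `|w n j x h - w n j y h| <=
              C2 / scale * Num.min (`|x - y| / h) 1 ]) ->
  local_weights (design_point (xi n)) (fun j x => w n j x h) s m
    (grid_card (p n))%:R h C1 C2 (Cd * Num.max 1 c^-1 ^+ d).
Proof.
move=> hxi c0 /andP[h00 h01] C10 C20 Cd0 pm0 hlt hle reg [M1 M2 M3 M4].
have q0 : 0 < (pmin (p n))%:R :> R by rewrite ltr0n.
have h_0 : 0 < h by apply: lt_trans hlt; rewrite divr_gt0.
have N0 : 0 < (grid_card (p n))%:R :> R by rewrite ltr0n grid_card_gt0.
have e0 : 0 < Num.max 1 c^-1 by rewrite lt_max ltr01.
split => //.
- by rewrite h_0 (le_lt_trans hle).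
- by rewrite mulr_gt0// exprn_gt0.
- by move=> j; exact: design_point_cube.
- move=> j x y cx cy; apply: (le_trans (M4 j x y cx cy)).
  rewrite ler_wpM2l ?ge_min ?lexx// divr_ge0 ?(ltW C20)//.
  by rewrite mulr_ge0 ?exprn_ge0// ltW.
move=> x cx.
set e := Num.max 1 c^-1 in e0 *.
have eh0 : 0 < e * h by rewrite mulr_gt0.
have heh : h <= e * h by rewrite ler_peMl ?(ltW h_0)// le_max lexx.
have peh : (pmin (p n))%:R^-1 <= e * h.
  rewrite (@le_trans _ _ (c^-1 * h))//; last first.
    by rewrite ler_wpM2r ?(ltW h_0)// le_max lexx orbT.
  by rewrite mulrC ler_pdivlMr// mulrC ltW.
have := reg x _ cx eh0 peh; rewrite exprMn mulrA; apply: le_trans.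
rewrite ler_nat; apply: subset_leq_card; apply/fintype.subsetP => j.
rewrite inE /= => xj; rewrite inE /=; apply/forallP => r.
have := le_trans (rV_coord_le_norm _ r) (le_trans xj heh).
rewrite !mxE ler_norml => /andP[a1 a2].
by move: a1 a2; move: (x ord0 r) (xi n r (j r)) => a b a1 a2; apply/andP; split; lra.
Qed.

(** The constant 2 comes from [1 / ln 2 <= 2]. *)
Lemma dyadic_level (R : realType) (eta : R) : 0 < eta <= 1 ->
  exists k0 : nat, 2^-1 ^+ k0 <= eta /\ k0.+1%:R <= 2 + 2 * ln eta^-1.
Proof.
move=> /andP[e0 e1].
have i0 : 1 <= eta^-1 by rewrite invf_ge1.
have l0 : 0 <= ln eta^-1 by rewrite ln_ge0.
have y0 : 0 <= 2 * ln eta^-1 by rewrite mulr_ge0.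
have /andP[t1 t2] := truncn_itv y0.
exists (Num.truncn (2 * ln eta^-1)).+1; split; last first.
  by move: t1; rewrite -2!natr1; lra.
set k := (Num.truncn _).+1 in t2 *.
have ln2 : 2^-1 <= ln 2 :> R.
  rewrite -ler_expR lnK ?posrE//.
  have := expR_ge1Dx (- 2^-1 : R); rewrite expRN => h.
  rewrite -[leRHS]invrK -[leLHS]invrK lef_pV2 ?posrE ?invr_gt0 ?expR_gt0//.
  by move: h; lra.
rewrite exprVn -[leRHS]invrK lef_pV2 ?posrE ?exprn_gt0 ?invr_gt0//.
rewrite -ler_ln ?posrE ?exprn_gt0 ?invr_gt0// lnXn// -[_ *+ k]mulr_natl.
move: t2; move: (k%:R : R) (ler0n R k) => kk kk0 t2.
by nra.
Qed.

(** * Rates of the noise term and of the process term *)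

Definition chaining_const (R : realType) (d : nat) (r : R) : R :=
  Num.sqrt (2 * d%:R) * (1 - r)^-1 ^+ 2 + 1.

Lemma chaining_const_gt0 (R : realType) (d : nat) (r : R) : 0 < chaining_const d r.
Proof. by rewrite ltr_wpDl// mulr_ge0 ?sqrtr_ge0// sqr_ge0. Qed.

(** The first square root covers the variances of values and of increments together; the second
    turns k0 + 1 <= 2 + 2 ln(1/h) into a multiple of ln(1/h), using ln(1/h) >= ln(1/h0) > 0. *)
Definition noise_const (R : realType) (d : nat) (C1 C2 Cw h0 : R) : R :=
  chaining_const d (2^-1 : R) * (2 * Num.sqrt (Cw * C1 ^+ 2 + 2 * Cw * C2 ^+ 2)) *
    Num.sqrt (2 / ln h0^-1 + 2).

(** The weights change by their own size over a distance h, so the chain starts at 2^-k0 <= h and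
    the increments halve at each further level. The depth k0 is of order ln(1/h), which cancels the
    division by that logarithm in [A]. *)
Lemma noise_rate (R : realType) (d : nat) (dO : measure_display)
    (Omega : measurableType dO) (P : probability Omega R) (n : nat) (J : finType)
    (eps : 'I_n -> J -> Omega -> R) (zeta sigma : R)
    (pt : J -> 'rV[R]_d) (om : J -> 'rV[R]_d -> R) (s : {ffun 'I_d -> nat}) (m : nat)
    (N h h0 C1 C2 Cw a : R) :
  (0 < n)%N -> (0 < d)%N ->
  (forall i j, measurable_fun setT (eps i j)) ->
  (forall i j, centered P (eps i j)) ->
  (forall i j, fine (variance0 P (eps i j)) <= sigma ^+ 2) ->
  (forall i j, sub_gaussian P (zeta ^+ 2 * fine (variance0 P (eps i j))) (eps i j)) ->
  mutually_independent P (fun ij : 'I_n * J => sigma_variable (eps ij.1 ij.2)) ->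
  local_weights pt om s m N h C1 C2 Cw -> h <= h0 -> h0 < 1 ->
  0 <= zeta -> 0 <= sigma -> 0 < a ->
  zeta * sigma * Num.sqrt (ln h^-1 / (n%:R * N * h ^+ (d + 2 * multi_size s))) <= a ->
  exists V : Omega -> \bar R,
  [/\ forall w, (0 <= V w)%E, measurable_fun setT V,
    {ae P, forall w, forall x, cube x ->
      ((`|\sum_j om j x * (n%:R^-1 * \sum_i eps i j w)|)%:E <= V w)%E} &
    (\int[P]_w V w <= (noise_const d C1 C2 Cw h0 * a)%:E)%E ].
Proof.
move=> n0 d0 meps ceps veps seps ieps lw hh0 h01 z0 s0 a0 ha.
have nR0 : 0 < n%:R :> R by rewrite ltr0n.
have /andP[h_0 h_1] := lw_h lw.
have N0 := lw_N lw; have Cw0 := lw_Cw lw; have C10 := lw_C1 lw; have C20 := lw_C2 lw.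
have h00 : 0 < h0 by apply: lt_le_trans hh0.
set l := ln h^-1 in ha.
pose l0 := ln h0^-1.
have l00 : 0 < l0 by rewrite ln_gt0// invf_gt1.
have l0l : l0 <= l by rewrite ler_ln ?posrE ?invr_gt0// lef_pV2.
have lp : 0 < l by apply: lt_le_trans l0l.
pose Ca2 := Cw * C1 ^+ 2 + 2 * Cw * C2 ^+ 2.
have p1 : 0 <= Cw * C1 ^+ 2 by rewrite mulr_ge0 ?sqr_ge0// ltW.
have p2 : 0 <= 2 * Cw * C2 ^+ 2 by rewrite mulr_ge0 ?sqr_ge0// mulr_ge0// ltW.
have Ca20 : 0 < Ca2.
  by rewrite ltr_pwDl// mulr_gt0// exprn_gt0.
(* Taking [a] instead of the noise term of the rate keeps [A] positive when [sigma = 0]. *)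
pose A := Num.sqrt Ca2 * (a / Num.sqrt l).
have A0 : 0 < A by rewrite mulr_gt0 ?sqrtr_gt0// divr_gt0// sqrtr_gt0.
have A2 : A ^+ 2 = Ca2 * (a ^+ 2 / l).
  by rewrite /A !exprMn exprVn !sqr_sqrtr// ltW.
set D := h ^+ (d + 2 * multi_size s) in ha *.
have D0 : 0 < D by rewrite exprn_gt0.
pose tau2 := zeta ^+ 2 * sigma ^+ 2 / n%:R / (N * D).
have tau20 : 0 <= tau2.
  by rewrite !divr_ge0 ?mulr_ge0 ?sqr_ge0// ltW.
have tauA : tau2 <= a ^+ 2 / l.
  rewrite ler_pdivlMr//.
  have -> : tau2 * l = (zeta * sigma * Num.sqrt (l / (n%:R * N * D))) ^+ 2.
    rewrite !exprMn sqr_sqrtr; last by rewrite divr_ge0 ?mulr_ge0// ltW.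
    by rewrite /tau2; field; rewrite !gt_eqF.
  by apply: lerXn2r => //; rewrite nnegrE ?(ltW a0)// !mulr_ge0// sqrtr_ge0.
have [k0 [k0h k0l]] := @dyadic_level R h ltac:(by rewrite h_0 ltW).
rewrite -/l in k0l.
pose B := 2 * Cw * C2 / h ^+ (multi_size s).+1.
have B0 : 0 <= B by rewrite divr_ge0 ?exprn_ge0 ?(ltW h_0)// !mulr_ge0// ltW.
have half01 : 0 < (2^-1 : R) < 1 by rewrite invr_gt0 ltr0n invf_lt1// ltr1n.
have dist k (x y : 'rV[R]_d) : `|x - y| <= (2^-1 : R) ^+ (k0 + k) -> `|x - y| <= h * 2^-1 ^+ k.
  move=> xy; apply: (le_trans xy); rewrite exprD.
  by apply: ler_wpM2r k0h; rewrite exprn_ge0.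
have [|||V [V0 mV XV EV]] := @noise_chaining R d dO Omega P n J eps zeta sigma n0 d0 meps ceps
  veps seps ieps om A B 2^-1 k0 A0 B0 half01.
- move=> x cx; rewrite A2.
  apply: (@le_trans _ _ (tau2 * (Cw * C1 ^+ 2))).
    rewrite /tau2 [leRHS](_ : _ = zeta ^+ 2 * sigma ^+ 2 / n%:R * (Cw * C1 ^+ 2 / (N * D))).
      apply: ler_wpM2l (weights_sqr_sum lw cx).
      by rewrite divr_ge0 ?mulr_ge0 ?sqr_ge0// ltW.
    by field; rewrite !gt_eqF.
  rewrite mulrC; apply: ler_pM => //.
  by rewrite /Ca2 lerDl.
- move=> x y k cx cy xy; rewrite exprMn A2.
  apply: (@le_trans _ _ (tau2 * (2 * Cw * C2 ^+ 2 * (`|x - y| / h) ^+ 2))).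
    rewrite /tau2 [leRHS](_ : _ = zeta ^+ 2 * sigma ^+ 2 / n%:R *
        (2 * Cw * C2 ^+ 2 / (N * D) * (`|x - y| / h) ^+ 2)).
      apply: ler_wpM2l (weights_diff_sqr_sum lw cx cy).
      by rewrite divr_ge0 ?mulr_ge0 ?sqr_ge0// ltW.
    by field; rewrite !gt_eqF.
  rewrite mulrA; apply: ler_pM.
  + exact: mulr_ge0.
  + exact: sqr_ge0.
  + by rewrite mulrC; apply: ler_pM => //; rewrite /Ca2 lerDr.
  apply: lerXn2r; rewrite ?nnegrE ?exprn_ge0 ?divr_ge0 ?(ltW h_0)//.
  by rewrite ler_pdivrMr// mulrC; exact: dist.
- move=> x y k cx cy xy.
  rewrite (le_trans (weights_diff_abs_sum lw cx cy))// -/B ler_wpM2l//.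
  rewrite (le_trans (dist k x y xy))// ler_piMl ?exprn_ge0//.
  exact: ltW.
exists V; split => //; apply: (le_trans EV); rewrite lee_fin.
rewrite /noise_const -/(chaining_const d _) -/Ca2 -/l0 -!mulrA.
apply: ler_wpM2l; first exact: ltW (chaining_const_gt0 _ _).
apply: ler_wpM2l => //; apply: ler_wpM2l; first exact: sqrtr_ge0.
rewrite [leRHS]mulrC; apply: ler_wpM2l; first exact: ltW.
rewrite mulrC ler_pdivrMr ?sqrtr_gt0// -sqrtrM; last first.
  by rewrite addr_ge0// divr_ge0// ltW.
apply: ler_wsqrtr; apply: (le_trans k0l).
by rewrite [leRHS]mulrDl lerD2r mulrAC ler_pdivlMr// ler_wpM2l.
Qed.

Section process_rate.
Variables (R : realType) (d : nat) (dO : measure_display).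
Variables (Omega : measurableType dO) (P : probability Omega R).
Variables (n : nat) (Z : 'I_n -> Omega -> 'rV[R]_d -> R) (b b1 CZ : R).
Variables (M : 'I_n -> Omega -> R) (J : finType) (pt : J -> 'rV[R]_d).
Variables (om : R -> J -> 'rV[R]_d -> R) (s : {ffun 'I_d -> nat}) (m : nat).
Variables (N C1 C2 Cw h hmin h0 : R).
Hypotheses (n0 : (0 < n)%N) (CZ0 : 0 < CZ) (d0 : (0 < d)%N) (b0 : 0 < b1 < b).
Hypothesis mZ : forall i x, cube x -> measurable_fun setT (Z i ^~ x).
Hypothesis cZ : forall i x, cube x -> centered P (Z i ^~ x).
Hypothesis indZ : mutually_independent P (fun i => sigma_process (Z i)).
Hypothesis mM : forall i, measurable_fun setT (M i).
Hypothesis hM : forall i, {ae P, forall w, holder_bound b (M i w) (Z i w)}.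
Hypothesis EM : forall i, (\int[P]_w (M i w ^+ 2)%:E <= CZ%:E)%E.
Hypothesis lw : forall h, hmin < h -> h <= h0 ->
  local_weights pt (om h) s m N h C1 C2 Cw.
Hypotheses (hlt : hmin < h) (hle : h <= h0).
Let S := multi_size s.
Hypothesis Sm : (S <= m)%N.

Let size_const : R := 1 + taylor_const R (minn m (sfloor b)) d * Cw * C1.

(** Division by sqrt(CZ), here and in [high_const], turns the sqrt(CZ / n) of the maximal inequality
    into the CZ / sqrt(n) of the rate. *)
Definition low_const : R :=
  chaining_const d (smoother_ratio s m b) *
  (9 * Num.max size_const (smoother_modulus s m C1 C2 Cw b h0)) / Num.sqrt CZ.

(** The square root is the price of absorbing the chaining depth into a power of h; it blows up as
    b1 approaches min(b, |s|). *)
Definition high_const : R :=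
  chaining_const d (2^-1 : R) * (9 * Num.max size_const (2 * Cw * C2)) *
  Num.sqrt (2 + S.+1%:R / (Num.min b S%:R - b1)) / Num.sqrt CZ.

Definition process_const : R := if S%:R <= b1 then low_const else high_const.

Let b_gt0 : 0 < b.
Proof. by case/andP: b0 => p1 p2; exact: (lt_trans p1 p2). Qed.

(** If |s| <= b1, then |s| < b and [smoother_holder] allows a chain from level 0. If b1 < |s|, the
    Lipschitz bound with h^-(|s|+1) is good enough, because the rate only asks for h^(b1 - |s|). *)
Lemma process_rate : exists V : Omega -> \bar R,
  [/\ forall w, (0 <= V w)%E, measurable_fun setT V,
    {ae P, forall w, forall x, cube x ->
      ((`|\sum_i n%:R^-1 * smoother pt (om h) (Z i w) x|)%:E <= V w)%E} &
    (\int[P]_w V w <=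
       (process_const * (CZ / (Num.sqrt n%:R * h `^ (S%:R - Num.min S%:R b1))))%:E)%E ].
Proof.
have lwh := lw hlt hle.
have /andP[h_0 h_1] := lw_h lwh.
have cpt := lw_cube lwh.
have C10 := lw_C1 lwh; have C20 := lw_C2 lwh; have Cw0 := lw_Cw lwh.
have nR0 : 0 < n%:R :> R by rewrite ltr0n.
have /andP[b10 b1b] := b0.
have Kt0 : 0 <= taylor_const R (minn m (sfloor b)) d * Cw * C1.
  by rewrite !mulr_ge0 ?taylor_const_ge0// ltW.
have sc1 : 1 <= size_const by rewrite lerDl.
have sCZ : 0 < Num.sqrt CZ by rewrite sqrtr_gt0.
have sn : 0 < Num.sqrt n%:R :> R by rewrite sqrtr_gt0.
have sqE : Num.sqrt (CZ / n%:R) = CZ / Num.sqrt n%:R / Num.sqrt CZ.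
  rewrite sqrtrM ?(ltW CZ0)// sqrtrV ?ler0n//.
  rewrite -{2}(sqr_sqrtr (ltW CZ0)); field; rewrite !gt_eqF//.
rewrite /process_const; case: ifPn => [Sb|].
  have hh : hmin < h0 by apply: lt_le_trans hle.
  have Sb' : S%:R < b by apply: le_lt_trans b1b.
  set D := Num.max size_const (smoother_modulus s m C1 C2 Cw b h0).
  have D0 : 0 < D by rewrite lt_max (lt_le_trans ltr01).
  have r01 := @smoother_ratio01 R d s m b Sm Sb'.
  have [||V [V0 mV XV EV]] := @process_chaining R d dO Omega P n Z b CZ M J pt n0 CZ0 d0
    mZ cZ indZ mM hM EM cpt (om h) D (smoother_ratio s m b) 0%N D0 r01.
  - move=> f mm x hf cx.
    apply: le_trans (smoother_le_low b_gt0 Sm Sb' lw hlt hle hf cx) _.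
    by apply: ler_wpM2r; [exact: holder_bound_ge0 hf|rewrite le_max lexx].
  - move=> f mm x y k hf cx cy xy.
    apply: le_trans (smoother_holder b_gt0 Sm Sb' lw hh Kt0 hlt hle hf cx cy xy) _.
    have /andP[r0 _] := r01.
    apply: ler_wpM2r; first by rewrite exprn_ge0// ltW.
    by apply: ler_wpM2r; [exact: holder_bound_ge0 hf|rewrite le_max lexx orbT].
  exists V; split => //; apply: (le_trans EV); rewrite lee_fin.
  rewrite min_l// subrr powRr0 sqrtr1 !mulr1 sqE /low_const -/(chaining_const d _) -/D.
  by rewrite le_eqVlt; apply/orP; left; apply/eqP; field; rewrite !gt_eqF.
rewrite -ltNge => b1S.
set D0 := Num.max size_const (2 * Cw * C2).
have D00 : 0 < D0 by rewrite lt_max (lt_le_trans ltr01).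
set bb := Num.min b S%:R.
pose D := D0 * h `^ (bb - S%:R).
have Dp : 0 < D by rewrite mulr_gt0// powR_gt0.
(* h^(S+1) is the distance below which [smoother_lipschitz] improves on the size bound; it fixes the
   starting level. *)
have eta01 : 0 < h ^+ S.+1 <= 1 by rewrite exprn_gt0//= exprn_ile1// ltW.
have [k0 [k0h k0l]] := dyadic_level eta01.
have half01 : 0 < (2^-1 : R) < 1 by rewrite invr_gt0 ltr0n invf_lt1// ltr1n.
have [||V [V0 mV XV EV]] := @process_chaining R d dO Omega P n Z b CZ M J pt n0 CZ0 d0
    mZ cZ indZ mM hM EM cpt (om h) D 2^-1 k0 Dp half01.
- move=> f mm x hf cx.
  apply: le_trans (smoother_le b_gt0 Sm lwh hf cx) _.
  have mm0 := holder_bound_ge0 hf.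
  rewrite /D [leRHS]mulrAC -/bb; apply: ler_wpM2r; first exact: powR_ge0.
  by apply: ler_wpM2r => //; rewrite le_max lexx.
- move=> f mm x y k hf cx cy xy.
  have mm0 := holder_bound_ge0 hf.
  apply: le_trans (smoother_lipschitz lwh hf cx cy) _.
  have /andP[eta0 _] := eta01.
  apply: ler_pM.
  + by rewrite !mulr_ge0 ?powR_ge0// ltW.
  + by rewrite divr_ge0// ltW.
  + rewrite /D [leRHS]mulrAC -/bb; apply: ler_wpM2r; first exact: powR_ge0.
    by apply: ler_wpM2r => //; rewrite le_max lexx orbT.
  rewrite ler_pdivrMr// (le_trans xy)// exprD mulrC.
  by apply: ler_wpM2l k0h; rewrite exprn_ge0.
exists V; split => //; apply: (le_trans EV); rewrite lee_fin.
pose del := bb - b1.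
have del0 : 0 < del by rewrite subr_gt0 lt_min b1b.
rewrite (min_r (ltW b1S)).
have hdel1 : 1 <= h `^ (- (2 * del)).
  rewrite powRN invf_ge1 ?powR_gt0// -[leRHS](powRr0 h).
  by apply: ger_powR; rewrite ?h_0 ?(ltW h_1)// mulr_ge0// ltW.
(* Sublinearity of the logarithm gives 2 del ln(1/h) <= h^(-2 del). After the square root the loss
   is h^(-del), exactly the gap between h^(bb - S) and h^(b1 - S). *)
have k0b : k0.+1%:R <= (2 + S.+1%:R / del) * h `^ (- (2 * del)).
  have lh : 2 * del * ln h^-1 <= h `^ (- (2 * del)).
    have := @ln_sublinear R (h `^ (- (2 * del))) (powR_gt0 _ h_0).
    by rewrite ln_powR mulNr -mulrN -lnV ?posrE// => /ltW.
  apply: (le_trans k0l).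
  rewrite -exprVn lnXn ?invr_gt0// -[_ *+ S.+1]mulr_natl.
  rewrite [leRHS]mulrDl; apply: lerD; first by rewrite ler_peMr.
  rewrite mulrAC ler_pdivlMr//.
  have : 0 <= S.+1%:R :> R by [].
  move: (S.+1%:R : R) (ln h^-1) (h `^ _) lh => u v z uv u0.
  by rewrite [leLHS](_ : _ = u * (2 * del * v)); [rewrite ler_wpM2l|ring].
have k0s : Num.sqrt k0.+1%:R <= Num.sqrt (2 + S.+1%:R / del) * h `^ (- del).
  have -> : h `^ (- del) = Num.sqrt (h `^ (- (2 * del))).
    have -> : - (2 * del) = - del + - del by ring.
    by rewrite powRD ?(gt_eqF h_0) ?implybT// -expr2 sqrtr_sqr ger0_norm// powR_ge0.
  rewrite -sqrtrM; last by rewrite addr_ge0// divr_ge0// ltW.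
  exact: ler_wsqrtr.
rewrite -/(chaining_const d _) sqE /high_const -/bb -/del -/D0.
apply: (@le_trans _ _ (chaining_const d 2^-1 * (9 * D * (CZ / Num.sqrt n%:R / Num.sqrt CZ)) *
   (Num.sqrt (2 + S.+1%:R / del) * h `^ (- del)))).
  apply: ler_wpM2l => //.
  apply: mulr_ge0; first exact: ltW (chaining_const_gt0 _ _).
  apply: mulr_ge0; first exact: (mulr_ge0 (ler0n _ 9) (ltW Dp)).
  by rewrite !divr_ge0 ?sqrtr_ge0// ltW.
rewrite /D.
have -> : h `^ (S%:R - b1) = (h `^ (bb - S%:R) * h `^ (- del))^-1.
  rewrite -powRD ?(gt_eqF h_0) ?implybT// -powRN; congr (_ `^ _).
  by rewrite /del; ring.
have q0 : 0 < h `^ (bb - S%:R) by exact: powR_gt0.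
have q1 : 0 < h `^ (- del) by exact: powR_gt0.
rewrite le_eqVlt; apply/orP; left; apply/eqP.
move: q0 q1 sCZ sn; move: (h `^ (bb - S%:R)) (h `^ (- del)) => u v.
move: (Num.sqrt CZ) (Num.sqrt n%:R) => y z u0 v0 y0 z0.
by field; rewrite !gt_eqF.
Qed.

End process_rate.

(** * Assembly of the error bound *)

Lemma sup_norm_ge0 (R : realType) (d : nat) (f : 'rV[R]_d -> R) : (0 <= sup_norm f)%E.
Proof.
apply: (@le_trans _ _ (`|f 0|)%:E); first by rewrite lee_fin.
by apply: ereal_sup_ubound; exists 0 => // r; rewrite mxE lexx ler01.
Qed.

Theorem theorem1 (R : realType) (d : nat) (hd : (0 < d)%N)
  (alpha beta L CZ : R)
  (halpha : 0 < alpha) (hbeta : 0 < beta) (hL : 0 < L) (hCZ : 0 < CZ)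
  (s : {ffun 'I_d -> nat}) (hs : (multi_size s <= sfloor alpha)%N)
  (p : nat -> 'I_d -> nat)
  (xi : forall n (r : 'I_d), 'I_(p n r) -> R)
  (hxi : forall n, product_design (xi n))
  (hreg : regular_design xi)
  (w : forall n, grid (p n) -> 'rV[R]_d -> R -> R)
  (c h0 : R) (hc : 0 < c) (hh0 : 0 < h0 < 1)
  (hw : weights_assumption s (sfloor alpha) xi w c h0)
  (zeta : R) (hzeta : 0 < zeta)
  (beta1 : R) (hbeta1 : 0 < beta1 < beta) :
  exists (K : R) (n0 p0 : nat),
    forall n : nat, (n0 <= n)%N -> (p0 <= pmin (p n))%N ->
    forall h : R, c / (pmin (p n))%:R < h -> h <= h0 ->
    forall mu : 'rV[R]_d -> R, holder_class alpha L mu ->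
    forall (dO : measure_display) (Omega : measurableType dO)
      (P : probability Omega R)
      (Z : 'I_n -> Omega -> 'rV[R]_d -> R)
      (eps : 'I_n -> grid (p n) -> Omega -> R),
    functional_data P beta CZ zeta Z eps ->
    (((rate alpha beta1 L CZ zeta (noise_sd P eps) s n (p n) h)^-1)%:E *
       \int[P]_om
         sup_norm (fun x : 'rV[R]_d =>
           (linear_estimator (w n) (observation (xi n) mu Z eps) h om x -
            cube_pderiv s mu x)%R)
     <= K%:E)%E.
Proof.
have /andP[h00 h01] := hh0.
case: hreg => Cd [Cd0 reg].
case: hw => C1 [C2 [p0 [C10 C20 hw']]].
pose Cw := Cd * Num.max 1 c^-1 ^+ d.
pose m := sfloor alpha.
pose Kb := taylor_const R m d * Cw * C1.
pose Kp := @process_const R d beta beta1 CZ s m C1 C2 Cw h0.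
pose Kn := @noise_const R d C1 C2 Cw h0.
(* [K] is fixed before n, h, mu and the probability space. One observation makes the averages
   meaningful, and pmin >= 1 makes the grid nonempty. *)
exists (Kb + Kp + Kn), 1%N, (maxn p0 1) => n n1.
rewrite geq_max => /andP[pp0 p1] h hlt hle mu [cmu nmu] dO Omega P Z eps.
move=> [hZ _ heps ind].
set sigma := noise_sd P eps.
set a := rate _ _ _ _ _ _ _ _ _ _.
have lw g : c / (pmin (p n))%:R < g -> g <= h0 ->
    local_weights (design_point (xi n)) (fun j x => w n j x g) s m
      (grid_card (p n))%:R g C1 C2 Cw.
  move=> g1 g2; apply: (@local_weights_design R d n s m p xi w c h0) => //.
  - exact: reg.
  - exact: hw'.
have lwh := lw h hlt hle.
have /andP[h_0 h_1] := lw_h lwh.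
have cpt := lw_cube lwh.
have nR0 : 0 < n%:R :> R by rewrite ltr0n.
have a1 : L * h `^ (alpha - (multi_size s)%:R) <= a by rewrite /a /rate /= le_max lexx.
have a2 : zeta * sigma * Num.sqrt (ln h^-1 /
    (n%:R * (grid_card (p n))%:R * h ^+ (d + 2 * multi_size s))) <= a.
  by rewrite /a /rate /= !le_max lexx orbT.
have a3 : CZ / (Num.sqrt n%:R * h `^ ((multi_size s)%:R -
    Num.min (multi_size s)%:R beta1)) <= a.
  by rewrite /a /rate /= !le_max lexx !orbT.
(* The bias term keeps the rate positive even if the noise vanishes, so its inverse is a true
   inverse. *)
have a0 : 0 < a by apply: lt_le_trans a1; rewrite mulr_gt0// powR_gt0.
have /choice[M hM] : forall i, exists M : Omega -> R,
    [/\ measurable_fun setT M,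
        {ae P, forall om, (holder_norm beta (Z i om) <= (M om)%:E)%E}
      & ('E_P[fun om => (M om ^+ 2)%R] <= CZ%:E)%E ].
  by move=> i; have [[_ _ ?] _] := hZ i.
have mZ i x : cube x -> measurable_fun setT (Z i ^~ x).
  by have [[h1 _ _] _] := hZ i; exact: h1.
have cZ i x : cube x -> centered P (Z i ^~ x).
  by have [_ h1] := hZ i; exact: h1.
have indZ : mutually_independent P (fun i => sigma_process (Z i)).
  exact: (mutually_independent_comp (@inl_inj _ _) ind).
have indeps : mutually_independent P
    (fun ij : 'I_n * grid (p n) => sigma_variable (eps ij.1 ij.2)).
  exact: (mutually_independent_comp (@inr_inj _ _) ind).
have hold i : {ae P, forall om, holder_bound beta (M i om) (Z i om)}.
  have [_ hMi _] := hM i; apply: filterS hMi => om hom.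
  by apply: holder_norm_bound => //; have [[_ h1 _] _] := hZ i; exact: h1.
have mM i : measurable_fun setT (M i) by have [] := hM i.
have EM i : (\int[P]_om (M i om ^+ 2)%:E <= CZ%:E)%E.
  by have [_ _] := hM i; rewrite unlock.
have [V1 [V10 mV1 XV1 EV1]] := @process_rate R d dO Omega P n Z beta beta1 CZ M _ _
  (fun g j x => w n j x g) s m _ C1 C2 Cw h _ h0 n1 hCZ hd hbeta1 mZ cZ indZ mM hold EM lw
  hlt hle hs.
have veps i j : fine (variance0 P (eps i j)) <= sigma ^+ 2.
  rewrite /sigma /noise_sd sqr_sqrtr.
    by apply: le_trans (le_bigmax _ _ i); exact: (le_bigmax _ _ j).
  exact: bigmax_ge_id.
have [V2 [V20 mV2 XV2 EV2]] := @noise_rate R d dO Omega P n _ eps zeta sigma _ _ s m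
  _ h h0 C1 C2 Cw a n1 hd
  (fun i j => let: And4 h1 _ _ _ := heps i j in h1)
  (fun i j => let: And4 _ h1 _ _ := heps i j in h1) veps
  (fun i j => let: And4 _ _ _ h1 := heps i j in h1)
  indeps lwh hle h01 (ltW hzeta) (sqrtr_ge0 _) a0 a2.
have Kp0 : 0 <= Kp.
  have s1 : 0 <= Num.sqrt CZ by exact: sqrtr_ge0.
  have t0 : 0 < 1 + taylor_const R (minn m (sfloor beta)) d * Cw * C1.
    apply: ltr_pwDl => //.
    exact: (mulr_ge0 (mulr_ge0 (taylor_const_ge0 _ _ _) (ltW (lw_Cw lwh))) (ltW C10)).
  rewrite /Kp /process_const /low_const /high_const; case: ifP => _.
    rewrite divr_ge0// mulr_ge0 ?(ltW (chaining_const_gt0 _ _))//.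
    by rewrite mulr_ge0// le_max ltW.
  rewrite divr_ge0// mulr_ge0 ?sqrtr_ge0// mulr_ge0 ?(ltW (chaining_const_gt0 _ _))//.
  by rewrite mulr_ge0// le_max ltW.
have Kb0 : 0 <= Kb.
  exact: (mulr_ge0 (mulr_ge0 (taylor_const_ge0 _ _ _) (ltW (lw_Cw lwh))) (ltW C10)).
have hmu : holder_bound alpha L mu by exact: holder_norm_bound.
have bias x : cube x ->
    `|smoother (design_point (xi n)) (fun j x => w n j x h) mu x - cube_pderiv s mu x| <= Kb * a.
  move=> cx; have := smoother_bias lwh halpha hmu cx hs.
  (* For a = alpha and m = sfloor alpha the exponent min(a, m+1) is alpha, so the bias is [Kb] times
     the first term of the rate. *)
  rewrite hs mul1r minnn min_l ?sfloor_ge// => /le_trans; apply.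
  by rewrite -/Kb -[leLHS]mulrA ler_wpM2l.
have int_le : (\int[P]_om sup_norm (fun x : 'rV[R]_d =>
           (linear_estimator (w n) (observation (xi n) mu Z eps) h om x -
            cube_pderiv s mu x)%R) <= ((Kb + Kp + Kn) * a)%:E)%E.
  pose V om := ((Kb * a)%:E + (V1 om + V2 om))%E.
  have Kba : 0 <= Kb * a by rewrite mulr_ge0// ltW.
  have mV12 : measurable_fun setT (fun om => V1 om + V2 om)%E by exact: emeasurable_funD.
  have V120 om : (0 <= V1 om + V2 om)%E by exact: adde_ge0.
  apply: (@le_trans _ _ (\int[P]_om V om)%E).
    apply: ae_le_integral_ge0.
    - by move=> om; exact: sup_norm_ge0.
    - by move=> om; rewrite adde_ge0.
    - by apply: emeasurable_funD => //; exact: measurable_cst.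
    apply: filterS2 XV1 XV2 => om XV1 XV2.
    apply: ge_ereal_sup => _ [x cx <-].
    (* Linearity in the observations splits the error into bias, smoothed processes and averaged
       noise; exchanging the sums over i and j puts the process part in the form bounded by [V1]. *)
    have -> : linear_estimator (w n) (observation (xi n) mu Z eps) h om x -
        cube_pderiv s mu x =
      (smoother (design_point (xi n)) (fun j x => w n j x h) mu x - cube_pderiv s mu x) +
      (\sum_i n%:R^-1 * smoother (design_point (xi n)) (fun j x => w n j x h) (Z i om) x +
       \sum_j w n j x h * (n%:R^-1 * \sum_i eps i j om)).
      rewrite addrAC; congr (_ - _).
      rewrite /linear_estimator /smoother.
      have -> : \sum_i n%:R^-1 * (\sum_j w n j x h * Z i om (design_point (xi n) j)) =
          \sum_j w n j x h * (n%:R^-1 * \sum_i Z i om (design_point (xi n) j)).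
        under eq_bigr do rewrite mulr_sumr; rewrite exchange_big /=.
        apply: eq_bigr => j _; rewrite !mulr_sumr; apply: eq_bigr => i _.
        by rewrite mulrCA.
      rewrite -!big_split /=; apply: eq_bigr => j _.
      rewrite /observation !big_split /= sumr_const card_ord -[_ *+ n]mulr_natl.
      by field; rewrite gt_eqF.
    rewrite /V; apply: (@le_trans _ _ ((Kb * a)%:E +
      ((`|\sum_i n%:R^-1 * smoother (design_point (xi n)) (fun j x => w n j x h) (Z i om) x|)%:E +
       (`|\sum_j w n j x h * (n%:R^-1 * \sum_i eps i j om)|)%:E))%E).
      rewrite -!EFinD lee_fin (le_trans (ler_normD _ _))// lerD ?bias//.
      exact: ler_normD.
    by rewrite leeD2l// leeD ?XV1 ?XV2.
  rewrite /V (ge0_integralD P measurableT _ (measurable_cst _) _ mV12)//.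
  rewrite integral_cst//.
  have /= -> := @probability_setT _ _ _ P.
  rewrite mule1 (ge0_integralD P measurableT _ mV1 _ mV2)//.
  have -> : (Kb + Kp + Kn) * a = Kb * a + (Kp * a + Kn * a) by ring.
  rewrite 2!EFinD; apply: leeD => //; apply: leeD => //.
  by apply: (le_trans EV1); rewrite lee_fin; exact: ler_wpM2l.
apply: (@le_trans _ _ ((a^-1)%:E * ((Kb + Kp + Kn) * a)%:E)%E).
  by apply: lee_wpmul2l => //; rewrite lee_fin invr_ge0 ltW.
by rewrite -EFinM mulrCA mulVf ?gt_eqF// mulr1.
Qed.
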